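(* Let $1<p<\infty$ and $s>1+\frac dp$. Then for any $M>0$, there exists $u\in\mathcal S(\mathbb R^d)$ with $\nabla\cdot u=0$, such that $$\|\partial u\|_{\mathrm{BMO}}\le1,$$ but $$\|J^s((u\cdot\nabla)u)-(u\cdot\nabla)(J^su)\|_p>M\|J^su\|_p.$$
   Context: $d$ is the dimension of the underlying space $\mathbb R^d$. $\mathcal S(\mathbb R^d)$ is the space of Schwartz functions; here $u=(u_1,\dots,u_d)$ is a vector field on $\mathbb R^d$, and $u\in\mathcal S(\mathbb R^d)$ means that each component is Schwartz. $\|\cdot\|_p$ is the $L^p(\mathbb R^d)$ norm; norms of vector- or matrix-valued functions are taken componentwise (summed over components). $J^s=(1-\Delta)^{s/2}$ is the Fourier multiplier with symbol $(1+|\xi|^2)^{s/2}$, acting componentwise. $\partial=\nabla=(\partial_1,\dots,\partial_d)$, $\partial u$ is the matrix of all first derivatives of $u$, $\nabla\cdot u=\sum_{l=1}^d\partial_lu_l$, and $u\cdot\nabla=\sum_{l=1}^du_l\partial_l$. The BMO norm is $\|v\|_{\mathrm{BMO}}=\sup_Q\frac1{|Q|}\int_Q|v(y)-v_Q|\,dy$, where $v_Q$ is the average of $v$ over $Q$ and the supremum is over all cubes $Q\subset\mathbb R^d$.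
   Formalization: The dimension is assumed to satisfy d ≥ 2; for d = 1 the only divergence-free Schwartz field is u = 0, so the strict inequality would read 0 > 0 and the claim fails. *)

(* Defs.v *)
From HB Require Import structures.
From mathcomp Require Import all_boot all_order all_algebra.
From mathcomp Require Import all_classical all_reals all_analysis.
From mathcomp Require Import complex.

Set Implicit Arguments.
Unset Strict Implicit.
Unset Printing Implicit Defensive.
Import Order.TTheory GRing.Theory Num.Theory.
Import numFieldNormedType.Exports.
Local Open Scope classical_set_scope.
Local Open Scope complex_scope.
Local Open Scope ring_scope.

Definition rv_display : measure_display. Proof. exact: default_measure_display. Qed.

(* R^n carries the product (= Borel) sigma-algebra, generated by the
   coordinate maps, as the library does for n.-tuple. *)
Section rv_measurable.
Variables (R : realType) (n : nat).

Definition rv_coord (i : 'I_n) (x : 'rV[R]_n) : measurableTypeR R := x ord0 i.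

Let rv_set0 : g_sigma_preimage rv_coord set0.
Proof. exact: sigma_algebra0. Qed.

Let rv_setC A : g_sigma_preimage rv_coord A -> g_sigma_preimage rv_coord (~` A).
Proof. exact: sigma_algebraC. Qed.

Let rv_bigcup (F : _^nat) : (forall i, g_sigma_preimage rv_coord (F i)) ->
  g_sigma_preimage rv_coord (\bigcup_i (F i)).
Proof. exact: sigma_algebra_bigcup. Qed.

HB.instance Definition _ := @isMeasurable.Build rv_display
  'rV[R]_n (g_sigma_preimage rv_coord) rv_set0 rv_setC rv_bigcup.

Lemma measurable_rv_coord i : measurable_fun [set: 'rV[R]_n] (rv_coord i).
Proof.
move=> _ Y mY; rewrite setTI; apply: sub_sigma_algebra => /=.
rewrite -bigcup_seq/=; exists i => /=; first by rewrite mem_index_enum.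
by exists Y => //; rewrite setTI.
Qed.

Lemma measurable_fun_rvP d (T : measurableType d) (f : T -> 'rV[R]_n) :
  (forall i, measurable_fun [set: T] (rv_coord i \o f)) ->
  measurable_fun [set: T] f.
Proof.
move=> mf _ A mA; rewrite setTI.
have : image_set_system setT f measurable A; last first.
  by rewrite /image_set_system/= setTI.
move: A mA; apply: smallest_sub.
  exact/sigma_algebra_image/sigma_algebra_measurable.
move=> A; rewrite -bigcup_seq/= => -[i _ [B mB <-]].
by rewrite /image_set_system/= !setTI -[X in measurable X]setTI; exact: mf.
Qed.

End rv_measurable.

Lemma product_sigma_finite d1 d2 (T1 : measurableType d1)
    (T2 : measurableType d2) (R : realType)
    (m1 : {sigma_finite_measure set T1 -> \bar R})
    (m2 : {sigma_finite_measure set T2 -> \bar R}) :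
  sigma_finite setT (m1 \x m2)%E.
Proof.
have /sigma_finiteP[F [TF ndF Foo]] := sigma_finiteT m1.
have /sigma_finiteP[G [TG ndG Goo]] := sigma_finiteT m2.
exists (fun k => F k `*` G k).
  rewrite -setXTT TF TG predeqE => -[x y]; split.
    move=> [/= [i _ Fix] [k _ Gky]]; exists (maxn i k) => //; split.
    - by move: x Fix; exact/subsetPset/ndF/leq_maxl.
    - by move: y Gky; exact/subsetPset/ndG/leq_maxr.
  by move=> [i _ []/= ? ?]; split; exists i.
move=> k; have [? ?] := Foo k; have [? ?] := Goo k.
split; first exact: measurableX.
by rewrite product_measure1E// lte_mul_pinfty// ge0_fin_numE.
Qed.

Section lebesgue.
Variable R : realType.

Definition rv_cons n (x : measurableTypeR R * 'rV[R]_n) : 'rV[R]_n.+1 :=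
  \row_j (if unlift ord0 j is Some k then x.2 ord0 k else x.1).

Definition rv_uncons n (x : 'rV[R]_n.+1) : measurableTypeR R * 'rV[R]_n :=
  (x ord0 ord0, \row_j x ord0 (lift ord0 j)).

Lemma rv_cons0 n x : @rv_cons n x ord0 ord0 = x.1.
Proof. by rewrite mxE unlift_none. Qed.

Lemma rv_consS n x j : @rv_cons n x ord0 (lift ord0 j) = x.2 ord0 j.
Proof. by rewrite mxE liftK. Qed.

Lemma rv_consK n : cancel (@rv_cons n) (@rv_uncons n).
Proof.
move=> x; rewrite /rv_uncons rv_cons0 [RHS]surjective_pairing; congr pair.
by apply/rowP => j; rewrite mxE rv_consS.
Qed.

Lemma rv_unconsK n : cancel (@rv_uncons n) (@rv_cons n).
Proof.
move=> x; apply/rowP => j; have [->|i0] := eqVneq j ord0; first by rewrite rv_cons0.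
have [k jk] : exists k, j = lift ord0 k.
  by case: (unliftP ord0 j) i0 => [k ->|->]; [exists k|rewrite eqxx].
by rewrite jk rv_consS mxE.
Qed.

Lemma measurable_rv_cons n : measurable_fun setT (@rv_cons n).
Proof.
apply: measurable_fun_rvP => i.
have [->|i0] := eqVneq i ord0.
  rewrite (_ : _ \o _ = fst); first exact: measurable_fst.
  by apply/funext => x; rewrite /= /rv_coord rv_cons0.
have [k ->] : exists k, i = lift ord0 k.
  by case: (unliftP ord0 i) i0 => [k ->|->]; [exists k|rewrite eqxx].
rewrite (_ : _ \o _ = rv_coord k \o snd).
  by apply: measurableT_comp; [exact: measurable_rv_coord|exact: measurable_snd].
by apply/funext => x; rewrite /= /rv_coord rv_consS.
Qed.

Lemma measurable_rv_uncons n : measurable_fun setT (@rv_uncons n).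
Proof.
apply/measurable_fun_pairP; split; first exact: (measurable_rv_coord ord0).
apply: measurable_fun_rvP => i.
rewrite (_ : _ \o _ = rv_coord (lift ord0 i)); first exact: measurable_rv_coord.
by apply/funext => x; rewrite /= /rv_coord /= mxE.
Qed.

Section lebesgue_rvS.
Variables (n : nat) (mu : {sigma_finite_measure set 'rV[R]_n -> \bar R}).

Definition lebesgue_rvS : set 'rV[R]_n.+1 -> \bar R :=
  pushforward (@lebesgue_measure R \x mu)%E (@rv_cons n).

Let lebesgue_rvS0 : lebesgue_rvS set0 = 0%E.
Proof. by rewrite /lebesgue_rvS /pushforward preimage_set0 measure0. Qed.

Let lebesgue_rvS_ge0 A : (0 <= lebesgue_rvS A)%E.
Proof. by apply: measure_ge0; exact: measurable_rv_cons. Qed.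

Let lebesgue_rvS_sigma_additive : semi_sigma_additive lebesgue_rvS.
Proof.
by apply: measure_semi_sigma_additive; exact: measurable_rv_cons.
Qed.

HB.instance Definition _ := isMeasure.Build _ _ _ lebesgue_rvS
  lebesgue_rvS0 lebesgue_rvS_ge0 lebesgue_rvS_sigma_additive.

Let lebesgue_rvS_sigma_finite : sigma_finite setT lebesgue_rvS.
Proof.
have [F FT Foo] := product_sigma_finite (@lebesgue_measure R) mu.
exists (fun i => @rv_uncons n @^-1` F i) => [|i].
  by rewrite -preimage_bigcup -FT preimage_setT.
have [mF Foo'] := Foo i; split.
  by rewrite -[X in measurable X]setTI; exact: measurable_rv_uncons.
rewrite /lebesgue_rvS /pushforward -comp_preimage.
rewrite (_ : _ @^-1` F i = F i)//.
by apply/seteqP; split => x /=; rewrite rv_consK.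
Qed.

HB.instance Definition _ := Measure_isSigmaFinite.Build _ _ _ lebesgue_rvS
  lebesgue_rvS_sigma_finite.

End lebesgue_rvS.

(* Lebesgue measure on R^n, as an n-fold product; sigma-finiteness is carried
   along because the product of two measures requires it. *)
Fixpoint lebesgue_rv n : {sigma_finite_measure set 'rV[R]_n -> \bar R} :=
  match n with
  | 0 => dirac (0 : 'rV[R]_0)
  | m.+1 => lebesgue_rvS (lebesgue_rv m)
  end.

Lemma lebesgue_rv_box n (A : 'I_n -> set R) :
  (forall i, measurable (A i : set (measurableTypeR R))) ->
  lebesgue_rv n [set x | forall i, A i (x ord0 i)] =
    (\prod_(i < n) lebesgue_measure (A i))%E.
Proof.
elim: n A => [|n IH] A mA.
  by rewrite big_ord0 /= diracE mem_set//= => -[].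
rewrite big_ord_recl /= /lebesgue_rvS /pushforward -IH//.
have mB : measurable
    [set x : 'rV[R]_n | forall i, A (lift ord0 i) (x ord0 i)].
  rewrite (_ : mkset _ = \bigcap_(i in [set: 'I_n])
      (rv_coord i @^-1` A (lift ord0 i))); last first.
    by apply/seteqP; split => [x Ax i _|x Ax i]; [exact: Ax|exact: (Ax i)].
  apply: fin_bigcap_measurable; first exact: finite_finset.
  by move=> i _; rewrite -[X in measurable X]setTI; exact: measurable_rv_coord.
rewrite -product_measure1E//.
congr (_ _); apply/seteqP; split => [x /= Ax|x [/= Ax0 Ax] i].
  by split => /= [|i]; [have := Ax ord0|have := Ax (lift ord0 i)];
    rewrite (rv_cons0, rv_consS).
by case: (unliftP ord0 i) => [j ->|->]; rewrite (rv_consS, rv_cons0).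
Qed.

End lebesgue.

Section fourier.
Variables (R : realType) (n : nat).
Local Notation mu := (lebesgue_rv R n).
Implicit Types (f g : 'rV[R]_n -> R[i]) (x xi : 'rV[R]_n).

Definition cintegral f : R[i] :=
  (\int[mu]_x complex.Re (f x)) +i* (\int[mu]_x complex.Im (f x)).

Definition cis (t : R) : R[i] := cos t +i* sin t.

Definition dotp x xi : R := \sum_(i < n) x ord0 i * xi ord0 i.

(* Convention e^(-i x.xi), under which -Delta has symbol |xi|^2; the inverse
   then carries the factor (2 pi)^(-n). *)
Definition fourier f xi : R[i] := cintegral (fun x => cis (- dotp x xi) * f x).

Definition inv_fourier g x : R[i] :=
  ((2 * pi) ^- n)%:C * cintegral (fun xi => cis (dotp x xi) * g xi).

Definition fourier_multiplier (m : 'rV[R]_n -> R) f : 'rV[R]_n -> R[i] :=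
  inv_fourier (fun xi => (m xi)%:C * fourier f xi).

(* J^s = (1 - Laplacian)^(s/2) *)
Definition bessel (s : R) : ('rV[R]_n -> R[i]) -> ('rV[R]_n -> R[i]) :=
  fourier_multiplier (fun xi => (1 + dotp xi xi) `^ (s / 2)).

Definition cLnorm (p : R) f : \bar R :=
  Lnorm mu p%:E (fun x => (ComplexField.Normc.normc (f x))%:E).

End fourier.

Section calculus.
Variables (R : realType) (n : nat).
Implicit Types (v : 'rV[R]_n -> R) (f : 'rV[R]_n -> R[i])
  (u : 'rV[R]_n -> 'rV[R]_n) (k j : 'I_n).

Definition partial k v : 'rV[R]_n -> R :=
  fun x => 'D_(delta_mx ord0 k : 'rV[R]_n) v x.

(* R[i] has no normed R-module structure in the library, hence the separate
   differentiation of real and imaginary parts. *)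
Definition cpartial k f : 'rV[R]_n -> R[i] :=
  fun x => partial k (fun y => complex.Re (f y)) x +i*
           partial k (fun y => complex.Im (f y)) x.

(* b lists the directions of differentiation, so that b ranges over all mixed
   partial derivatives of all orders. *)
Definition iter_partial (b : seq 'I_n) v : 'rV[R]_n -> R := foldr partial v b.

Definition smooth v : Prop :=
  forall b x, differentiable (iter_partial b v) x.

Definition schwartz v : Prop :=
  smooth v /\
  forall (a : 'I_n -> nat) (b : seq 'I_n), exists C : R,
    forall x : 'rV[R]_n,
    `|(\prod_(i < n) x ord0 i ^+ a i) * iter_partial b v x| <= C.

Definition component u j : 'rV[R]_n -> R := fun x => u x ord0 j.

Definition divergence u : 'rV[R]_n -> R :=
  fun x => \sum_(l < n) partial l (component u l) x.

Definition advection u f : 'rV[R]_n -> R[i] :=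
  fun x => \sum_(l < n) (component u l x)%:C * cpartial l f x.

Definition ccomponent u j : 'rV[R]_n -> R[i] := fun x => (component u j x)%:C.

(* j-th component of J^s ((u . nabla) u) - (u . nabla) (J^s u) *)
Definition commutator (s : R) u j : 'rV[R]_n -> R[i] :=
  fun x => bessel s (advection u (ccomponent u j)) x -
           advection u (bessel s (ccomponent u j)) x.

End calculus.

Section bmo.
Variables (R : realType) (n : nat).
Local Notation mu := (lebesgue_rv R n).

Definition cube (a : 'rV[R]_n) (l : R) : set 'rV[R]_n :=
  [set x | forall i, a ord0 i <= x ord0 i <= a ord0 i + l].

Definition cubes : set (set 'rV[R]_n) :=
  [set Q | exists a l, 0 < l /\ Q = cube a l].

Definition average (Q : set 'rV[R]_n) (v : 'rV[R]_n -> R) : R :=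
  (fine (mu Q))^-1 * \int[mu]_(y in Q) v y.

Definition bmo_norm (v : 'rV[R]_n -> R) : \bar R :=
  ereal_sup [set (((fine (mu Q))^-1)%:E *
    \int[mu]_(y in Q) (`|v y - average Q v|%:E))%E | Q in cubes].

End bmo.

(* Main.v *)
Require Import Defs.
From HB Require Import structures.
From mathcomp Require Import all_boot all_order all_algebra.
From mathcomp Require Import all_classical all_reals all_analysis measurable_realfun.
From mathcomp Require Import complex.
From mathcomp Require Import ring lra.

Import Order.TTheory GRing.Theory Num.Theory.
Import numFieldNormedType.Exports.
Local Open Scope classical_set_scope.
Local Open Scope complex_scope.
Local Open Scope ring_scope.

(** Suppose that, for some M, no field violates the bound: every admissible u
satisfies Sum_j |T(u)_j|_p <= M Sum_j |J^s u_j|_p, where T(u) is the commutator.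
The contradiction comes from letting a high-frequency wave packet ride on a
background whose gradient is large at the origin but bounded in BMO.

Polarisation. T is quadratic in u. If b and w are divergence free and the
gradients of b and del w are small in BMO, then b + del w and b - del w are both
admissible, and the difference of their commutators is 2 del times the symmetric
bilinear form attached to T. Hence [polar_bound]: the L^p norm of the
polarisation of T at (b, w) is at most a multiple of
M (|J^s w|_p + |J^s b|_p / del).

High frequency. Let w be the real or imaginary part of a packet
exp(i nu x_0) (h0 + h1 / nu) whose amplitude h0 has no component along the
direction 0 of propagation. On functions of frequency nu the operator nu^-s J^s
tends to the identity ([modulated_bessel_cvg]). Of the four terms of component 0
of the polarisation, J^s (b . grad w) and b . grad J^s w cancel to leading order,
w . grad J^s b carries no power of nu, and J^s (w . grad b) has nothing to cancel
with. So nu^-s times the polarisation converges in modulus to |h0 . grad b_0|,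
uniformly ([polar_packets_cvg]). On the other side |J^s w|_p <= C nu^s with C
independent of b, and del can be taken of order 1 / nu, so that the upper bound
is nu^s (C M + O(nu^(1 - s))). As s > 1, letting nu tend to infinity bounds
h0 . grad b_0 on a fixed box by a constant that depends on M but not on b.

The background. For a Gaussian vortex V in the plane of the coordinates 0 and 1,
b = c Sum_(m < K) 4^m V(x / 4^m) has the gradient c Sum_m (grad V)(x / 4^m). Near
the origin d_1 b_0 has size c K times a positive constant ([partial_swirl_box]).
Its mean oscillation is bounded independently of K ([osc_lacunary]): on a cube of
side l the dilates with 4^m > l are nearly constant, those with 4^m < l are small
outside a thin slab, and the two kinds of error decay geometrically away from
4^m = l. Taking K large contradicts the constant found above.

All functions involved are combinations of monomials times plane waves times
Gaussians ([wave]). Their Fourier transforms are computed from that of a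
Gaussian, so Fourier inversion and the rules for J^s are obtained on this class
by induction. *)
Set Implicit Arguments.
Unset Strict Implicit.
Unset Printing Implicit Defensive.

(** * Lebesgue measure on row vectors: translations and tensor products *)
Section lebesgue_rv_theory.
Variable R : realType.
Local Notation lambda := (@lebesgue_measure R).

Lemma lebesgue_measure_shift (t : R) (A : set (measurableTypeR R)) :
  measurable A -> pushforward lambda
    ((fun x => x + t) : measurableTypeR R -> measurableTypeR R) A = lambda A.
Proof.
have mshift : measurable_fun setT
    ((fun x => x + t) : measurableTypeR R -> measurableTypeR R).
  exact: measurable_funD.
move=> mA.
pose nu := measure_function_pushforward__canonical__measure_function_Measure
  lambda mshift.
apply/esym/(@lebesgue_measure_unique _ nu) => //.
move=> _ [[a b]] _ <-; rewrite /nu /= /pushforward.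
rewrite (_ : _ @^-1` _ = [set` `]a - t, b - t]]); last first.
  by apply/seteqP; split => x /=; rewrite !in_itv/= ltrBlDr lerBrDr.
rewrite !lebesgue_measure_itv/= !lte_fin ltrD2r.
by case: ifP => // _; rewrite -!EFinD; congr EFin; ring.
Qed.

Lemma ge0_integral_shift (t : R) (f : R -> \bar R) :
  measurable_fun setT f -> (forall x, 0 <= f x)%E ->
  (\int[lambda]_x f (x + t)%R = \int[lambda]_x f x)%E.
Proof.
move=> mf f0.
pose sh : measurableTypeR R -> measurableTypeR R := fun x => x + t.
have mshift : measurable_fun setT sh by exact: measurable_funD.
transitivity (\int[pushforward lambda sh]_x f x)%E.
  by rewrite ge0_integral_pushforward// preimage_setT.
by apply: eq_measure_integral => //= A mA _; exact: lebesgue_measure_shift.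
Qed.

Section row_of_cons.
Variable n : nat.
Local Notation mu := (lebesgue_rv R n).

Lemma ge0_integral_rvS (f : 'rV[R]_n.+1 -> \bar R) :
  measurable_fun setT f -> (forall x, 0 <= f x)%E ->
  (\int[lebesgue_rv R n.+1]_x f x =
   \int[lambda]_x \int[mu]_y f (rv_cons (x, y)))%E.
Proof.
move=> mf f0.
rewrite [LHS](_ : _ = \int[(lambda \x mu)%E]_z f (rv_cons z))%E; last first.
  rewrite -[in RHS](preimage_setT (@rv_cons R n)).
  by rewrite -ge0_integral_pushforward//; exact: measurable_rv_cons.
rewrite fubini_tonelli1//.
exact: (measurableT_comp mf (@measurable_rv_cons R n)).
Qed.

End row_of_cons.

Lemma measurable_rv_coord_comp n (g : R -> R) (i : 'I_n) :
  measurable_fun setT g ->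
  measurable_fun setT (fun x : 'rV[R]_n => g (x ord0 i)).
Proof. by move=> mg; apply: (measurableT_comp mg (measurable_rv_coord i)). Qed.

Lemma measurable_prod_coord n (g : 'I_n -> R -> R) :
  (forall i, measurable_fun setT (g i)) ->
  measurable_fun setT (fun x : 'rV[R]_n => \prod_i g i (x ord0 i)).
Proof.
move=> mg; apply: measurable_prod => i _.
exact: measurable_rv_coord_comp.
Qed.

Lemma ge0_integral_prod_coord n (g : 'I_n -> R -> R) :
  (forall i, measurable_fun setT (g i)) -> (forall i x, 0 <= g i x) ->
  (\int[lebesgue_rv R n]_x (\prod_i g i (x ord0 i))%:E =
   \prod_i \int[lambda]_x (g i x)%:E)%E.
Proof.
elim: n g => [|n IH] g mg g0.
  rewrite big_ord0 /=.
  under eq_integral do rewrite big_ord0.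
  by rewrite integral_cst//= diracT mule1.
rewrite ge0_integral_rvS; last 2 first.
- by apply/measurable_EFinP; exact: measurable_prod_coord.
- by move=> x; rewrite lee_fin prodr_ge0.
rewrite big_ord_recl -IH//.
rewrite -ge0_integralZr//; last 3 first.
- by apply/measurable_EFinP; exact: mg.
- by move=> x _; rewrite lee_fin.
- by apply: integral_ge0 => x _; rewrite lee_fin prodr_ge0.
apply: eq_integral => x _.
rewrite -ge0_integralZl//; last 3 first.
- by apply/measurable_EFinP; exact: (measurable_prod_coord (g := fun i => g (lift ord0 i))).
- by move=> y _; rewrite lee_fin prodr_ge0.
- by rewrite lee_fin.
apply: eq_integral => y _; rewrite -EFinM big_ord_recl rv_cons0 /=.
by congr (_ * _)%:E; apply: eq_bigr => j _; rewrite rv_consS.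
Qed.

Lemma measurable_rv_shift n (v : 'rV[R]_n) :
  measurable_fun setT (fun x : 'rV[R]_n => x + v).
Proof.
apply: measurable_fun_rvP => i.
rewrite [X in measurable_fun _ X](_ : _ = fun x : 'rV[R]_n => x ord0 i + v ord0 i); last first.
  by apply/funext => x; rewrite /rv_coord /= mxE.
by apply: measurable_funD => //; exact: measurable_rv_coord.
Qed.

Lemma ge0_integral_rv_shift n (v : 'rV[R]_n) (f : 'rV[R]_n -> \bar R) :
  measurable_fun setT f -> (forall x, 0 <= f x)%E ->
  (\int[lebesgue_rv R n]_x f (x + v)%R = \int[lebesgue_rv R n]_x f x)%E.
Proof.
elim: n v f => [|n IH] v f mf f0.
  by apply: eq_integral => x _; congr f; apply/rowP => -[].
rewrite !ge0_integral_rvS//; last first.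
  exact: (measurableT_comp mf (measurable_rv_shift v)).
pose v' : 'rV[R]_n := \row_j v ord0 (lift ord0 j).
have cons_shift x y :
    rv_cons (x, y) + v = rv_cons (x + v ord0 ord0, y + v') :> 'rV[R]_n.+1.
  apply/rowP => i; rewrite mxE.
  by case: (unliftP ord0 i) => [j ->|->]; rewrite ?(rv_consS, rv_cons0)/= ?mxE.
have mc x : measurable_fun setT (fun y : 'rV[R]_n => f (rv_cons (x, y))).
  apply: (measurableT_comp mf).
  by apply: (measurableT_comp (@measurable_rv_cons R n)).
rewrite -[RHS](ge0_integral_shift (v ord0 ord0)); last 2 first.
- apply: (@measurable_fun_fubini_tonelli_F _ _ _ _ _ (lebesgue_rv R n)
    (f \o @rv_cons R n)); last by move=> z; exact: f0.
  exact: (measurableT_comp mf (@measurable_rv_cons R n)).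
- by move=> x; apply: integral_ge0 => y _; exact: f0.
apply: eq_integral => x _; rewrite -[RHS](IH v')//.
by apply: eq_integral => y _; rewrite cons_shift.
Qed.

Lemma integral_rv_shift n (v : 'rV[R]_n) (f : 'rV[R]_n -> \bar R) :
  measurable_fun setT f ->
  (\int[lebesgue_rv R n]_x f (x + v)%R = \int[lebesgue_rv R n]_x f x)%E.
Proof.
move=> mf; rewrite integralE [RHS]integralE.
rewrite -[X in (_ = X - _)%E](ge0_integral_rv_shift v)//; last first.
  exact: measurable_funepos.
rewrite -[X in (_ = _ - X)%E](ge0_integral_rv_shift v)//; last first.
  exact: measurable_funeneg.
by congr (_ - _)%E; apply: eq_integral => x _; rewrite ?funeposE ?funenegE.
Qed.

Lemma Rintegral_rv_shift n (v : 'rV[R]_n) (f : 'rV[R]_n -> R) :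
  measurable_fun setT f ->
  \int[lebesgue_rv R n]_x f (x + v) = \int[lebesgue_rv R n]_x f x.
Proof.
move=> mf; rewrite /Rintegral; congr fine.
by rewrite -[RHS](integral_rv_shift v)//; exact/measurable_EFinP.
Qed.

Lemma integrable_rv_shift n (v : 'rV[R]_n) (f : 'rV[R]_n -> R) :
  (lebesgue_rv R n).-integrable setT (EFin \o f) ->
  (lebesgue_rv R n).-integrable setT (fun x => (f (x + v))%:E).
Proof.
move=> /integrableP[mf foo]; apply/integrableP; split.
  exact: (measurableT_comp mf (measurable_rv_shift v)).
apply: le_lt_trans foo.
rewrite -[leRHS](ge0_integral_rv_shift v)//.
exact: (measurableT_comp _ mf).
Qed.

End lebesgue_rv_theory.

(** * Gradients and Gaussians *)
Section gradient.
Variables (R : realType) (V : normedModType R).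
Implicit Types (f g : V -> R) (x v : V) (L : V -> R).

(** Recording the derivatives as an explicit functional [L] lets the derivative
of a compound expression be assembled by the rules below. *)
Definition gradient f x L := differentiable f x /\ forall v, 'D_v f x = L v.

Lemma gradient_cst (a : R) x : gradient (fun=> a) x (fun=> 0).
Proof. by split => [|v]; [exact: differentiable_cst|rewrite derive_cst]. Qed.

Lemma gradientD f g x Lf Lg : gradient f x Lf -> gradient g x Lg ->
  gradient (fun y => f y + g y) x (fun v => Lf v + Lg v).
Proof.
move=> [df ef] [dg eg]; split=> [|v]; first exact: differentiableD.
by rewrite -ef -eg -deriveD//; exact: diff_derivable.
Qed.

Lemma gradientM f g x Lf Lg : gradient f x Lf -> gradient g x Lg ->
  gradient (fun y => f y * g y) x (fun v => f x * Lg v + g x * Lf v).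
Proof.
move=> [df ef] [dg eg]; split=> [|v]; first exact: differentiableM.
by rewrite -ef -eg -deriveM//; exact: diff_derivable.
Qed.

Lemma gradientZ (a : R) f x Lf : gradient f x Lf ->
  gradient (fun y => a * f y) x (fun v => a * Lf v).
Proof.
move=> gf; have [d e] := gradientM (gradient_cst a x) gf.
by split => // v; rewrite e mulr0 addr0.
Qed.

Lemma gradientB f g x Lf Lg : gradient f x Lf -> gradient g x Lg ->
  gradient (fun y => f y - g y) x (fun v => Lf v - Lg v).
Proof.
move=> gf gg; rewrite (_ : (fun y => f y - g y) = fun y => f y + (-1) * g y).
  have [d e] := gradientD gf (gradientZ (-1) gg).
  by split => // v; rewrite e mulN1r.
by apply/funext => y; rewrite mulN1r.
Qed.

Lemma gradient_comp f (h : R -> R) x Lf (l : R) : gradient f x Lf ->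
  is_derive (f x) (1 : R) h l ->
  gradient (fun y => h (f y)) x (fun v => l * Lf v).
Proof.
move=> [df ef] [dh eh].
have dh' : differentiable h (f x) by apply/derivable1_diffP.
split=> [|v]; first exact: (differentiable_comp df dh').
rewrite deriveE; last exact: (differentiable_comp df dh').
rewrite diff_comp//= -ef (deriveE _ df) -eh.
rewrite (deriveE _ dh') -[X in 'd h _ X](mulr1 ('d f x v)).
by rewrite [X in 'd h _ X](_ : _ = ('d f x v) *: (1 : R))// linearZ/= mulrC.
Qed.

Lemma gradient_sum (I : Type) (s : seq I) (f : I -> V -> R) x
    (L : I -> V -> R) : (forall i, gradient (f i) x (L i)) ->
  gradient (fun y => \sum_(i <- s) f i y) x (fun v => \sum_(i <- s) L i v).
Proof.
move=> gf; elim: s => [|i s IH].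
  rewrite (_ : (fun y => _) = fun=> 0); last first.
    by apply/funext => y; rewrite big_nil.
  by split=> [|v]; [exact: differentiable_cst|rewrite derive_cst big_nil].
rewrite (_ : (fun y => _) = fun y => f i y + \sum_(j <- s) f j y); last first.
  by apply/funext => y; rewrite big_cons.
have [d e] := gradientD (gf i) IH.
by split => // v; rewrite e big_cons.
Qed.

Lemma gradient_is_derive f x L v : gradient f x L -> is_derive x v f (L v).
Proof. by move=> [df ef]; split; [exact: diff_derivable|rewrite ef]. Qed.

End gradient.

Lemma gradient_id (R : realType) (x : R) : gradient (fun y : R => y) x id.
Proof. by split => [|v]; [exact: ex_diff|rewrite derive_id]. Qed.

Section rv_gradient.
Variables (R : realType) (n : nat).
Implicit Types (x y z v : 'rV[R]_n).

Lemma dotpC x y : dotp x y = dotp y x.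
Proof. by apply: eq_bigr => i _; rewrite mulrC. Qed.

Lemma dotpDl x y z : dotp (x + y) z = dotp x z + dotp y z.
Proof. by rewrite -big_split; apply: eq_bigr => i _; rewrite mxE mulrDl. Qed.

Lemma dotpZl (a : R) x y : dotp (a *: x) y = a * dotp x y.
Proof. by rewrite mulr_sumr; apply: eq_bigr => i _; rewrite mxE mulrA. Qed.

Lemma dotpDr x y z : dotp z (x + y) = dotp z x + dotp z y.
Proof. by rewrite !(dotpC z) dotpDl. Qed.

Lemma dotpZr (a : R) x y : dotp y (a *: x) = a * dotp y x.
Proof. by rewrite !(dotpC y) dotpZl. Qed.

Lemma dotpNl x y : dotp (- x) y = - dotp x y.
Proof. by rewrite -scaleN1r dotpZl mulN1r. Qed.

Lemma dotpNr x y : dotp x (- y) = - dotp x y.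
Proof. by rewrite !(dotpC x) dotpNl. Qed.

Lemma dotp0l x : dotp 0 x = 0.
Proof. by rewrite -(scale0r 0) dotpZl mul0r. Qed.

Lemma dotp_deltar x k : dotp x (delta_mx ord0 k) = x ord0 k.
Proof.
rewrite /dotp (bigD1 k)//= mxE !eqxx mulr1 big1 ?addr0// => i ik.
by rewrite mxE eqxx (negbTE ik) mulr0.
Qed.

Lemma dotp_ge0 x : 0 <= dotp x x.
Proof. by apply: sumr_ge0 => i _; rewrite -expr2 sqr_ge0. Qed.

Lemma sqr_coord_le x k : x ord0 k ^+ 2 <= dotp x x.
Proof.
rewrite /dotp (bigD1 k)//= -expr2 lerDl.
by apply: sumr_ge0 => i _; rewrite -expr2 sqr_ge0.
Qed.

Lemma oneDdotp_gt0 x : 0 < 1 + dotp x x.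
Proof. by rewrite ltr_pwDl// dotp_ge0. Qed.

Lemma normr_coord_le x k : `|x ord0 k| <= 1 + dotp x x.
Proof.
apply: (@le_trans _ _ (1 + x ord0 k ^+ 2)); last first.
  by rewrite lerD2l sqr_coord_le.
rewrite -(real_normK (num_real (x ord0 k))); set t := `|_|.
have : 0 <= (t - 1) ^+ 2 by exact: sqr_ge0.
have : 0 <= t by exact: normr_ge0.
by rewrite sqrrB1 -mulr_natl; nra.
Qed.

Lemma dotpDD x y : dotp (x + y) (x + y) <= 2 * dotp x x + 2 * dotp y y.
Proof.
rewrite /dotp !mulr_sumr -big_split; apply: ler_sum => i _ /=; rewrite mxE.
by have := sqr_ge0 (x ord0 i - y ord0 i); nra.
Qed.

Lemma gradient_coord x k : gradient (fun y => y ord0 k) x (fun v => v ord0 k).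
Proof.
split=> [|v]; first exact: differentiable_coord.
rewrite deriveE; last exact: differentiable_coord.
have lin : linear (fun y : 'rV[R]_n => y ord0 k : R).
  by move=> a u w; rewrite !mxE.
pose f : {linear 'rV[R]_n -> R} := HB.pack (fun y : 'rV[R]_n => y ord0 k : R)
  (GRing.isLinear.Build _ _ _ _ _ lin).
rewrite (@diff_lin _ _ _ f)//.
exact: coord_continuous.
Qed.

Lemma gradient_dotp (a : 'rV[R]_n) x : gradient (dotp a) x (dotp a).
Proof.
by rewrite /dotp; apply: gradient_sum => i; apply: gradientZ; exact: gradient_coord.
Qed.

Lemma gradient_sq z x : gradient (fun y => dotp (y + z) (y + z)) x
  (fun v => 2 * dotp (x + z) v).
Proof.
have g1 i : gradient (fun y => y ord0 i + z ord0 i) x (fun v => v ord0 i).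
  have [d e] := gradientD (gradient_coord x i) (gradient_cst (z ord0 i) x).
  by split => // v; rewrite e addr0.
rewrite (_ : (fun y => _) =
   fun y => \sum_i (y ord0 i + z ord0 i) * (y ord0 i + z ord0 i)); last first.
  by apply/funext => y; apply: eq_bigr => i _; rewrite mxE.
have [d e] := gradient_sum (index_enum 'I_n) (fun i => gradientM (g1 i) (g1 i)).
split => // v; rewrite e /dotp mulr_sumr.
by apply: eq_bigr => i _; rewrite mxE; ring.
Qed.

Definition gauss (c : R) z x := expR (- (c / 2) * dotp (x - z) (x - z)).

Lemma gauss_gt0 c z x : 0 < gauss c z x.
Proof. exact: expR_gt0. Qed.

Lemma gauss_le1 c z x : 0 <= c -> gauss c z x <= 1.
Proof.
move=> c0; rewrite -expR0 ler_expR mulNr oppr_le0 mulr_ge0 ?dotp_ge0//.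
by rewrite divr_ge0.
Qed.

Lemma gaussD c1 c2 z x : gauss c1 z x * gauss c2 z x = gauss (c1 + c2) z x.
Proof. by rewrite /gauss -expRD; congr expR; field. Qed.

Lemma gradient_gauss c z x :
  gradient (gauss c z) x (fun v => - c * dotp (x - z) v * gauss c z x).
Proof.
have h1 := gradientZ (- (c / 2)) (gradient_sq (- z) x).
have [d e] := gradient_comp h1 (is_derive_expR _).
by split => // v; rewrite e /gauss; field.
Qed.

End rv_gradient.

(** * Families of polynomial growth *)
Section slow.
Variables (R : realType) (n : nat).
Implicit Types (x y z v : 'rV[R]_n).

(** Families of smooth functions with polynomial growth, uniform in the index
([slow_bound]). The weights are the symbols of Bessel potentials, rescaled by
[r i] and recentred at [- z i]; their side conditions keep
[r i * (1 + |z i|^2)] between two positive constants, which is what makes the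
bound uniform when the frequency [z i] tends to infinity. The class is inductive
so that its stability under differentiation is a structural induction. *)
Inductive slow (I : Type) : (I -> 'rV[R]_n -> R) -> Prop :=
| slow_cst (c : I -> R) (C : R) of (forall i, `|c i| <= C) :
    slow (fun i _ => c i)
| slow_coord (k : 'I_n) : slow (fun _ x => x ord0 k)
| slow_gauss c z of 0 <= c : slow (fun _ => gauss c z)
| slow_cos v : slow (fun _ x => cos (dotp v x))
| slow_sin v : slow (fun _ x => sin (dotp v x))
| slow_weight (a C : R) (r : I -> R) (z : I -> 'rV[R]_n) of
    (forall i, 0 < r i) & (forall i, r i * (1 + dotp (z i) (z i)) <= C) &
    (forall i, 1 <= C * (r i * (1 + dotp (z i) (z i)))) :
    slow (fun i x => (r i * (1 + dotp (x + z i) (x + z i))) `^ a)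
| slowD F G of slow F & slow G : slow (fun i x => F i x + G i x)
| slowM F G of slow F & slow G : slow (fun i x => F i x * G i x).

Lemma slow_eq I (F G : I -> 'rV[R]_n -> R) :
  slow F -> (forall i x, F i x = G i x) -> slow G.
Proof.
by move=> sF FG; rewrite (_ : G = F)//; apply/funext => i; apply/funext => x.
Qed.

Lemma slow_reindex I J (h : J -> I) (F : I -> 'rV[R]_n -> R) :
  slow F -> slow (fun j => F (h j)).
Proof.
elim=> {F} [c C cC|k|c z c0|v|v|a C r z r0 rC Cr|F G _ sF _ sG|F G _ sF _ sG].
- exact: (@slow_cst _ (fun j => c (h j)) C).
- exact: slow_coord.
- exact: slow_gauss.
- exact: slow_cos.
- exact: slow_sin.
- exact: (@slow_weight _ a C (fun j => r (h j)) (fun j => z (h j))).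
- exact: slowD.
- exact: slowM.
Qed.

Lemma slow_const I (a : R) : slow (fun (_ : I) _ => a).
Proof. exact: (@slow_cst _ (fun=> a) `|a|). Qed.

Lemma slowZ I (a : R) (F : I -> 'rV[R]_n -> R) : slow F ->
  slow (fun i x => a * F i x).
Proof. by move=> sF; apply: slowM => //; exact: slow_const. Qed.

Lemma slow_sum I (T : Type) (s : seq T) (F : T -> I -> 'rV[R]_n -> R) :
  (forall t, slow (F t)) -> slow (fun i x => \sum_(t <- s) F t i x).
Proof.
move=> sF; elim: s => [|t s IH].
  by apply: (slow_eq (slow_const I 0)) => i x; rewrite big_nil.
by apply: (slow_eq (slowD (sF t) IH)) => i x; rewrite big_cons.
Qed.

Lemma slow_dotp I (v : I -> 'rV[R]_n) (C : R) :
  (forall i k, `|v i ord0 k| <= C) -> slow (fun i x => dotp (v i) x).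
Proof.
move=> vC; apply: slow_sum => k; apply: slowM; last exact: slow_coord.
exact: (@slow_cst _ (fun i => v i ord0 k) C).
Qed.

Lemma slow_dotp_cst I v : slow (fun (_ : I) x => dotp v x).
Proof.
apply: (@slow_dotp _ (fun=> v) (\sum_k `|v ord0 k|)) => _ k.
by rewrite (bigD1 k)//= lerDl sumr_ge0.
Qed.

Lemma weight_gt0 (r : R) z x : 0 < r -> 0 < r * (1 + dotp (x + z) (x + z)).
Proof. by move=> r0; rewrite mulr_gt0// oneDdotp_gt0. Qed.

Lemma gradient_weight a (r : R) z x : 0 < r ->
  gradient (fun y => (r * (1 + dotp (y + z) (y + z))) `^ a) x
    (fun v => a * (r * (1 + dotp (x + z) (x + z))) `^ (a - 1) *
      (r * (2 * dotp (x + z) v))).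
Proof.
move=> r0; have h1 := gradientZ r (gradientD (gradient_cst 1 x) (gradient_sq z x)).
have [d e] := gradient_comp h1 (is_derive1_powR a (weight_gt0 z x r0)).
by split => // v; rewrite e add0r.
Qed.

(** The derivative of a weight of exponent [a] is a weight of exponent [a - 1]
times an affine function whose coefficients [r i] and [r i * z i] are bounded,
because |z_k| <= 1 + |z|^2. *)
Lemma slow_gradient I (F : I -> 'rV[R]_n -> R) : slow F -> forall v,
  (forall i x, differentiable (F i) x) /\ slow (fun i x => 'D_v (F i) x).
Proof.
move=> sF v; elim: sF => {F}
    [c C cC|k|c z c0|w|w|a C r z r0 rC Cr|F G sF [dF DF] sG [dG DG]
    |F G sF [dF DF] sG [dG DG]].
- split => [i x|]; first exact: differentiable_cst.
  by apply: (slow_eq (slow_const I 0)) => i x; rewrite derive_cst.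
- split => [i x|]; first exact: (gradient_coord x k).1.
  apply: (slow_eq (slow_const I (v ord0 k))) => i x.
  by rewrite (gradient_coord x k).2.
- split => [i x|]; first exact: (gradient_gauss c z x).1.
  have s1 : slow (fun (_ : I) x => - c * (dotp v x + - dotp v z) * gauss c z x).
    apply: slowM; last exact: slow_gauss.
    apply: slowZ; apply: slowD; first exact: slow_dotp_cst.
    exact: slow_const.
  apply: (slow_eq s1) => i x.
  by rewrite (gradient_gauss c z x).2 !(dotpC v) dotpDl dotpNl.
- have h x := gradient_comp (gradient_dotp w x) (is_derive_cos _).
  split => [i x|]; first exact: (h x).1.
  have s1 := slowZ (- dotp w v) (slow_sin I w).
  by apply: (slow_eq s1) => i x; rewrite (h x).2; ring.
- have h x := gradient_comp (gradient_dotp w x) (is_derive_sin _).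
  split => [i x|]; first exact: (h x).1.
  have s1 := slowZ (dotp w v) (slow_cos I w).
  by apply: (slow_eq s1) => i x; rewrite (h x).2; ring.
- split => [i x|]; first exact: (gradient_weight a (z i) x (r0 i)).1.
  have r1 i : `|r i| <= C.
    rewrite gtr0_norm//; apply: le_trans (rC i).
    by rewrite ler_peMr ?(ltW (r0 i))// lerDl dotp_ge0.
  have rz i : `|r i * dotp (z i) v| <= C * \sum_k `|v ord0 k|.
    rewrite normrM gtr0_norm// /dotp.
    apply: (@le_trans _ _ (r i * \sum_k ((1 + dotp (z i) (z i)) * `|v ord0 k|))).
      rewrite ler_wpM2l ?(ltW (r0 i))//; apply: le_trans (ler_norm_sum _ _ _) _.
      by apply: ler_sum => k _; rewrite normrM ler_wpM2r// normr_coord_le.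
    rewrite -mulr_sumr mulrA ler_wpM2r// sumr_ge0//.
  have s1 : slow (fun (i : I) x => 2 * a *
      ((r i * (1 + dotp (x + z i) (x + z i))) `^ (a - 1) *
      (r i * dotp v x + r i * dotp (z i) v))).
    apply: slowZ; apply: slowM; first exact: (slow_weight _ r0 rC Cr).
    apply: slowD; last exact: (slow_cst rz).
    by apply: slowM; [exact: (slow_cst r1)|exact: slow_dotp_cst].
  apply: (slow_eq s1) => i x.
  by rewrite (gradient_weight a (z i) x (r0 i)).2 (dotpDl x (z i) v) (dotpC x v); ring.
- have h i x := gradientD (conj (dF i x) (fun=> erefl)) (conj (dG i x) (fun=> erefl)).
  split => [i x|]; first exact: (h i x).1.
  by apply: (slow_eq (slowD DF DG)) => i x; rewrite (h i x).2.
- have h i x := gradientM (conj (dF i x) (fun=> erefl)) (conj (dG i x) (fun=> erefl)).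
  split => [i x|]; first exact: (h i x).1.
  apply: (slow_eq (slowD (slowM sF DG) (slowM sG DF))) => i x.
  by rewrite (h i x).2.
Qed.

Lemma measurable_dotp (v : 'rV[R]_n) : measurable_fun setT (fun x => dotp v x).
Proof.
apply: measurable_sum => i; apply: measurable_funM => //.
exact: measurable_rv_coord.
Qed.

Lemma measurable_sq z : measurable_fun setT (fun x => dotp (x + z) (x + z)).
Proof.
have h i : measurable_fun setT (fun x : 'rV[R]_n => (x + z) ord0 i).
  apply: (eq_measurable_fun (fun x : 'rV[R]_n => x ord0 i + z ord0 i)).
    by move=> x _; rewrite mxE.
  by apply: measurable_funD => //; exact: measurable_rv_coord.
by apply: measurable_sum => i; apply: measurable_funM.
Qed.

Lemma slow_measurable I (F : I -> 'rV[R]_n -> R) : slow F ->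
  forall i, measurable_fun setT (F i).
Proof.
move=> + i; elim=> {F} [c C cC|k|c z c0|v|v|a C r z r0 rC Cr|F G _ mF _ mG|F G _ mF _ mG].
- exact: measurable_cst.
- exact: measurable_rv_coord.
- apply: (measurableT_comp (@measurable_expR R)).
  by apply: measurable_funM => //; exact: measurable_sq.
- apply: (@measurableT_comp _ _ _ _ _ _ (@cos R) _ (fun x => dotp v x)).
    by apply: continuous_measurable_fun; exact: continuous_cos.
  exact: measurable_dotp.
- apply: (@measurableT_comp _ _ _ _ _ _ (@sin R) _ (fun x => dotp v x)).
    by apply: continuous_measurable_fun; exact: continuous_sin.
  exact: measurable_dotp.
- apply: (@measurableT_comp _ _ _ _ _ _ (fun t => powR t a) _ _ (@measurable_powR R a)).
  apply: measurable_funM => //; apply: measurable_funD => //; exact: measurable_sq.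
- exact: measurable_funD.
- exact: measurable_funM.
Qed.

Lemma powR_bound (a K t : R) (m : nat) : `|a| <= m%:R -> 1 <= K ->
  K^-1 <= t -> t <= K -> 0 <= t `^ a <= K ^+ m.
Proof.
move=> am K1 Kt tK; rewrite powR_ge0/=.
have K0 : 0 < K by apply: lt_le_trans K1.
have t0 : 0 < t by apply: lt_le_trans Kt; rewrite invr_gt0.
have Km b : b <= m%:R -> K `^ b <= K ^+ m.
  by move=> bm; rewrite -powR_mulrn ?(ltW K0)//; exact: ler_powR.
have [a0|a0] := leP 0 a.
  apply: (@le_trans _ _ (K `^ a)).
    by apply: ge0_ler_powR => //; rewrite nnegrE ltW.
  by apply: Km; apply: le_trans am; rewrite ler_norm.
rewrite -(opprK a) powRN -powR_inv1 ?powR_ge0// -powRrM mulrC powRrM.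
apply: (@le_trans _ _ (K `^ (- a))).
  apply: ge0_ler_powR; rewrite ?nnegrE ?powR_ge0 ?(ltW K0) ?oppr_ge0 ?(ltW a0)//.
  by rewrite powR_inv1 ?(ltW t0)// -(invrK K) lef_pV2 ?posrE ?invr_gt0.
by apply: Km; apply: le_trans am; rewrite -normrN ler_norm.
Qed.

(** For a weight, r(1+|x+z|^2) and its inverse are both at most a constant times
1+|x|^2, because |x+z|^2 <= 2|x|^2+2|z|^2 and |z|^2 <= 2|x+z|^2+2|x|^2; hence
powers of either sign grow polynomially. *)
Lemma slow_bound I (F : I -> 'rV[R]_n -> R) : slow F ->
  exists C m, 0 <= C /\ forall i x, `|F i x| <= C * (1 + dotp x x) ^+ m.
Proof.
have s1 x : 1 <= 1 + dotp x x by rewrite lerDl dotp_ge0.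
elim=> {F} [c C cC|k|c z c0|v|v|a C r z r0 rC Cr|F G _ [C [m [C0 FC]]] _ [D [p [D0 GD]]]
    |F G _ [C [m [C0 FC]]] _ [D [p [D0 GD]]]].
- exists `|C|, 0; split => // i x; rewrite expr0 mulr1.
  exact: (le_trans (cC i) (ler_norm _)).
- by exists 1, 1; split => // i x; rewrite mul1r expr1 normr_coord_le.
- exists 1, 0; split => // i x; rewrite mul1r expr0 ger0_norm; first exact: gauss_le1.
  by rewrite ltW// gauss_gt0.
- exists 1, 0; split => // i x; rewrite mul1r expr0 ler_norml cos_le1.
  by rewrite cos_geN1.
- exists 1, 0; split => // i x; rewrite mul1r expr0 ler_norml sin_le1.
  by rewrite sin_geN1.
- pose m := Num.truncn `|a|.
  pose K := 2 * (1 + C ^+ 2).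
  have K0 : 0 <= C ^+ 2 by exact: sqr_ge0.
  exists (K ^+ m.+1), m.+1; split; first by rewrite exprn_ge0// /K; lra.
  move=> i x; rewrite -exprMn.
  have rp := r0 i; have dz := dotp_ge0 (z i); have dx := dotp_ge0 x.
  have dxz := dotp_ge0 (x + z i).
  have h1 := rC i; have h2 := Cr i.
  have C0 : 0 < C by apply: lt_le_trans h1; rewrite mulr_gt0// oneDdotp_gt0.
  have /andP[p0 p1] : 0 <= (r i * (1 + dotp (x + z i) (x + z i))) `^ a <=
      (K * (1 + dotp x x)) ^+ m.+1.
    apply: powR_bound.
    + exact: (ltW (truncnS_gt _)).
    + by rewrite /K; nra.
    + rewrite -[leLHS]mul1r ler_pdivrMr; last by rewrite /K; nra.
      have := dotpDD (x + z i) (- x); rewrite addrAC subrr add0r dotpNl dotpNr opprK.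
      move=> h3; have h4 : r i * (1 + dotp (z i) (z i)) <=
          2 * (r i * (1 + dotp (x + z i) (x + z i))) * (1 + dotp x x).
        rewrite -!mulrA [leRHS]mulrCA ler_pM2l//; nra.
      have h5 : C * (r i * (1 + dotp (z i) (z i))) <=
          C * (2 * (r i * (1 + dotp (x + z i) (x + z i))) * (1 + dotp x x)).
        by rewrite ler_pM2l.
      have h6 : C <= 1 + C ^+ 2 by have := sqr_ge0 (C - 1); nra.
      have h7 : 0 <= r i * (1 + dotp (x + z i) (x + z i)) * (1 + dotp x x).
        by rewrite !mulr_ge0 ?ltW// ltr_pwDl.
      rewrite (le_trans h2)// (le_trans h5)// /K.
      move: h7; set A := r i * _; set B := 1 + dotp x x => h7.
      rewrite (_ : C * (2 * A * B) = C * (2 * (A * B))); last by ring.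
      rewrite (_ : A * (2 * (1 + C ^+ 2) * B) = (1 + C ^+ 2) * (2 * (A * B))).
        by rewrite ler_wpM2r// mulr_ge0.
      by ring.
    + apply: (@le_trans _ _ (r i * (1 + (2 * dotp x x + 2 * dotp (z i) (z i))))).
        by rewrite ler_pM2l// lerD2l dotpDD.
      rewrite /K.
      have h6 : C <= 1 + C ^+ 2 by have := sqr_ge0 (C - 1); nra.
      have h7 : r i <= C by nra.
      have h8 : r i * dotp x x <= C * dotp x x by rewrite ler_wpM2r.
      have h9 : C * dotp x x <= (1 + C ^+ 2) * dotp x x by rewrite ler_wpM2r.
      nra.
  by rewrite ger0_norm.
- exists (C + D), (m + p)%N; split => [|i x]; first exact: addr_ge0.
  rewrite (le_trans (ler_normD _ _))// mulrDl lerD//.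
    by rewrite (le_trans (FC i x))// ler_wpM2l// ler_weXn2l// leq_addr.
  by rewrite (le_trans (GD i x))// ler_wpM2l// ler_weXn2l// leq_addl.
- exists (C * D), (m + p)%N; split => [|i x]; first exact: mulr_ge0.
  by rewrite normrM exprD mulrACA ler_pM.
Qed.

End slow.

(** * Integrable decay *)
Section decay.
Variables (R : realType) (n : nat).
Local Notation mu := (lebesgue_rv R n).
Implicit Types (x y z v : 'rV[R]_n).

(** A product of one-variable weights rather than a power of 1+|x|^2: its
integral factors by Tonelli, and its inverse is a polynomial that can be gained
on a Fourier transform one coordinate at a time ([ft_decay]). *)
Definition decay x : R := \prod_i (1 + x ord0 i ^+ 2)^-1.

Lemma oneDsqr_gt0 (t : R) : 0 < 1 + t ^+ 2.
Proof. by rewrite ltr_pwDl// sqr_ge0. Qed.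

Lemma decay_gt0 x : 0 < decay x.
Proof. by apply: prodr_gt0 => i _; rewrite invr_gt0 oneDsqr_gt0. Qed.

Lemma decay_ge0 x : 0 <= decay x. Proof. exact/ltW/decay_gt0. Qed.

Lemma decay_le1 x : decay x <= 1.
Proof.
suff /andP[] : 0 <= decay x <= 1 by [].
rewrite /decay; apply: (big_ind (fun t => 0 <= t <= 1)).
- by rewrite ler01 lexx.
- by move=> a b /andP[a0 a1] /andP[b0 b1]; rewrite mulr_ge0// mulr_ile1.
- move=> i _; rewrite invr_ge0 ltW ?oneDsqr_gt0//=.
  by rewrite invf_le1 ?oneDsqr_gt0// lerDl sqr_ge0.
Qed.

Lemma invr_decay x : (decay x)^-1 = \prod_i (1 + x ord0 i ^+ 2).
Proof. by rewrite -prodfV; apply: eq_bigr => i _; rewrite invrK. Qed.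

Lemma decayV_le x : (decay x)^-1 <= (1 + dotp x x) ^+ n.
Proof.
rewrite invr_decay -[X in _ ^+ X]card_ord -prodr_const; apply: ler_prod => i _.
by rewrite ltW ?oneDsqr_gt0//= lerD2l sqr_coord_le.
Qed.

Lemma measurable_oneDsqrV :
  measurable_fun setT (fun t : R => (1 + t ^+ 2)^-1).
Proof.
apply: continuous_measurable_fun; exact: continuous_oneDsqrV.
Qed.

Lemma measurable_decay : measurable_fun setT decay.
Proof. by apply: (measurable_prod_coord (g := fun _ t => (1 + t ^+ 2)^-1)) => _; exact: measurable_oneDsqrV. Qed.

Lemma integral_oneDsqrV_lty :
  (\int[@lebesgue_measure R]_t (((1 + t ^+ 2)^-1)%:E) < +oo)%E.
Proof.
rewrite (@ge0_symfun_integralT R (fun t : R => (1 + t ^+ 2)^-1)); last 3 first.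
- by move=> t; rewrite invr_ge0 ltW ?oneDsqr_gt0.
- exact: continuous_oneDsqrV.
- by move=> t /=; rewrite sqrrN.
rewrite -set_itvcy.
rewrite [X in (_ * X)%E](_ : _ = (pi / 2)%:E); first by rewrite -EFinM ltry.
exact: integral0y_oneDsqr.
Qed.

Lemma integral_decay_lty : (\int[mu]_x (decay x)%:E < +oo)%E.
Proof.
rewrite (ge0_integral_prod_coord (g := fun _ t => (1 + t ^+ 2)^-1)); last 2 first.
- by move=> _; exact: measurable_oneDsqrV.
- by move=> _ t; rewrite invr_ge0 ltW ?oneDsqr_gt0.
set P := (X in (X < _)%E).
suff /andP[] : (0 <= P < +oo)%E by [].
rewrite /P; apply: (big_ind (fun t : \bar R => 0 <= t < +oo)%E).
- by rewrite lee01 ltry.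
- move=> a b /andP[a0 aoo] /andP[b0 boo].
  by rewrite mule_ge0//= lte_mul_pinfty// ge0_fin_numE.
- move=> i _; rewrite integral_oneDsqrV_lty andbT; apply: integral_ge0 => t _.
  by rewrite lee_fin invr_ge0 ltW ?oneDsqr_gt0.
Qed.

Lemma integrable_decay : mu.-integrable setT (EFin \o decay).
Proof.
apply/integrableP; split; first by apply/measurable_EFinP; exact: measurable_decay.
under eq_integral do rewrite /= ger0_norm ?decay_ge0//.
exact: integral_decay_lty.
Qed.

Lemma integrable_le_decay (f : 'rV[R]_n -> R) (C : R) :
  measurable_fun setT f -> (forall x, `|f x| <= C * decay x) ->
  mu.-integrable setT (EFin \o f).
Proof.
move=> mf fC; apply: (@le_integrable _ _ _ mu setT measurableT _
   (fun x => C%:E * (decay x)%:E)%E).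
- exact/measurable_EFinP.
- by move=> x _; rewrite /= lee_fin (le_trans (fC x))// ler_norm.
- exact: (@integrableZl _ _ _ _ _ _ _ _ integrable_decay).
Qed.

(** Translations by bounded multiples of [v] cost a constant factor; this gives
the domination needed to differentiate an integral along a line. *)
Lemma decay_shift x v (t : R) : `|t| <= 1 ->
  decay (x + t *: v) <= (\prod_i (2 * (1 + v ord0 i ^+ 2))) * decay x.
Proof.
move=> t1; rewrite /decay -big_split; apply: ler_prod => i _ /=.
rewrite !mxE invr_ge0 ltW ?oneDsqr_gt0//=.
rewrite ler_pdivlMr ?oneDsqr_gt0// mulrC ler_pdivrMr ?oneDsqr_gt0//.
have t2 : t ^+ 2 <= 1 by rewrite -(real_normK (num_real t)) expr_le1.
have h0 : t ^+ 2 * v ord0 i ^+ 2 <= v ord0 i ^+ 2.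
  by rewrite ler_piMl ?sqr_ge0.
move: (x ord0 i) (v ord0 i) h0 => a b h0.
have := sqr_ge0 ((a + t * b) + t * b); have := sqr_ge0 (a + t * b).
have := sqr_ge0 b; set c := a + t * b => hb hc.
have -> : a = c - t * b by rewrite /c; ring.
have := mulr_ge0 hb hc.
nra.
Qed.

Lemma pow_le_expR (k : nat) (t : R) : 0 <= t -> t ^+ k <= k`!%:R * expR t.
Proof.
case: k => [|k] t0; first by rewrite expr0 fact0 mul1r -expR0 ler_expR.
have := expR_ge1Dxn k t0; rewrite -ler_pdivrMl ?ltr0n ?fact_gt0//.
by rewrite mulrC; lra.
Qed.

Lemma gauss_decay (c : R) (k : nat) : 0 < c -> exists C : R, 0 <= C /\
  forall x, (1 + dotp x x) ^+ k * gauss c 0 x <= C * decay x.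
Proof.
move=> c0; pose m := (k + n)%N.
exists (m`!%:R * (2 / c) ^+ m * expR (c / 2)); split.
  by rewrite !mulr_ge0 ?expR_ge0// exprn_ge0// divr_ge0// ltW.
move=> x; rewrite -ler_pdivrMr ?decay_gt0//.
apply: (@le_trans _ _ ((1 + dotp x x) ^+ k * gauss c 0 x * (1 + dotp x x) ^+ n)).
  rewrite ler_wpM2l ?decayV_le// mulr_ge0 ?(ltW (gauss_gt0 _ _ _))//.
  by rewrite exprn_ge0// ltW// oneDdotp_gt0.
rewrite mulrAC -exprD -/m /gauss subr0.
have t0 : 0 <= c / 2 * (1 + dotp x x).
  by rewrite mulr_ge0// ?(ltW (oneDdotp_gt0 _))// divr_ge0// ltW.
have := pow_le_expR m t0; rewrite exprMn.
rewrite mulrDr mulr1 expRD mulNr expRN => h.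
have e0 := expR_gt0 (c / 2 * dotp x x).
rewrite ler_pdivrMr//.
have cm : 0 < (2 / c) ^+ m by rewrite exprn_gt0// divr_gt0.
have -> : (1 + dotp x x) ^+ m = (2 / c) ^+ m * ((c / 2) ^+ m * (1 + dotp x x) ^+ m).
  have e : (2 / c) * (c / 2) = 1 by field; rewrite gt_eqF.
  by rewrite mulrA -exprMn e expr1n mul1r.
rewrite [leRHS](_ : _ = (2 / c) ^+ m *
  (m`!%:R * (expR (c / 2) * expR (c / 2 * dotp x x)))); last by ring.
by rewrite ler_pM2l.
Qed.

(** * Families with a common Gaussian factor *)
(** A single Gaussian rate [c] serves the whole family, so that one integrable
function dominates all its members. *)
Definition snice (I : Type) (F : I -> 'rV[R]_n -> R) := exists c G,
  [/\ 0 < c, slow G & forall i x, F i x = G i x * gauss c 0 x].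

Section snice_theory.
Variable I : Type.
Implicit Types F G : I -> 'rV[R]_n -> R.

Lemma snice_eq F G : snice F -> (forall i x, F i x = G i x) -> snice G.
Proof. by move=> [c [H [c0 sH FH]]] FG; exists c, H; split => // i x; rewrite -FG. Qed.

Lemma snice_reindex J (h : J -> I) F : snice F -> snice (fun j => F (h j)).
Proof.
move=> [c [H [c0 sH FH]]]; exists c, (fun j => H (h j)); split => //.
exact: slow_reindex.
Qed.

Lemma sniceM F G : slow F -> snice G -> snice (fun i x => F i x * G i x).
Proof.
move=> sF [c [H [c0 sH GH]]]; exists c, (fun i x => F i x * H i x).
by split => // [|i x]; [exact: slowM|rewrite GH mulrA].
Qed.

Lemma sniceZ (a : R) F : snice F -> snice (fun i x => a * F i x).
Proof. by apply: sniceM; exact: slow_const. Qed.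

Lemma sniceD F G : snice F -> snice G -> snice (fun i x => F i x + G i x).
Proof.
wlog : F G / exists c d F' G', [/\ 0 < c <= d, slow F', slow G' &
    forall i x, F i x = F' i x * gauss c 0 x /\ G i x = G' i x * gauss d 0 x].
  move=> wl nF nG; have [c [F' [c0 sF' FF']]] := nF.
  have [d [G' [d0 sG' GG']]] := nG.
  have [cd|/ltW dc] := leP c d.
    by apply: wl => //; exists c, d, F', G'; rewrite c0 cd; split.
  apply: (@snice_eq (fun i x => G i x + F i x)) => [|i x]; last by rewrite addrC.
  by apply: wl => //; exists d, c, G', F'; rewrite d0 dc; split.
move=> [c [d [F' [G' [/andP[c0 cd] sF' sG' FG]]]]] _ _.
(* The faster decaying Gaussian is the slower one times a Gaussian, and the
   latter is absorbed in the slow factor. *)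
exists c, (fun i x => F' i x + G' i x * gauss (d - c) 0 x); split => // [|i x].
  by apply: slowD => //; apply: slowM => //; apply: slow_gauss; rewrite subr_ge0.
have [-> ->] := FG i x.
by rewrite mulrDl -mulrA gaussD subrK.
Qed.

Lemma snice_slow F : snice F -> slow F.
Proof.
move=> [c [G [c0 sG FG]]]; apply: (slow_eq (slowM sG (slow_gauss I 0 (ltW c0)))).
by move=> i x; rewrite FG.
Qed.

Lemma snice_differentiable F i x : snice F -> differentiable (F i) x.
Proof. by move=> /snice_slow /(fun s => slow_gradient s 0)[]. Qed.

Lemma snice_gradient F v : snice F -> snice (fun i x => 'D_v (F i) x).
Proof.
move=> [c [G [c0 sG FG]]].
have [dG sDG] := slow_gradient sG v.
have h i x := gradientM (conj (dG i x) (fun=> erefl)) (gradient_gauss c 0 x).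
exists c, (fun i x => 'D_v (G i) x + - c * (G i x * dotp v x)); split => //.
  apply: slowD => //; apply: slowZ; apply: slowM => //; exact: slow_dotp_cst.
move=> i x; rewrite (_ : F i = fun x => G i x * gauss c 0 x); last first.
  by apply/funext => y; rewrite FG.
by rewrite (h i x).2 subr0 (dotpC v); ring.
Qed.

Lemma snice_measurable F i : snice F -> measurable_fun setT (F i).
Proof. by move/snice_slow/slow_measurable. Qed.

Lemma snice_decay F : snice F -> exists C, 0 <= C /\
  forall i x, `|F i x| <= C * decay x.
Proof.
move=> [c [G [c0 sG FG]]]; have [C [m [C0 GC]]] := slow_bound sG.
have [D [D0 gD]] := gauss_decay m c0.
exists (C * D); split => [|i x]; first exact: mulr_ge0.
rewrite FG normrM (gtr0_norm (gauss_gt0 _ _ _)).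
apply: (@le_trans _ _ (C * ((1 + dotp x x) ^+ m * gauss c 0 x))).
  by rewrite mulrA ler_wpM2r ?(ltW (gauss_gt0 _ _ _)).
by rewrite -mulrA ler_wpM2l.
Qed.

Lemma snice_integrable F i : snice F -> mu.-integrable setT (EFin \o F i).
Proof.
move=> nF; have [C [C0 FC]] := snice_decay nF.
exact: (integrable_le_decay (snice_measurable i nF) (FC i)).
Qed.

Lemma is_derive_line (f : 'rV[R]_n -> R) x v (t : R) :
  derivable f (x + t *: v) v ->
  is_derive t (1 : R) (fun u => f (x + u *: v)) ('D_v f (x + t *: v)).
Proof.
have e : (fun h : R => h^-1 *: ((f \o shift (x + t *: v)) (h *: v) - f (x + t *: v))) =
  (fun h : R => h^-1 *: (((fun u => f (x + u *: v)) \o shift t) (h *: (1 : R))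
      - f (x + t *: v))).
  apply/funext => h; have h1 : h *: (1 : R) = h := mulr1 h.
  by rewrite /= h1 scalerDl addrCA.
rewrite /derivable e => dv; split; first exact: dv.
by rewrite /derive e.
Qed.

(** The integral of F(x + t v) does not depend on t, and its derivative at t = 0
is the integral of the derivative of F. *)
Lemma integral_gradient0 F i v : snice F -> \int[mu]_x ('D_v (F i) x) = 0.
Proof.
move=> nF; pose f (t : R) x := F i (x + t *: v).
have [C [C0 DC]] := snice_decay (snice_gradient v nF).
pose K := \prod_j (2 * (1 + v ord0 j ^+ 2)).
have I0 : [set` `](-1), 1[] (0 : R) by rewrite /= in_itv/= ltrN10 ltr01.
have df t x : is_derive t (1 : R) (f ^~ x) ('D_v (F i) (x + t *: v)).
  exact/is_derive_line/diff_derivable/snice_differentiable.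
have d1 t x : partial1of2 f t x = 'D_v (F i) (x + t *: v).
  by rewrite partial1of2E derive_val.
have := @cvg_differentiation_under_integral R _ _ mu f setT measurableT
  0 (-1) 1 I0.
move=> /(_ _ _ (fun x => C * K * decay x)) H.
have {}H : h^-1 *: (\int[mu]_x f (h + 0) x - \int[mu]_x f 0 x) @[h --> (0 : R)^'] -->
    \int[mu]_x partial1of2 f 0 x.
  apply: H.
  - move=> t _; exact: (@integrable_rv_shift _ _ (t *: v) _ (snice_integrable i nF)).
  - by move=> t x _ _; exact: ex_derive.
  - by move=> x; rewrite !mulr_ge0 ?decay_ge0// prodr_ge0// => j _;
       rewrite mulr_ge0// ltW// oneDsqr_gt0.
  - exact: (@integrableZl _ _ _ _ _ _ _ _ integrable_decay).
  - move=> t x; rewrite /= in_itv/= => /andP[t1 t2] _; rewrite d1.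
    rewrite (le_trans (DC i _))// -mulrA ler_wpM2l// decay_shift//.
    by rewrite ler_norml !ltW.
have e : (fun h : R => h^-1 *: (\int[mu]_x f (h + 0) x - \int[mu]_x f 0 x)) = fun=> 0.
  apply/funext => h.
  rewrite /f !(@Rintegral_rv_shift R n _ (F i)) ?subrr ?scaler0//;
  exact: snice_measurable.
have : \int[mu]_x partial1of2 f 0 x = 0.
  by rewrite -(cvg_lim (@Rhausdorff R) H) e lim_cst//; exact: Rhausdorff.
by under eq_Rintegral do rewrite d1 scale0r addr0.
Qed.

Lemma snice_partial F k : snice F -> snice (fun i => partial k (F i)).
Proof. exact: snice_gradient. Qed.

Lemma snice_iter_partial F b : snice F -> snice (fun i => iter_partial b (F i)).
Proof. by move=> nF; elim: b => [//|k b IH]; exact: (snice_partial k IH). Qed.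

Lemma snice_schwartz F i : snice F -> schwartz (F i).
Proof.
move=> nF; split => [b x|a b].
  exact: (snice_differentiable i x (snice_iter_partial b nF)).
have nb := snice_iter_partial b nF.
have sp : slow (fun (_ : I) (x : 'rV[R]_n) => \prod_k x ord0 k ^+ a k).
  elim: (index_enum 'I_n) => [|k s IH].
    by apply: (slow_eq (slow_const _ I (1 : R))) => j x; rewrite big_nil.
  have se : slow (fun (_ : I) (x : 'rV[R]_n) => x ord0 k ^+ a k).
    elim: (a k) => [|m IHm].
      by apply: (slow_eq (slow_const _ I (1 : R))) => j x; rewrite expr0.
    by apply: (slow_eq (slowM (@slow_coord R n I k) IHm)) => j x; rewrite exprS.
  by apply: (slow_eq (slowM se IH)) => j x; rewrite big_cons.
have [C [C0 H]] := snice_decay (sniceM sp nb); exists C => x.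
by rewrite (le_trans (H i x))// ler_piMr// decay_le1.
Qed.

End snice_theory.
End decay.

(** * Complex-valued calculus *)
Section complex_lemmas.
Variable R : realType.
Implicit Types a b : R[i].
Local Notation Re := complex.Re.
Local Notation Im := complex.Im.
Local Notation normc := ComplexField.Normc.normc.

Lemma ReD a b : Re (a + b) = Re a + Re b. Proof. by case: a; case: b. Qed.
Lemma ImD a b : Im (a + b) = Im a + Im b. Proof. by case: a; case: b. Qed.
Lemma ReN a : Re (- a) = - Re a. Proof. by case: a. Qed.
Lemma ImN a : Im (- a) = - Im a. Proof. by case: a. Qed.
Lemma ReM a b : Re (a * b) = Re a * Re b - Im a * Im b.
Proof. by case: a; case: b. Qed.
Lemma ImM a b : Im (a * b) = Re a * Im b + Im a * Re b.
Proof. by case: a => ? ?; case: b. Qed.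
Lemma Re_conj a : Re (conjc a) = Re a. Proof. by case: a. Qed.
Lemma Im_conj a : Im (conjc a) = - Im a. Proof. by case: a. Qed.

Lemma ReMC a (t : R) : Re (a * t%:C) = Re a * t.
Proof. by case: a => ? ? /=; rewrite mulr0 subr0. Qed.
Lemma ImMC a (t : R) : Im (a * t%:C) = Im a * t.
Proof. by case: a => ? ? /=; rewrite mulr0 add0r. Qed.
Lemma ReCM a (t : R) : Re (t%:C * a) = t * Re a.
Proof. by rewrite mulrC ReMC mulrC. Qed.
Lemma ImCM a (t : R) : Im (t%:C * a) = t * Im a.
Proof. by rewrite mulrC ImMC mulrC. Qed.

Lemma real_complexM (s t : R) : (s * t)%:C = s%:C * t%:C.
Proof. exact: rmorphM. Qed.
Lemma real_complexD (s t : R) : (s + t)%:C = s%:C + t%:C.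
Proof. exact: rmorphD. Qed.
Lemma real_complexN (t : R) : (- t)%:C = - t%:C.
Proof. exact: rmorphN. Qed.

Lemma conjcM a b : conjc (a * b) = conjc a * conjc b.
Proof. exact: rmorphM. Qed.
Lemma conjcD a b : conjc (a + b) = conjc a + conjc b.
Proof. exact: rmorphD. Qed.

Definition cE := (ReD, ImD, ReN, ImN, ReM, ImM, Re_conj, Im_conj).

Lemma complex_ext a b : Re a = Re b -> Im a = Im b -> a = b.
Proof. by case: a => ? ?; case: b => ? ? /= -> ->. Qed.

Lemma normcE2 a : normc a = Num.sqrt (Re a ^+ 2 + Im a ^+ 2).
Proof. by case: a. Qed.

Lemma normc_ge0 a : 0 <= normc a.
Proof. by rewrite normcE2 sqrtr_ge0. Qed.

Lemma normr_Re_le a : `|Re a| <= normc a.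
Proof.
by rewrite normcE2 -sqrtr_sqr ler_sqrt ?lerDl ?sqr_ge0// addr_ge0 ?sqr_ge0.
Qed.

Lemma normr_Im_le a : `|Im a| <= normc a.
Proof.
by rewrite normcE2 -sqrtr_sqr ler_sqrt ?lerDr ?sqr_ge0// addr_ge0 ?sqr_ge0.
Qed.

Lemma normc_le a : normc a <= `|Re a| + `|Im a|.
Proof.
rewrite normcE2 -[leRHS]ger0_norm ?addr_ge0// -sqrtr_sqr ler_sqrt ?sqr_ge0//.
rewrite sqrrD !real_normK ?num_real// lerD2r lerDl.
by rewrite mulrn_wge0// mulr_ge0.
Qed.

Lemma normcR (t : R) : normc t%:C = `|t|.
Proof. by rewrite normcE2 /= expr0n /= addr0 sqrtr_sqr. Qed.

Lemma normc_i : normc ('i : R[i]) = 1.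
Proof. by rewrite normcE2 /= expr0n expr1n /= add0r sqrtr1. Qed.

Lemma normc_cis (t : R) : normc (cis t) = 1.
Proof. by rewrite normcE2 /= cos2Dsin2 sqrtr1. Qed.

Lemma cisD (s t : R) : cis (s + t) = cis s * cis t.
Proof. by apply: complex_ext; rewrite !cE /= ?cosD ?sinD; ring. Qed.

Lemma cis0 : cis 0 = 1 :> R[i].
Proof. by rewrite /cis cos0 sin0. Qed.

Lemma cisNK (t : R) : cis (- t) * cis t = 1.
Proof. by rewrite -cisD addNr cis0. Qed.

Lemma conjc_cis (t : R) : conjc (cis t) = cis (- t).
Proof. by rewrite /cis /= cosN sinN. Qed.

End complex_lemmas.

Section cintegral_theory.
Variables (R : realType) (n : nat).
Local Notation mu := (lebesgue_rv R n).
Local Notation Re := complex.Re.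
Local Notation Im := complex.Im.
Local Notation normc := ComplexField.Normc.normc.
Implicit Types (f g : 'rV[R]_n -> R[i]).

Definition cintegrable f := mu.-integrable setT (EFin \o (fun x => Re (f x))) /\
  mu.-integrable setT (EFin \o (fun x => Im (f x))).

Lemma eq_cintegral f g : f =1 g -> cintegral f = cintegral g.
Proof. by move=> fg; congr cintegral; exact/funext. Qed.

Lemma cintegralD f g : cintegrable f -> cintegrable g ->
  cintegral (fun x => f x + g x) = cintegral f + cintegral g.
Proof.
move=> [fr fi] [gr gi]; apply: complex_ext; rewrite !cE /= -RintegralD//;
by apply: eq_Rintegral => x _; rewrite !cE.
Qed.

Lemma cintegralZ (a : R[i]) f : cintegrable f ->
  cintegral (fun x => a * f x) = a * cintegral f.
Proof.
move=> [fr fi]; apply: complex_ext; rewrite !cE /=.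
  rewrite -!RintegralZl//= -RintegralB//; last 2 first.
  - exact: (integrableZl measurableT _ fr).
  - exact: (integrableZl measurableT _ fi).
  by apply: eq_Rintegral => x _; rewrite !cE.
rewrite -!RintegralZl//= -RintegralD//; last 2 first.
- exact: (integrableZl measurableT _ fi).
- exact: (integrableZl measurableT _ fr).
by apply: eq_Rintegral => x _; rewrite !cE.
Qed.

(** The factor 2 comes from treating real and imaginary parts separately. *)
Lemma normc_cintegral_le f (g : 'rV[R]_n -> R) : cintegrable f ->
  mu.-integrable setT (EFin \o g) -> (forall x, normc (f x) <= g x) ->
  normc (cintegral f) <= 2 * \int[mu]_x g x.
Proof.
move=> [fr fi] ig fg; rewrite (le_trans (normc_le _))//= mulr_natl mulr2n.
apply: lerD.
  apply: le_trans (le_normr_Rintegral _ fr) _ => //.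
  apply: le_Rintegral => // [|x _]; first exact: integrable_norm.
  exact: le_trans (normr_Re_le _) (fg x).
apply: le_trans (le_normr_Rintegral _ fi) _ => //.
apply: le_Rintegral => // [|x _]; first exact: integrable_norm.
exact: le_trans (normr_Im_le _) (fg x).
Qed.

Lemma cintegral_shift (v : 'rV[R]_n) f :
  measurable_fun setT (fun x => Re (f x)) ->
  measurable_fun setT (fun x => Im (f x)) ->
  cintegral (fun x => f (x + v)) = cintegral f.
Proof.
move=> mr mi; apply: complex_ext => /=.
  exact: (Rintegral_rv_shift v mr).
exact: (Rintegral_rv_shift v mi).
Qed.

End cintegral_theory.

Section cnice.
Variables (R : realType) (n : nat).
Local Notation Re := complex.Re.
Local Notation Im := complex.Im.
Local Notation normc := ComplexField.Normc.normc.

Definition cslow (I : Type) (F : I -> 'rV[R]_n -> R[i])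
  := slow (fun i x => Re (F i x)) /\ slow (fun i x => Im (F i x)).
Definition cnice (I : Type) (F : I -> 'rV[R]_n -> R[i])
  := snice (fun i x => Re (F i x)) /\ snice (fun i x => Im (F i x)).

Section family.
Variable I : Type.
Implicit Types (F G : I -> 'rV[R]_n -> R[i]).

Lemma cslow_cst (a : R[i]) : cslow (fun (_ : I) _ => a).
Proof. by split; exact: slow_const. Qed.

Lemma cslow_real (F : I -> 'rV[R]_n -> R) : slow F -> cslow (fun i x => (F i x)%:C).
Proof. by split => //=; exact: (slow_const _ I 0). Qed.

Lemma cslow_cis (v : 'rV[R]_n) : cslow (fun (_ : I) x => cis (dotp v x)).
Proof. by split; [exact: slow_cos|exact: slow_sin]. Qed.

Lemma cslowM F G : cslow F -> cslow G -> cslow (fun i x => F i x * G i x).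
Proof.
move=> [Fr Fi] [Gr Gi]; split.
  apply: (slow_eq (slowD (slowM Fr Gr) (slowZ (-1) (slowM Fi Gi)))) => i x.
  by rewrite cE mulN1r.
by apply: (slow_eq (slowD (slowM Fr Gi) (slowM Fi Gr))) => i x; rewrite cE.
Qed.

Lemma cnice_eq F G : cnice F -> (forall i x, F i x = G i x) -> cnice G.
Proof. by move=> [Fr Fi] FG; split; [apply: (snice_eq Fr)|apply: (snice_eq Fi)] => i x; rewrite FG. Qed.

Lemma cniceM F G : cslow F -> cnice G -> cnice (fun i x => F i x * G i x).
Proof.
move=> [Fr Fi] [Gr Gi]; split.
  apply: (snice_eq (sniceD (sniceM Fr Gr) (sniceZ (-1) (sniceM Fi Gi)))) => i x.
  by rewrite cE mulN1r.
by apply: (snice_eq (sniceD (sniceM Fr Gi) (sniceM Fi Gr))) => i x; rewrite cE.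
Qed.

Lemma cniceD F G : cnice F -> cnice G -> cnice (fun i x => F i x + G i x).
Proof.
by move=> [Fr Fi] [Gr Gi]; split;
  [apply: (snice_eq (sniceD Fr Gr))|apply: (snice_eq (sniceD Fi Gi))] => i x;
  rewrite cE.
Qed.

Lemma cniceZ (a : R[i]) F : cnice F -> cnice (fun i x => a * F i x).
Proof. by apply: cniceM; exact: cslow_cst. Qed.

Lemma cnice_coord k F : cnice F -> cnice (fun i x => (x ord0 k)%:C * F i x).
Proof. by apply: cniceM; apply: cslow_real; exact: slow_coord. Qed.

Lemma cnice_cpartial k F : cnice F -> cnice (fun i => cpartial k (F i)).
Proof. by move=> [Fr Fi]; split; exact: snice_partial. Qed.

Lemma cnice_reindex J (h : J -> I) F : cnice F -> cnice (fun j => F (h j)).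
Proof. by move=> [Fr Fi]; split; [exact: (snice_reindex h Fr)|exact: (snice_reindex h Fi)]. Qed.

Lemma cnice_cintegrable F i : cnice F -> cintegrable (F i).
Proof. by move=> [Fr Fi]; split; [exact: (snice_integrable i Fr)|exact: (snice_integrable i Fi)]. Qed.

Lemma cnice_decay F : cnice F -> exists C, 0 <= C /\
  forall i x, normc (F i x) <= C * decay x.
Proof.
move=> [/snice_decay[C [C0 FC]] /snice_decay[D [D0 FD]]].
exists (C + D); split => [|i x]; first exact: addr_ge0.
by rewrite (le_trans (normc_le _))// mulrDl lerD.
Qed.

Lemma cnice_measurable F i : cnice F ->
  measurable_fun setT (fun x => Re (F i x)) /\
  measurable_fun setT (fun x => Im (F i x)).
Proof. by move=> [Fr Fi]; split; [exact: (snice_measurable i Fr)|exact: (snice_measurable i Fi)]. Qed.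

End family.

(** A single function is a family indexed by [unit], so that every uniform
statement specialises to it. *)
Definition nice (f : 'rV[R]_n -> R[i]) := cnice (fun _ : unit => f).

Lemma nice_cst I (f : 'rV[R]_n -> R[i]) : nice f -> cnice (fun _ : I => f).
Proof. exact: (cnice_reindex (fun=> tt)). Qed.

Lemma cnice_nice I (F : I -> 'rV[R]_n -> R[i]) i : cnice F -> nice (F i).
Proof. exact: (cnice_reindex (fun _ : unit => i)). Qed.

Implicit Types (f g : 'rV[R]_n -> R[i]) (x y v : 'rV[R]_n).

Definition cdiff f x := differentiable (fun y => Re (f y)) x /\
  differentiable (fun y => Im (f y)) x.

Lemma nice_cdiff f x : nice f -> cdiff f x.
Proof. by move=> [fr fi]; split; [exact: (snice_differentiable tt x fr)|exact: (snice_differentiable tt x fi)]. Qed.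

Lemma partialD k (u w : 'rV[R]_n -> R) x : differentiable u x -> differentiable w x ->
  partial k (fun y => u y + w y) x = partial k u x + partial k w x.
Proof.
move=> du dw.
by rewrite [LHS](gradientD (conj du (fun=> erefl)) (conj dw (fun=> erefl))).2.
Qed.

Lemma cpartialD k f g x : cdiff f x -> cdiff g x ->
  cpartial k (fun y => f y + g y) x = cpartial k f x + cpartial k g x.
Proof.
move=> [fr fi] [gr gi]; apply: complex_ext; rewrite cE /= -partialD//;
by congr partial; apply/funext => y; rewrite cE.
Qed.

Lemma cdiffM f g x : cdiff f x -> cdiff g x -> cdiff (fun y => f y * g y) x.
Proof.
move=> [fr fi] [gr gi]; split.
  rewrite (_ : (fun _ => _) = (fun y => Re (f y) * Re (g y) - Im (f y) * Im (g y))).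
    by apply: differentiableB; exact: differentiableM.
  by apply/funext => y; rewrite cE.
rewrite (_ : (fun _ => _) = (fun y => Re (f y) * Im (g y) + Im (f y) * Re (g y))).
  by apply: differentiableD; exact: differentiableM.
by apply/funext => y; rewrite cE.
Qed.

Lemma cdiffD f g x : cdiff f x -> cdiff g x -> cdiff (fun y => f y + g y) x.
Proof.
move=> [fr fi] [gr gi]; split.
  rewrite (_ : (fun _ => _) = (fun y => Re (f y) + Re (g y))).
    exact: differentiableD.
  by apply/funext => y; rewrite cE.
rewrite (_ : (fun _ => _) = (fun y => Im (f y) + Im (g y))).
  exact: differentiableD.
by apply/funext => y; rewrite cE.
Qed.

Lemma cdiff_cst (a : R[i]) x : cdiff (fun=> a) x.
Proof. by split; exact: differentiable_cst. Qed.

Lemma cdiff_real (u : 'rV[R]_n -> R) x : differentiable u x ->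
  cdiff (fun y => (u y)%:C) x.
Proof. by split => //=; exact: differentiable_cst. Qed.

Lemma cpartialM k f g x : cdiff f x -> cdiff g x ->
  cpartial k (fun y => f y * g y) x = f x * cpartial k g x + g x * cpartial k f x.
Proof.
move=> df dg; have [[fr fi] [gr gi]] := (df, dg).
have h u w := gradientM (conj u (fun=> erefl)) (conj w (fun=> erefl)).
apply: complex_ext; rewrite !cE /=.
  rewrite (_ : (fun y => _) = (fun y => Re (f y) * Re (g y) - Im (f y) * Im (g y))).
    by rewrite /partial (gradientB (h _ _ _ _ _ fr gr) (h _ _ _ _ _ fi gi)).2; ring.
  by apply/funext => y; rewrite cE.
rewrite (_ : (fun y => _) = (fun y => Re (f y) * Im (g y) + Im (f y) * Re (g y))).
  by rewrite /partial (gradientD (h _ _ _ _ _ fr gi) (h _ _ _ _ _ fi gr)).2; ring.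
by apply/funext => y; rewrite cE.
Qed.

Lemma cpartial_cst k (a : R[i]) x : cpartial k (fun=> a) x = 0.
Proof. by apply: complex_ext; rewrite /= /partial derive_cst. Qed.

Lemma cpartialZ k (a : R[i]) f x : cdiff f x ->
  cpartial k (fun y => a * f y) x = a * cpartial k f x.
Proof.
by move=> df; rewrite (cpartialM k (cdiff_cst a x) df) cpartial_cst mulr0 addr0.
Qed.

Lemma cpartial_real k (u : 'rV[R]_n -> R) x :
  cpartial k (fun y => (u y)%:C) x = (partial k u x)%:C.
Proof. by apply: complex_ext => //=; rewrite /partial derive_cst. Qed.

Lemma cpartial_coord k j x :
  cpartial k (fun y => (y ord0 j)%:C) x = (j == k)%:R%:C.
Proof. by rewrite cpartial_real /partial (gradient_coord x j).2 mxE eqxx. Qed.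

Lemma gradient_cis v x : gradient (fun y => cos (dotp v y)) x
    (fun w => - sin (dotp v x) * dotp v w) /\
  gradient (fun y => sin (dotp v y)) x (fun w => cos (dotp v x) * dotp v w).
Proof.
by split; [exact: (gradient_comp (gradient_dotp v x) (is_derive_cos _))
  |exact: (gradient_comp (gradient_dotp v x) (is_derive_sin _))].
Qed.

Lemma cdiff_cis v x : cdiff (fun y => cis (dotp v y)) x.
Proof. by have [[d1 _] [d2 _]] := gradient_cis v x. Qed.

Lemma cpartial_cis k v x : cpartial k (fun y => cis (dotp v y)) x =
  'i * (v ord0 k)%:C * cis (dotp v x).
Proof.
have [[_ e1] [_ e2]] := gradient_cis v x.
by apply: complex_ext; rewrite !cE /= /partial ?e1 ?e2 dotp_deltar; ring.
Qed.

Lemma cintegral_cpartial0 k f : nice f -> cintegral (cpartial k f) = 0.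
Proof.
move=> [fr fi]; apply: complex_ext => /=.
  exact: (integral_gradient0 tt _ fr).
exact: (integral_gradient0 tt _ fi).
Qed.

End cnice.

(** * The Fourier integral *)
Section ft.
Variables (R : realType) (n : nat).
Local Notation mu := (lebesgue_rv R n).
Local Notation Re := complex.Re.
Local Notation Im := complex.Im.
Local Notation normc := ComplexField.Normc.normc.
Implicit Types (A B f g : 'rV[R]_n -> R[i]) (x y v : 'rV[R]_n).

(** The sign [t] covers both transforms: t = -1 is the Fourier transform and
t = 1 its inverse up to the factor (2 pi)^-n. *)
Definition ft (t : R) A x : R[i] :=
  cintegral (fun xi => cis (t * dotp x xi) * A xi).

Lemma fourierE f : fourier f = ft (-1) f.
Proof.
apply/funext => xi; apply: eq_cintegral => x.
by rewrite mulN1r dotpC.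
Qed.

Lemma inv_fourierE f x : inv_fourier f x = ((2 * pi) ^- n)%:C * ft 1 f x.
Proof.
by congr (_ * _); apply: eq_cintegral => xi; rewrite mul1r.
Qed.

Lemma cisZ_dotp (t : R) x xi : cis (t * dotp x xi) = cis (dotp (t *: x) xi).
Proof. by rewrite dotpZl. Qed.

Lemma nice_ft_integrand t A x : nice A -> nice (fun xi => cis (t * dotp x xi) * A xi).
Proof.
move=> nA; apply: (cnice_eq (cniceM (cslow_cis _ (t *: x)) nA)) => _ xi.
by rewrite cisZ_dotp.
Qed.

Lemma ft_cintegrable t A x : nice A -> cintegrable (fun xi => cis (t * dotp x xi) * A xi).
Proof. by move=> nA; exact: (cnice_cintegrable tt (nice_ft_integrand t x nA)). Qed.

Lemma ftD t A B x : nice A -> nice B ->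
  ft t (fun xi => A xi + B xi) x = ft t A x + ft t B x.
Proof.
move=> nA nB; rewrite -cintegralD; [|exact: ft_cintegrable..].
by apply: eq_cintegral => xi; rewrite mulrDr.
Qed.

Lemma ftZ t (a : R[i]) A x : nice A ->
  ft t (fun xi => a * A xi) x = a * ft t A x.
Proof.
move=> nA; rewrite -cintegralZ; last exact: ft_cintegrable.
by apply: eq_cintegral => xi; rewrite mulrCA.
Qed.

Lemma eq_ft t A B x : A =1 B -> ft t A x = ft t B x.
Proof. by move=> AB; apply: eq_cintegral => xi; rewrite AB. Qed.

(** Integration by parts: the integral of d_k (cis (t x . xi) A) vanishes. *)
Lemma ft_cpartial t A k x : nice A ->
  ft t (cpartial k A) x = - ('i * (t * x ord0 k)%:C) * ft t A x.
Proof.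
move=> nA.
have nk : nice (cpartial k A) by exact: (cnice_cpartial k nA).
have := cintegral_cpartial0 k (nice_ft_integrand t x nA).
rewrite (@eq_cintegral _ _ _ (fun xi => cis (t * dotp x xi) * cpartial k A xi +
    ('i * (t * x ord0 k)%:C) * (cis (t * dotp x xi) * A xi))); last first.
  move=> xi; rewrite (_ : (fun y => _) = (fun y => cis (dotp (t *: x) y) * A y)).
    rewrite cpartialM; [|exact: cdiff_cis|exact: nice_cdiff].
    rewrite cpartial_cis !mxE cisZ_dotp.
    by congr (_ + _); ring.
  by apply/funext => y; rewrite cisZ_dotp.
rewrite cintegralD; last 2 first.
- exact: ft_cintegrable.
- exact: (cnice_cintegrable tt (cniceZ _ (nice_ft_integrand t x nA))).
rewrite cintegralZ; last exact: ft_cintegrable.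
by move/eqP; rewrite addr_eq0 => /eqP E; rewrite /ft E mulNr.
Qed.

(** Differentiation under the integral sign; the differentiated integrand is
again nice, and its modulus does not depend on the base point. *)
Lemma Re_ft_derive t A x v : nice A ->
  is_derive x v (fun y => Re (ft t A y))
    (Re (ft t (fun xi => 'i * (t * dotp v xi)%:C * A xi) x)).
Proof.
move=> nA; pose f (u : R) xi := Re (cis (t * dotp (x + u *: v) xi) * A xi).
have df u xi : is_derive u (1 : R) (f ^~ xi)
   (Re (cis (t * dotp (x + u *: v) xi) * ('i * (t * dotp v xi)%:C * A xi))).
  have -> : f ^~ xi = fun u => cos (t * dotp x xi + u * (t * dotp v xi)) * Re (A xi)
      - sin (t * dotp x xi + u * (t * dotp v xi)) * Im (A xi).
    apply/funext => u'; rewrite /f !cE /= dotpDl dotpZl.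
    by congr (cos _ * _ - sin _ * _); ring.
  have gl := gradientD (gradient_cst (t * dotp x xi) u)
    (gradientM (gradient_id u) (gradient_cst (t * dotp v xi) u)).
  have g := gradientB
    (gradientM (gradient_comp gl (is_derive_cos _)) (gradient_cst (Re (A xi)) u))
    (gradientM (gradient_comp gl (is_derive_sin _)) (gradient_cst (Im (A xi)) u)).
  have := gradient_is_derive (1 : R) g.
  congr is_derive; rewrite !cE /= dotpDl dotpZl.
  rewrite (_ : t * (dotp x xi + u * dotp v xi) =
     t * dotp x xi + u * (t * dotp v xi)); last by ring.
  ring.
have d1 u xi : partial1of2 f u xi =
    Re (cis (t * dotp (x + u *: v) xi) * ('i * (t * dotp v xi)%:C * A xi)).
  by rewrite partial1of2E derive_val.
have nvA : nice (fun xi => 'i * (t * dotp v xi)%:C * A xi).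
  apply: (cniceM _ nA); apply: cslowM; first exact: cslow_cst.
  by apply: cslow_real; apply: slowZ; exact: slow_dotp_cst.
have [C [C0 DC]] := cnice_decay nvA.
have I0 : [set` `](-1), 1[] (0 : R) by rewrite /= in_itv/= ltrN10 ltr01.
have := @cvg_differentiation_under_integral R _ _ mu f setT measurableT
  0 (-1) 1 I0.
move=> /(_ _ _ (fun xi => C * decay xi)) H.
have {}H : h^-1 *: (\int[mu]_xi f (h + 0) xi - \int[mu]_xi f 0 xi) @[h --> (0 : R)^'] -->
    \int[mu]_xi partial1of2 f 0 xi.
  apply: H.
  - by move=> u _; exact: (ft_cintegrable t (x + u *: v) nA).1.
  - by move=> u xi _ _; exact: ex_derive.
  - by move=> xi; rewrite mulr_ge0 ?decay_ge0.
  - exact: (@integrableZl _ _ _ _ _ _ _ _ (integrable_decay R n)).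
  - move=> u xi _ _; rewrite d1.
    rewrite (le_trans (normr_Re_le _))// ComplexField.Normc.normcM normc_cis mul1r.
    exact: (DC tt).
have e : (fun h : R => h^-1 *: (\int[mu]_xi f (h + 0) xi - \int[mu]_xi f 0 xi)) =
    (fun h : R => h^-1 *: (((fun y => Re (ft t A y)) \o shift x) (h *: v)
      - Re (ft t A x))).
  apply/funext => h; congr (_ *: (_ - _)) => /=.
    by rewrite addr0 addrC.
  by rewrite /f scale0r addr0.
have e2 : \int[mu]_xi partial1of2 f 0 xi =
    Re (ft t (fun xi => 'i * (t * dotp v xi)%:C * A xi) x).
  by apply: eq_Rintegral => xi _; rewrite d1 scale0r addr0.
move: H; rewrite e e2 => H; split; first by apply/cvg_ex; eexists; exact: H.
exact: (cvg_lim (@Rhausdorff R) H).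
Qed.

Lemma Im_ft_derive t A x v : nice A ->
  is_derive x v (fun y => Im (ft t A y))
    (Im (ft t (fun xi => 'i * (t * dotp v xi)%:C * A xi) x)).
Proof.
move=> nA.
have ImE (z : R[i]) : Im z = Re (- 'i * z) by rewrite !cE /=; ring.
have nvA : nice (fun xi => 'i * (t * dotp v xi)%:C * A xi).
  apply: (cniceM _ nA); apply: cslowM; first exact: cslow_cst.
  by apply: cslow_real; apply: slowZ; exact: slow_dotp_cst.
rewrite ImE -ftZ// (_ : (fun y => _) = fun y => Re (ft t (fun xi => - 'i * A xi) y)).
  rewrite (@eq_ft t _ (fun xi => 'i * (t * dotp v xi)%:C * (- 'i * A xi))).
    exact: (Re_ft_derive _ _ _ (cniceZ _ nA)).
  by move=> xi; ring.
by apply/funext => y; rewrite ftZ// -ImE.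
Qed.

Lemma cpartial_ft t A k x : nice A ->
  cpartial k (ft t A) x = ft t (fun xi => 'i * (t * xi ord0 k)%:C * A xi) x.
Proof.
move=> nA; have [_ e1] := Re_ft_derive t x (delta_mx ord0 k) nA.
have [_ e2] := Im_ft_derive t x (delta_mx ord0 k) nA.
rewrite /cpartial /partial e1 e2; set a := ft _ _ _.
rewrite (_ : _ +i* _ = a); last by case: a.
by apply: eq_ft => xi; rewrite dotpC dotp_deltar.
Qed.

(** Multiplying the transform by 1 + x_k^2 amounts to transforming A - d_k^2 A,
which is nice again; doing so once for each coordinate gains the inverse of
[decay]. *)
Lemma ft_decay I t (A : I -> 'rV[R]_n -> R[i]) : t ^+ 2 = 1 -> cnice A ->
  exists C, 0 <= C /\ forall i x, normc (ft t (A i) x) <= C * decay x.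
Proof.
move=> t2.
suff H (l : seq 'I_n) : forall A : I -> 'rV[R]_n -> R[i], cnice A ->
    exists C, 0 <= C /\ forall i x,
      (\prod_(k <- l) (1 + x ord0 k ^+ 2)) * normc (ft t (A i) x) <= C.
  move=> nA; have [C [C0 CA]] := H (index_enum 'I_n) _ nA.
  exists C; split => // i x; rewrite -ler_pdivrMr ?decay_gt0//.
  by rewrite invr_decay mulrC.
elim: l => [|k l IH] {}A nA.
  have [C [C0 CA]] := cnice_decay nA.
  exists (2 * \int[mu]_x (C * decay x)); split.
    by rewrite mulr_ge0//; apply: Rintegral_ge0 => x _; rewrite mulr_ge0 ?decay_ge0.
  move=> i x; rewrite big_nil mul1r; apply: normc_cintegral_le.
  - exact/ft_cintegrable/(cnice_nice i nA).
  - exact: (@integrableZl _ _ _ _ _ _ _ _ (integrable_decay R n)).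
  - by move=> xi; rewrite ComplexField.Normc.normcM normc_cis mul1r CA.
pose B i xi := A i xi + (-1) * cpartial k (cpartial k (A i)) xi.
have nB : cnice B.
  by apply: cniceD => //; apply: cniceZ; do 2 apply: cnice_cpartial.
have [C [C0 CB]] := IH _ nB; exists C; split => // i x.
have := CB i x; rewrite big_cons.
have nAi := cnice_nice i nA.
have nk : nice (cpartial k (A i)) := cnice_cpartial k nAi.
have nkk : nice (cpartial k (cpartial k (A i))) := cnice_cpartial k nk.
rewrite /B ftD//; last exact: cniceZ.
rewrite ftZ// !ft_cpartial//.
set a := ft t (A i) x.
rewrite [X in normc X](_ : _ = (1 + x ord0 k ^+ 2)%:C * a); last first.
  have e : x ord0 k ^+ 2 = t ^+ 2 * x ord0 k ^+ 2 by rewrite t2 mul1r.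
  by apply: complex_ext; rewrite !cE /= [X in 1 + X]e; ring.
rewrite ComplexField.Normc.normcM normcR ger0_norm ?(ltW (oneDsqr_gt0 _))//.
by rewrite mulrCA mulrA.
Qed.

End ft.

(** * The Fourier transform of a Gaussian *)
Section gauss_fourier.
Variables (R : realType) (n : nat).
Local Notation mu := (lebesgue_rv R n).
Local Notation Re := complex.Re.
Local Notation Im := complex.Im.
Implicit Types (A B f g : 'rV[R]_n -> R[i]) (x y v : 'rV[R]_n).

Lemma integral_gauss1 (c : R) : 0 < c ->
  (\int[@lebesgue_measure R]_x (expR (- (c / 2) * x ^+ 2))%:E =
   (Num.sqrt (2 * pi / c))%:E)%E.
Proof.
move=> c0; pose s := Num.sqrt c^-1.
have s0 : s != 0 by rewrite gt_eqF// sqrtr_gt0 invr_gt0.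
have s2 : s ^+ 2 = c^-1 by rewrite sqr_sqrtr// invr_ge0 ltW.
have p0 := normal_peak_gt0 s0.
have e : (normal_peak s)^-1 = Num.sqrt (2 * pi / c).
  by rewrite /normal_peak invrK s2; congr Num.sqrt; field; rewrite gt_eqF.
rewrite -e -[RHS]mule1 -(@integral_normal_pdf _ 0 s).
rewrite -ge0_integralZl//=; last 3 first.
- by apply/measurable_EFinP; exact: measurable_normal_pdf.
- by move=> x _; rewrite lee_fin normal_pdf_ge0.
- by rewrite lee_fin invr_ge0 ltW.
apply: eq_integral => x _; rewrite -EFinM normal_pdfE// mulKf ?gt_eqF//.
rewrite /normal_fun subr0 s2; congr (expR _)%:E; field.
by rewrite gt_eqF.
Qed.

Lemma integral_gauss (c : R) : 0 < c ->
  \int[mu]_x gauss c 0 x = Num.sqrt (2 * pi / c) ^+ n.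
Proof.
move=> c0; rewrite /Rintegral.
under eq_integral => x _.
  rewrite (_ : gauss c 0 x = \prod_i expR (- (c / 2) * x ord0 i ^+ 2)).
    over.
  by rewrite /gauss subr0 /dotp mulr_sumr expR_sum.
rewrite (ge0_integral_prod_coord (g := fun _ t => expR (- (c / 2) * t ^+ 2))).
- under eq_bigr do rewrite integral_gauss1//.
  by rewrite prodEFin prodr_const card_ord.
- move=> _; apply: (measurableT_comp (@measurable_expR R)).
  by apply: measurable_funM => //; exact: exprn_measurable.
- by move=> _ t; exact: expR_ge0.
Qed.

Lemma nice_gauss (c : R) v : 0 < c -> nice (fun x => (gauss c v x)%:C).
Proof.
move=> c0; split => /=; last first.
  exists c, (fun _ _ => 0); split => //; first exact: slow_const.
  by move=> _ x; rewrite mul0r.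
exists (c / 2), (fun _ x => expR (c / 2 * dotp v v) * gauss (c / 2) (2 *: v) x).
split; first by rewrite divr_gt0.
  by apply: slowZ; apply: slow_gauss; rewrite divr_ge0// ltW.
move=> _ x; rewrite /gauss subr0 -!expRD; congr expR.
by rewrite !(dotpDl, dotpDr, dotpNl, dotpNr, dotpZl, dotpZr) (dotpC v x); field.
Qed.

Lemma nice_sum (T : Type) (s : seq T) (B : T -> 'rV[R]_n -> R[i]) :
  (forall k, nice (B k)) -> nice (fun x => \sum_(k <- s) B k x).
Proof.
move=> nB; elim: s => [|k s IH].
  apply: (cnice_eq (cniceZ 0 (nice_gauss 0 (@ltr01 R)))) => i x.
  by rewrite big_nil mul0r.
by apply: (cnice_eq (cniceD (nB k) IH)) => i x; rewrite big_cons.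
Qed.

Lemma ft_sum t (T : Type) (s : seq T) (B : T -> 'rV[R]_n -> R[i]) x :
  (forall k, nice (B k)) ->
  ft t (fun xi => \sum_(k <- s) B k xi) x = \sum_(k <- s) ft t (B k) x.
Proof.
move=> nB; elim: s => [|k s IH].
  rewrite big_nil (@eq_ft _ _ _ _ (fun xi => 0 * (gauss 1 0 xi)%:C)); last first.
    by move=> xi; rewrite big_nil mul0r.
  by rewrite ftZ ?mul0r//; exact: nice_gauss.
rewrite big_cons -IH -ftD//; last exact: nice_sum.
by apply: eq_ft => xi; rewrite big_cons.
Qed.

Lemma cpartial_gauss c v k x :
  cpartial k (fun y => (gauss c v y)%:C) x =
  (- c * (x ord0 k - v ord0 k))%:C * (gauss c v x)%:C.
Proof.
rewrite cpartial_real /partial (gradient_gauss c v x).2 dotp_deltar !mxE.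
by rewrite -rmorphM.
Qed.

(** Because xi times a Gaussian is a multiple of its gradient, differentiating
its transform H under the integral and integrating by parts yields
D_v H (y) = - (v . y) H (y) / c. Along the ray from 0 to x this is a linear
differential equation whose solutions are multiples of a Gaussian, and H(0) is
the integral of the Gaussian. *)
Lemma ft_gauss t c x : 0 < c -> t ^+ 2 = 1 ->
  ft t (fun xi => (gauss c 0 xi)%:C) x =
  (Num.sqrt (2 * pi / c) ^+ n)%:C * (gauss c^-1 0 x)%:C.
Proof.
move=> c0 t2; pose g (xi : 'rV[R]_n) := (gauss c 0 xi)%:C : R[i]; pose H := ft t g.
have cn0 : c%:C != 0 :> R[i] by rewrite (inj_eq (@complexI _)) gt_eqF.
have ng : nice g by exact: nice_gauss.
have dH v y : ft t (fun xi => 'i * (t * dotp v xi)%:C * g xi) y =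
    (- (c^-1 * dotp v y))%:C * H y.
  rewrite (@eq_ft _ _ _ _ (fun xi => \sum_k
      (- ('i * (t * v ord0 k / c)%:C)) * cpartial k g xi)); last first.
    move=> xi; rewrite /g; under eq_bigr do rewrite cpartial_gauss.
    rewrite /dotp mulr_sumr rmorph_sum mulr_sumr mulr_suml.
    apply: eq_bigr => k _; rewrite mxE subr0.
    by apply: complex_ext; rewrite !cE /=; field; rewrite gt_eqF.
  rewrite ft_sum; last by move=> k; apply: cniceZ; exact: cnice_cpartial.
  rewrite /dotp mulr_sumr -sumrN rmorph_sum mulr_suml.
  apply: eq_bigr => k _; rewrite ftZ; last exact: cnice_cpartial.
  rewrite ft_cpartial// mulrA -/H; congr (_ * H y).
  transitivity ((- (t ^+ 2 * (c^-1 * (v ord0 k * y ord0 k))))%:C : R[i]).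
    by apply: complex_ext; rewrite !cE /=; ring.
  by rewrite t2 mul1r.
(* The inverse of the expected solution along the ray: the derivative of
   u |-> H (u x) E u vanishes. *)
pose E (u : R) := expR (c^-1 / 2 * dotp x x * u ^+ 2).
have dE (u : R) : is_derive u (1 : R) E (c^-1 * dotp x x * u * E u).
  have g2 := gradient_comp (gradientZ (c^-1 / 2 * dotp x x)
    (gradientM (gradient_id u) (gradient_id u))) (is_derive_expR _).
  have := gradient_is_derive (1 : R) g2.
  congr is_derive; rewrite /E expr2; field; rewrite gt_eqF//.
have key (h : 'rV[R]_n -> R) :
    (forall y, is_derive y x h (- (c^-1 * dotp x y) * h y)) ->
    h x = h 0 * gauss c^-1 0 x.
  move=> dh; pose q (u : R) := h (0 + u *: x) * E u.
  have dq (u : R) : is_derive u (1 : R) q 0.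
    have dl := @is_derive_line R n h 0 x u.
    have {}dl := dl (@ex_derive _ _ _ _ _ _ _ (dh _)).
    have := is_deriveM dl (dE u).
    congr is_derive.
    rewrite (derive_val (f := h)) /GRing.scale /= add0r dotpZr; ring.
  have := @is_derive_0_is_cst R q 1 0 dq.
  rewrite /q /E scale1r scale0r !add0r expr1n expr0n /= mulr0 mulr1 expR0 mulr1.
  move=> <-; rewrite -mulrA -expRD subr0 mulNr subrr expR0 mulr1//.
have H0 : H 0 = (Num.sqrt (2 * pi / c) ^+ n)%:C.
  rewrite -integral_gauss//; apply: complex_ext => /=.
    by apply: eq_Rintegral => xi _; rewrite ?cE /= dotp0l !mulr0 ?cos0 ?sin0; ring.
  transitivity (\int[mu]_x (0 : R)).
    by apply: eq_Rintegral => xi _; rewrite ?cE /= dotp0l !mulr0 ?cos0 ?sin0; ring.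
  by rewrite /Rintegral integral0.
have kr : Re (H x) = Re (H 0) * gauss c^-1 0 x.
  apply: (key (fun y => Re (H y))) => y.
  by have := Re_ft_derive t y x ng; rewrite dH -/H ReCM.
have ki : Im (H x) = Im (H 0) * gauss c^-1 0 x.
  apply: (key (fun y => Im (H y))) => y.
  by have := Im_ft_derive t y x ng; rewrite dH -/H ImCM.
by rewrite -/g -/H -H0; apply: complex_ext; rewrite ?ReMC ?ImMC.
Qed.

End gauss_fourier.

(** * Gaussian wave packets and Fourier inversion *)
Section waves.
Variables (R : realType) (n : nat).
Local Notation Re := complex.Re.
Local Notation Im := complex.Im.
Local Notation normc := ComplexField.Normc.normc.
Implicit Types (A B f g : 'rV[R]_n -> R[i]) (x y v : 'rV[R]_n).

(** Combinations of monomials times plane waves times Gaussians. The class is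
closed under products and derivatives, so it contains everything inside J^s in
the commutator, while each constructor is an induction step of Fourier
inversion. *)
Inductive wave : ('rV[R]_n -> R[i]) -> Prop :=
| wave_gauss c v of 0 < c : wave (fun x => cis (dotp v x) * (gauss c 0 x)%:C)
| wave_coord k f of wave f : wave (fun x => (x ord0 k)%:C * f x)
| wave_lin (a : R[i]) f g of wave f & wave g : wave (fun x => a * f x + g x).

Lemma wave_eq f g : wave f -> f =1 g -> wave g.
Proof. by move=> wf /funext <-. Qed.

Lemma wave0 : wave (fun=> 0).
Proof.
have w := wave_gauss 0 (@ltr01 R).
by apply: (wave_eq (wave_lin (-1) w w)) => x; rewrite mulN1r addNr.
Qed.

Lemma waveZ (a : R[i]) f : wave f -> wave (fun x => a * f x).
Proof. by move=> wf; apply: (wave_eq (wave_lin a wf wave0)) => x; rewrite addr0. Qed.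

Lemma waveD f g : wave f -> wave g -> wave (fun x => f x + g x).
Proof. by move=> wf wg; apply: (wave_eq (wave_lin 1 wf wg)) => x; rewrite mul1r. Qed.

Lemma wave_sum (T : Type) (s : seq T) (B : T -> 'rV[R]_n -> R[i]) :
  (forall k, wave (B k)) -> wave (fun x => \sum_(k <- s) B k x).
Proof.
move=> wB; elim: s => [|k s IH].
  by apply: (wave_eq wave0) => x; rewrite big_nil.
by apply: (wave_eq (waveD (wB k) IH)) => x; rewrite big_cons.
Qed.

Lemma wave_cis v f : wave f -> wave (fun x => cis (dotp v x) * f x).
Proof.
elim=> {f} [c w c0|k f _ IH|a f g _ IHf _ IHg].
- apply: (wave_eq (wave_gauss (v + w) c0)) => x.
  by rewrite dotpDl cisD mulrA.
- by apply: (wave_eq (wave_coord k IH)) => x; rewrite mulrCA.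
- by apply: (wave_eq (wave_lin a IHf IHg)) => x; rewrite mulrDr mulrCA.
Qed.

Lemma waveM f g : wave f -> wave g -> wave (fun x => f x * g x).
Proof.
move=> + wg; elim=> {f} [c w c0|k f _ IH|a f h _ IHf _ IHh].
- apply: (@wave_eq (fun x => cis (dotp w x) * ((gauss c 0 x)%:C * g x))); last first.
    by move=> x; rewrite mulrA.
  apply: wave_cis; elim: wg => {g} [d v d0|k g _ IH|a g h _ IHg _ IHh].
  + apply: (wave_eq (wave_gauss v (addr_gt0 c0 d0))) => x.
    by rewrite -gaussD real_complexM; ring.
  + by apply: (wave_eq (wave_coord k IH)) => x; rewrite mulrCA.
  + by apply: (wave_eq (wave_lin a IHg IHh)) => x; rewrite mulrDr mulrCA.
- by apply: (wave_eq (wave_coord k IH)) => x; rewrite mulrA.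
- by apply: (wave_eq (wave_lin a IHf IHh)) => x; rewrite mulrDl mulrA.
Qed.

Lemma wave_conj f : wave f -> wave (fun x => conjc (f x)).
Proof.
elim=> {f} [c w c0|k f _ IH|a f g _ IHf _ IHg].
- apply: (wave_eq (wave_gauss (- w) c0)) => x.
  by rewrite conjcM conjc_cis conjc_real dotpNl.
- by apply: (wave_eq (wave_coord k IH)) => x; rewrite conjcM conjc_real.
- by apply: (wave_eq (wave_lin (conjc a) IHf IHg)) => x; rewrite conjcD conjcM.
Qed.

Lemma wave_nice f : wave f -> nice f.
Proof.
elim=> {f} [c w c0|k f _ IH|a f g _ IHf _ IHg].
- by apply: cniceM; [exact: cslow_cis|exact: nice_gauss].
- exact: cnice_coord.
- by apply: cniceD => //; exact: cniceZ.
Qed.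

Lemma wave_cdiff f x : wave f -> cdiff f x.
Proof. by move=> /wave_nice/nice_cdiff. Qed.

Lemma wave_cpartial k f : wave f -> wave (cpartial k f).
Proof.
elim=> {f} [c w c0|j f wf IH|a f g wf IHf wg IHg].
- have h := wave_gauss w c0.
  have dg x : cdiff (fun y : 'rV[R]_n => (gauss c 0 y)%:C) x.
    by apply: nice_cdiff; exact: nice_gauss.
  apply: (wave_eq (waveD (waveZ (- c)%:C (wave_coord k h))
    (waveZ ('i * (w ord0 k)%:C) h))) => x.
  rewrite cpartialM//; last exact: cdiff_cis.
  by rewrite cpartial_cis cpartial_gauss mxE subr0 real_complexM; ring.
- apply: (wave_eq (waveD (wave_coord j IH) (waveZ ((j == k)%:R)%:C wf))) => x.
  rewrite cpartialM ?cpartial_coord//; last exact: wave_cdiff.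
    by congr (_ + _); rewrite mulrC.
  by apply: cdiff_real; exact: differentiable_coord.
- apply: (wave_eq (wave_lin a IHf IHg)) => x.
  rewrite cpartialD; last exact: wave_cdiff.
    by rewrite cpartialZ//; exact: wave_cdiff.
  by apply: cdiffM; [exact: cdiff_cst|exact: wave_cdiff].
Qed.

Lemma N1_sqr : (-1 : R) ^+ 2 = 1. Proof. by rewrite sqrrN expr1n. Qed.

Definition gauss_cst (c : R) : R := Num.sqrt (2 * pi / c) ^+ n.

Lemma gauss_cstM c : 0 < c -> gauss_cst c * gauss_cst c^-1 = (2 * pi) ^+ n.
Proof.
move=> c0; rewrite /gauss_cst -exprMn -sqrtrM; last first.
  by rewrite divr_ge0 ?mulr_ge0 ?pi_ge0// ltW.
rewrite invrK (_ : 2 * pi / c * (2 * pi * c) = (2 * pi) ^+ 2); last first.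
  by field; rewrite gt_eqF.
by rewrite sqrtr_sqr ger0_norm// mulr_ge0// pi_ge0.
Qed.

Lemma gauss0_shift (c : R) x v : gauss c 0 (x + v) = gauss c (- v) x.
Proof. by rewrite /gauss subr0 opprK. Qed.

Lemma ft_wave_gauss t c v x : 0 < c -> t ^+ 2 = 1 ->
  ft t (fun y => cis (dotp v y) * (gauss c 0 y)%:C) x =
  (gauss_cst c)%:C * (gauss c^-1 (- (t *: v)) x)%:C.
Proof.
move=> c0 t2; rewrite /gauss_cst.
transitivity (ft t (fun y => (gauss c 0 y)%:C) (x + t *: v)).
  apply: eq_cintegral => y; rewrite mulrA -cisD; congr (cis _ * _).
  by rewrite dotpDl dotpZl mulrDr mulrA -expr2 t2 mul1r.
by rewrite (ft_gauss _ c0 t2) gauss0_shift.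
Qed.

(** Multiplication by x_k becomes i d_k on the Fourier side, and [ft_cpartial]
turns it back into multiplication by x_k in the inversion formula. *)
Lemma ft_wave_coord f k x : wave f ->
  ft (-1) (fun y => (y ord0 k)%:C * f y) x = 'i * cpartial k (ft (-1) f) x.
Proof.
move=> wf; have nf := wave_nice wf.
rewrite cpartial_ft// -ftZ; last first.
  apply: cniceM => //; apply: cslowM; first exact: cslow_cst.
  by apply: cslow_real; apply: slowZ; exact: slow_coord.
apply: eq_ft => y; rewrite !mulrA mulN1r real_complexN mulrN.
by rewrite -expr2 sqr_i !mulN1r opprK.
Qed.

Lemma wave_nice_fourier f : wave f -> nice (ft (-1) f).
Proof.
elim=> {f} [c w c0|k f wf IH|a f g wf IHf wg IHg].
- have c0' : 0 < c^-1 by rewrite invr_gt0.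
  apply: (cnice_eq (cniceZ (gauss_cst c)%:C (nice_gauss w c0'))) => _ x.
  by rewrite (ft_wave_gauss _ _ c0 N1_sqr) scaleN1r opprK.
- apply: (cnice_eq (cniceZ 'i (cnice_cpartial k IH))) => _ x.
  by rewrite ft_wave_coord.
- apply: (cnice_eq (cniceD (cniceZ a IHf) IHg)) => _ x.
  rewrite ftD ?ftZ//; try exact: wave_nice.
  by apply: cniceZ; exact: wave_nice.
Qed.

(** A modulated Gaussian has a translated Gaussian as transform, and the two
Gaussian constants multiply to (2 pi)^n; coordinates and linear combinations
follow from the rules for [ft]. *)
Lemma wave_inversion f x : wave f -> ft 1 (ft (-1) f) x = ((2 * pi) ^+ n)%:C * f x.
Proof.
move=> wf; elim: wf x => {f} [c w c0|k f wf IH|a f g wf IHf wg IHg] x.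
- have c0' : 0 < c^-1 by rewrite invr_gt0.
  rewrite (@eq_ft _ _ _ _ (fun xi => (gauss_cst c)%:C * (gauss c^-1 w xi)%:C)); last first.
    by move=> xi; rewrite (ft_wave_gauss _ _ c0 N1_sqr) scaleN1r opprK.
  rewrite ftZ; last exact: nice_gauss.
  have [mr mi] := cnice_measurable tt (nice_ft_integrand 1 x (nice_gauss w c0')).
  rewrite /ft -(cintegral_shift w mr mi).
  rewrite (@eq_cintegral _ _ _ (fun xi => cis (dotp w x) *
      (cis (1 * dotp x xi) * (gauss c^-1 0 xi)%:C))); last first.
    move=> xi; rewrite mulrA -cisD dotpDr !mul1r (dotpC w) addrC /gauss.
    by rewrite addrK subr0.
  rewrite cintegralZ; last exact/ft_cintegrable/nice_gauss.
  rewrite [X in _ * (_ * X)]ft_gauss ?expr1n// -/(gauss_cst _) invrK.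
  by rewrite -(gauss_cstM c0) real_complexM; ring.
- rewrite (@eq_ft _ _ _ _ (fun xi => 'i * cpartial k (ft (-1) f) xi)); last first.
    by move=> xi; rewrite ft_wave_coord.
  have nf := wave_nice_fourier wf.
  rewrite ftZ; last exact: cnice_cpartial.
  rewrite ft_cpartial// IH mul1r !mulrA mulrN !mulrA -expr2 sqr_i; ring.
- have nf := wave_nice_fourier wf; have ng := wave_nice_fourier wg.
  rewrite (@eq_ft _ _ _ _ (fun xi => a * ft (-1) f xi + ft (-1) g xi)); last first.
    move=> xi; rewrite ftD ?ftZ//; try exact: wave_nice.
    by apply: cniceZ; exact: wave_nice.
  rewrite ftD//; last exact: cniceZ.
  by rewrite ftZ// IHf IHg; ring.
Qed.

Lemma cpartialZ_derivable k (t : R) f x :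
  derivable (fun y => Re (f y)) x (delta_mx ord0 k) ->
  derivable (fun y => Im (f y)) x (delta_mx ord0 k) ->
  cpartial k (fun y => t%:C * f y) x = t%:C * cpartial k f x.
Proof.
move=> dr di; rewrite /cpartial /partial.
have -> : (fun y => Re (t%:C * f y)) = t *: (fun y => Re (f y)).
  by apply/funext => y; rewrite ReCM.
have -> : (fun y => Im (t%:C * f y)) = t *: (fun y => Im (f y)).
  by apply/funext => y; rewrite ImCM.
by rewrite (deriveZ t dr) (deriveZ t di); apply: complex_ext; rewrite (ReCM, ImCM).
Qed.

Section bessel.
Variable s : R.

Definition symbol (r : R) v (xi : 'rV[R]_n) : R :=
  (r * (1 + dotp (xi + v) (xi + v))) `^ (s / 2).

Lemma slow_symbol (r : R) v : 0 < r -> slow (fun _ : unit => symbol r v).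
Proof.
move=> r0; pose q := r * (1 + dotp v v).
have q0 : 0 < q by rewrite mulr_gt0// oneDdotp_gt0.
apply: (@slow_weight _ _ _ _ (q + q^-1)) => // _.
  by rewrite lerDl invr_ge0 ltW.
by rewrite -/q mulrDl mulVf ?gt_eqF// lerDr mulr_ge0 ?ltW.
Qed.

Lemma nice_symbol (r : R) v A : 0 < r -> nice A ->
  nice (fun xi => (symbol r v xi)%:C * A xi).
Proof. by move=> r0 nA; apply: cniceM => //; apply: cslow_real; exact: slow_symbol. Qed.

Definition fourier_cst : R[i] := ((2 * pi) ^- n)%:C.

Lemma fourier_cstK (a : R[i]) : fourier_cst * (((2 * pi) ^+ n)%:C * a) = a.
Proof.
rewrite mulrA -real_complexM mulVf ?mul1r//.
by rewrite expf_neq0// mulf_neq0// gt_eqF// pi_gt0.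
Qed.

(** Up to a power of [r], this is J^s conjugated by the plane wave of frequency
[v]; see [bessel_cis]. The case r = 1, v = 0 is J^s. *)
Definition modulated_bessel (r : R) v f x : R[i] :=
  fourier_cst * ft 1 (fun xi => (symbol r v xi)%:C * ft (-1) f xi) x.

Lemma besselE f x : bessel s f x = modulated_bessel 1 0 f x.
Proof.
rewrite /bessel /fourier_multiplier inv_fourierE fourierE.
rewrite (@eq_ft _ _ _ _ (fun xi => (symbol 1 0 xi)%:C * ft (-1) f xi))//.
by move=> xi; rewrite /symbol addr0 mul1r.
Qed.

Lemma modulated_bessel_lin (r : R) v (a : R[i]) f g x : 0 < r -> wave f -> wave g ->
  modulated_bessel r v (fun y => a * f y + g y) x =
  a * modulated_bessel r v f x + modulated_bessel r v g x.
Proof.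
move=> r0 wf wg; have nf := wave_nice_fourier wf; have ng := wave_nice_fourier wg.
rewrite /modulated_bessel (@eq_ft _ _ _ _ (fun xi =>
    a * ((symbol r v xi)%:C * ft (-1) f xi) + (symbol r v xi)%:C * ft (-1) g xi)).
  rewrite ftD; [|exact/cniceZ/nice_symbol|exact: nice_symbol].
  by rewrite ftZ; [rewrite mulrDr mulrCA|exact: nice_symbol].
move=> xi; rewrite ftD ?ftZ; try exact: wave_nice; first by ring.
by apply: cniceZ; exact: wave_nice.
Qed.

Lemma bessel_lin (a : R[i]) f g x : wave f -> wave g ->
  bessel s (fun y => a * f y + g y) x = a * bessel s f x + bessel s g x.
Proof. by move=> wf wg; rewrite !besselE modulated_bessel_lin. Qed.

Lemma cpartial_bessel k f x : wave f ->
  cpartial k (bessel s f) x = bessel s (cpartial k f) x.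
Proof.
move=> wf; have nf := wave_nice_fourier wf.
have -> : bessel s f = (fun y => fourier_cst *
    ft 1 (fun xi => (symbol 1 0 xi)%:C * ft (-1) f xi) y).
  by apply/funext => y; rewrite besselE.
have nS := nice_symbol 0 (@ltr01 R) nf.
rewrite besselE /modulated_bessel.
have e1 := cpartial_ft 1 k x nS.
rewrite [RHS](_ : _ = fourier_cst * cpartial k (ft 1 (fun xi => (symbol 1 0 xi)%:C * ft (-1) f xi)) x); last first.
  rewrite e1; congr (_ * _); apply: eq_ft => xi.
  rewrite ft_cpartial; last exact: wave_nice.
  by rewrite mul1r mulN1r real_complexN; ring.
rewrite /fourier_cst; set F := ft 1 _.
have d1 := @ex_derive _ _ _ _ _ _ _ (Re_ft_derive 1 x (delta_mx ord0 k) nS).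
have d2 := @ex_derive _ _ _ _ _ _ _ (Im_ft_derive 1 x (delta_mx ord0 k) nS).
exact: (@cpartialZ_derivable k ((2 * pi) ^- n) F x d1 d2).
Qed.

(** Multiplication by a plane wave translates the Fourier transform; translating
the variable of integration back moves the shift onto the symbol. *)
Lemma bessel_cis (r : R) v f x : 0 < r -> wave f ->
  bessel s (fun y => cis (dotp v y) * f y) x =
  (r `^ (- (s / 2)))%:C * (cis (dotp v x) * modulated_bessel r v f x).
Proof.
move=> r0 wf; have nf := wave_nice_fourier wf.
have nfv : nice (ft (-1) (fun y => cis (dotp v y) * f y)).
  exact/wave_nice_fourier/wave_cis.
rewrite besselE /modulated_bessel.
have [mr mi] := cnice_measurable tt
  (nice_ft_integrand 1 x (nice_symbol 0 (@ltr01 R) nfv)).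
set F := ft 1 (fun xi => (symbol r v xi)%:C * _) x.
suff -> : ft 1 (fun xi => (symbol 1 0 xi)%:C *
      ft (-1) (fun y => cis (dotp v y) * f y) xi) x =
    (r `^ (- (s / 2)))%:C * cis (dotp v x) * F by ring.
rewrite /F /ft -(cintegral_shift v mr mi) -cintegralZ; last first.
  exact: (ft_cintegrable 1 x (nice_symbol v r0 nf)).
apply: eq_cintegral => xi.
have -> : ft (-1) (fun y => cis (dotp v y) * f y) (xi + v) = ft (-1) f xi.
  apply: eq_cintegral => y; rewrite mulrA -cisD; congr (cis _ * _).
  by rewrite dotpDl; ring.
have -> : symbol 1 0 (xi + v) = r `^ (- (s / 2)) * symbol r v xi.
  rewrite /symbol addr0 mul1r powRM ?(ltW r0) ?(ltW (oneDdotp_gt0 _))//.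
  by rewrite mulrA powRN mulVf ?mul1r// gt_eqF// powR_gt0.
by rewrite -[cintegral _]/(ft (-1) f xi) real_complexM !mul1r dotpDr cisD (dotpC v x); ring.
Qed.

(** The recentred symbols form one slow family, so the decay of their inverse
transforms is uniform in the index. *)
Lemma modulated_bessel_decay I (r : I -> R) (v : I -> 'rV[R]_n) C f :
  (forall i, 0 < r i) -> (forall i, r i * (1 + dotp (v i) (v i)) <= C) ->
  (forall i, 1 <= C * (r i * (1 + dotp (v i) (v i)))) -> wave f ->
  exists K, 0 <= K /\
    forall i x, normc (modulated_bessel (r i) (v i) f x) <= K * decay x.
Proof.
move=> r0 rC Cr wf; have nf := nice_cst I (wave_nice_fourier wf).
have nA : cnice (fun i xi => (symbol (r i) (v i) xi)%:C * ft (-1) f xi).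
  by apply: cniceM => //; apply: cslow_real; exact: (@slow_weight _ _ _ _ C).
have [K [K0 AK]] := ft_decay (expr1n _ 2) nA.
exists (normc fourier_cst * K); split; first by rewrite mulr_ge0// normc_ge0.
move=> i x; rewrite ComplexField.Normc.normcM -mulrA.
by rewrite ler_wpM2l// normc_ge0.
Qed.

End bessel.

End waves.

(** * Measurability and Lebesgue norms *)
Section norms.
Variables (R : realType) (n : nat).
Local Notation mu := (lebesgue_rv R n).
Local Notation Re := complex.Re.
Local Notation Im := complex.Im.
Local Notation normc := ComplexField.Normc.normc.
Implicit Types (A f g h : 'rV[R]_n -> R[i]) (x y v : 'rV[R]_n).

Definition cmeasurable f := measurable_fun setT (fun x => Re (f x)) /\
  measurable_fun setT (fun x => Im (f x)).

Lemma cmeasurableD f g : cmeasurable f -> cmeasurable g ->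
  cmeasurable (fun x => f x + g x).
Proof.
move=> [fr fi] [gr gi]; split.
  by apply: (eq_measurable_fun (fun x => Re (f x) + Re (g x))) => [x _|];
    [rewrite cE|exact: measurable_funD].
by apply: (eq_measurable_fun (fun x => Im (f x) + Im (g x))) => [x _|];
    [rewrite cE|exact: measurable_funD].
Qed.

Lemma cmeasurableM f g : cmeasurable f -> cmeasurable g ->
  cmeasurable (fun x => f x * g x).
Proof.
move=> [fr fi] [gr gi]; split.
  apply: (eq_measurable_fun (fun x => Re (f x) * Re (g x) - Im (f x) * Im (g x))).
    by move=> x _; rewrite cE.
  by apply: measurable_funB; exact: measurable_funM.
apply: (eq_measurable_fun (fun x => Re (f x) * Im (g x) + Im (f x) * Re (g x))).
  by move=> x _; rewrite cE.
by apply: measurable_funD; exact: measurable_funM.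
Qed.

Lemma cmeasurable_cst (a : R[i]) : cmeasurable (fun=> a).
Proof. by split; exact: measurable_cst. Qed.

Lemma cmeasurable_sum (T : Type) (s : seq T) (F : T -> 'rV[R]_n -> R[i]) :
  (forall k, cmeasurable (F k)) -> cmeasurable (fun x => \sum_(k <- s) F k x).
Proof.
move=> mF; elim: s => [|k s IH].
  rewrite (_ : (fun x => _) = fun=> 0); first exact: cmeasurable_cst.
  by apply/funext => x; rewrite big_nil.
rewrite (_ : (fun x => _) = fun x => F k x + \sum_(k <- s) F k x).
  exact: cmeasurableD.
by apply/funext => x; rewrite big_cons.
Qed.

Lemma measurable_normc f : cmeasurable f -> measurable_fun setT (fun x => normc (f x)).
Proof.
move=> [fr fi].
apply: (eq_measurable_fun (fun x => Num.sqrt (Re (f x) ^+ 2 + Im (f x) ^+ 2))).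
  by move=> x _; rewrite normcE2.
apply: (@measurableT_comp _ _ _ _ _ _ (@Num.sqrt R) _
  (fun x => Re (f x) ^+ 2 + Im (f x) ^+ 2)).
  by apply: continuous_measurable_fun; exact: sqrt_continuous.
by apply: measurable_funD; apply: measurable_funX.
Qed.

Lemma nice_cmeasurable f : nice f -> cmeasurable f.
Proof. by move=> nf; exact: (cnice_measurable tt nf). Qed.

Lemma wave_cmeasurable f : wave f -> cmeasurable f.
Proof. by move=> /wave_nice/nice_cmeasurable. Qed.

(** Adding the dominating function makes the integrand nonnegative, so that
measurability in the parameter is part of Tonelli's theorem; the integral [K] of
the added function is subtracted afterwards. *)
Lemma Re_ft_measurable t A : nice A -> measurable_fun setT (fun x => Re (ft t A x)).
Proof.
move=> nA; have [C [C0 AC]] := cnice_decay nA.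
pose G (z : 'rV[R]_n * 'rV[R]_n) := Re (cis (t * dotp z.1 z.2) * A z.2) + C * decay z.2.
have [mr mi] := nice_cmeasurable nA.
have md : measurable_fun setT (fun z : 'rV[R]_n * 'rV[R]_n => t * dotp z.1 z.2).
  apply: measurable_funM => //; apply: measurable_sum => k.
  apply: measurable_funM.
    exact: (measurableT_comp (measurable_rv_coord k) measurable_fst).
  exact: (measurableT_comp (measurable_rv_coord k) measurable_snd).
have mG : measurable_fun setT G.
  apply: measurable_funD; last first.
    apply: measurable_funM => //.
    exact: (measurableT_comp (@measurable_decay R n) measurable_snd).
  apply: (eq_measurable_fun (fun z : 'rV[R]_n * 'rV[R]_n =>
    cos (t * dotp z.1 z.2) * Re (A z.2) - sin (t * dotp z.1 z.2) * Im (A z.2))).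
    by move=> z _; rewrite cE.
  apply: measurable_funB; apply: measurable_funM.
  - apply: (measurableT_comp _ md).
    by apply: continuous_measurable_fun; exact: continuous_cos.
  - exact: (measurableT_comp mr measurable_snd).
  - apply: (measurableT_comp _ md).
    by apply: continuous_measurable_fun; exact: continuous_sin.
  - exact: (measurableT_comp mi measurable_snd).
have G0 z : 0 <= G z.
  have := le_trans (normr_Re_le _) (AC tt z.2).
  have h : `|Re (cis (t * dotp z.1 z.2) * A z.2)| <= C * decay z.2.
    apply: le_trans (normr_Re_le _) _.
    by rewrite ComplexField.Normc.normcM normc_cis mul1r (AC tt).
  by move: h; rewrite ler_norml /G => /andP[h _] _; rewrite -lerBlDr sub0r.
pose K := \int[mu]_xi (C * decay xi).
have icd : mu.-integrable setT (EFin \o (fun xi : 'rV[R]_n => C * decay xi)).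
  exact: (@integrableZl _ _ _ _ _ _ _ _ (integrable_decay R n)).
apply: (eq_measurable_fun (fun x => fine (\int[mu]_xi (G (x, xi))%:E) - K)).
  move=> x _.
  have -> : fine (\int[mu]_xi (G (x, xi))%:E) = Re (ft t A x) + K.
    rewrite /= -RintegralD//; last exact: (ft_cintegrable t x nA).1.
  by rewrite addrK.
apply: measurable_funB => //.
apply: (measurableT_comp (fine_measurable measurableT)).
apply: (@measurable_fun_fubini_tonelli_F _ _ _ _ _ mu (EFin \o G)).
  exact/measurable_EFinP.
by move=> z; rewrite lee_fin.
Qed.

Lemma ft_cmeasurable t A : nice A -> cmeasurable (ft t A).
Proof.
move=> nA; split; first exact: Re_ft_measurable.
have ImE (z : R[i]) : Im z = Re (- 'i * z) by rewrite !cE /=; ring.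
apply: (eq_measurable_fun (fun x => Re (ft t (fun xi => - 'i * A xi) x))).
  by move=> x _; rewrite ftZ// -ImE.
by apply: Re_ft_measurable; exact: cniceZ.
Qed.

Lemma bessel_cmeasurable s f : wave f -> cmeasurable (bessel s f).
Proof.
move=> wf; rewrite (_ : bessel s f = modulated_bessel s 1 0 f); last first.
  by apply/funext => x; rewrite besselE.
apply: cmeasurableM; first exact: cmeasurable_cst.
by apply: ft_cmeasurable; apply: nice_symbol => //; exact: wave_nice_fourier.
Qed.

Section Lp.
Variable p : R.
Hypothesis p1 : 1 < p.

Let p0 : 0 < p. Proof. exact: lt_trans p1. Qed.

Lemma LnormE (F : 'rV[R]_n -> R) : (forall x, 0 <= F x) ->
  Lnorm mu p%:E (EFin \o F) = ((\int[mu]_x (F x `^ p)%:E) `^ p^-1)%E.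
Proof.
move=> F0; rewrite unlock; congr (_ `^ _)%E; apply: eq_integral => x _.
by rewrite /= ger0_norm.
Qed.

Lemma measurable_powRp (F : 'rV[R]_n -> R) : measurable_fun setT F ->
  measurable_fun setT (fun x => (F x `^ p)%:E).
Proof.
move=> mF; apply/measurable_EFinP.
exact: (@measurableT_comp _ _ _ _ _ _ (fun t => powR t p) _ _ (@measurable_powR R p)).
Qed.

Lemma le_poweR_pV (a b : \bar R) : (0 <= a -> a <= b -> a `^ p^-1 <= b `^ p^-1)%E.
Proof.
move=> a0 ab; apply: gt0_ler_poweR => //.
- by rewrite invr_ge0 ltW.
- by rewrite in_itv/= a0 leey.
- by rewrite in_itv/= (le_trans a0 ab) leey.
Qed.

Lemma le_Lnorm (F G : 'rV[R]_n -> R) : measurable_fun setT F ->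
  measurable_fun setT G -> (forall x, 0 <= F x <= G x) ->
  (Lnorm mu p%:E (EFin \o F) <= Lnorm mu p%:E (EFin \o G))%E.
Proof.
move=> mF mG FG; have F0 x : 0 <= F x by have /andP[] := FG x.
have G0 x : 0 <= G x by have /andP[h /(le_trans h)] := FG x.
rewrite !LnormE//; apply: le_poweR_pV.
  by apply: integral_ge0 => x _; rewrite lee_fin powR_ge0.
apply: ge0_le_integral => //.
- by move=> x _; rewrite lee_fin powR_ge0.
- exact: measurable_powRp.
- exact: measurable_powRp.
- move=> x _; have /andP[_ h] := FG x.
  by rewrite lee_fin ge0_ler_powR ?(ltW p0)// nnegrE.
Qed.

Lemma cLnorm_ge0 f : (0 <= cLnorm p f)%E.
Proof. exact: Lnorm_ge0. Qed.

Lemma cLnorm_le_add f g h : cmeasurable f -> cmeasurable g -> cmeasurable h ->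
  (forall x, normc (f x) <= normc (g x) + normc (h x)) ->
  (cLnorm p f <= cLnorm p g + cLnorm p h)%E.
Proof.
move=> /measurable_normc mf /measurable_normc mg /measurable_normc mh fgh.
apply: le_trans (minkowski_EFin mu mg mh (ltW p1)).
apply: le_Lnorm => //; first exact: measurable_funD.
by move=> x; rewrite normc_ge0 /= fgh.
Qed.

Lemma cLnormZ (a : R[i]) f : cmeasurable f ->
  cLnorm p (fun x => a * f x) = ((normc a)%:E * cLnorm p f)%E.
Proof.
move=> /measurable_normc mf; rewrite /cLnorm.
rewrite (LnormE (F := fun x => normc (a * f x))); last by move=> x; exact: normc_ge0.
rewrite (LnormE (F := fun x => normc (f x))); last by move=> x; exact: normc_ge0.
under eq_integral do rewrite ComplexField.Normc.normcM powRM ?normc_ge0// EFinM.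
rewrite ge0_integralZl//; last 3 first.
- exact: measurable_powRp.
- by move=> x _; rewrite lee_fin powR_ge0.
- by rewrite lee_fin powR_ge0.
rewrite poweRM; last 2 first.
- by rewrite lee_fin powR_ge0.
- by apply: integral_ge0 => x _; rewrite lee_fin powR_ge0.
congr (_ * _)%E; rewrite poweR_EFin -powRrM mulfV ?gt_eqF// powRr1//.
exact: normc_ge0.
Qed.

(** An upper bound for the L^p norm of [decay], because [decay] is at most 1 and
so decay^p <= decay. *)
Definition decay_norm : \bar R := ((\int[mu]_x (decay x)%:E) `^ p^-1)%E.

Lemma decay_norm_fin : decay_norm \is a fin_num.
Proof.
apply: fin_num_poweR; rewrite ge0_fin_numE ?integral_decay_lty//.
by apply: integral_ge0 => x _; rewrite lee_fin decay_ge0.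
Qed.

Lemma cLnorm_decay_le f C : 0 <= C -> cmeasurable f ->
  (forall x, normc (f x) <= C * decay x) ->
  (cLnorm p f <= (C * fine decay_norm)%:E)%E.
Proof.
move=> C0 /measurable_normc mf fC.
rewrite EFinM fineK ?decay_norm_fin// /cLnorm.
have md := @measurable_decay R n.
apply: (@le_trans _ _ (Lnorm mu p%:E (EFin \o (fun x : 'rV[R]_n => C * decay x)))).
  apply: le_Lnorm => // [|x]; last by rewrite normc_ge0 fC.
  exact: measurable_funM.
rewrite LnormE; last by move=> x; rewrite mulr_ge0 ?decay_ge0.
rewrite (_ : C%:E = (C `^ p)%:E `^ p^-1)%E; last first.
  by rewrite poweR_EFin -powRrM mulfV ?gt_eqF// powRr1.
rewrite -poweRM; last 2 first.
- by rewrite lee_fin powR_ge0.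
- by apply: integral_ge0 => x _; rewrite lee_fin decay_ge0.
apply: le_poweR_pV.
  by apply: integral_ge0 => x _; rewrite lee_fin powR_ge0.
rewrite -ge0_integralZl//; last 3 first.
- exact/measurable_EFinP.
- by move=> x _; rewrite lee_fin decay_ge0.
- by rewrite lee_fin powR_ge0.
apply: ge0_le_integral => //.
- by move=> x _; rewrite lee_fin powR_ge0.
- by apply: measurable_powRp; exact: measurable_funM.
- by apply/measurable_EFinP; exact: measurable_funM.
move=> x _; rewrite -EFinM lee_fin powRM ?decay_ge0// ler_wpM2l ?powR_ge0//.
by apply: ge1r_powR; rewrite ?(ltW p1)// decay_gt0 decay_le1.
Qed.

Definition unit_box : set 'rV[R]_n :=
  [set x | forall i, [set` `[- 2^-1, 2^-1]] (x ord0 i)].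

Lemma unit_box_measure : mu unit_box = 1%E.
Proof.
rewrite (lebesgue_rv_box (A := fun=> [set` `[- 2^-1, 2^-1]])); last first.
  by move=> _; exact: measurable_itv.
rewrite lebesgue_measure_itv/= lte_fin ifT; last by lra.
rewrite -EFinD (_ : 2^-1 - - 2^-1 = 1 :> R); last by lra.
by rewrite big1.
Qed.

Lemma measurable_box (A : 'I_n -> set R) :
  (forall i, measurable (A i : set (measurableTypeR R))) ->
  measurable [set x : 'rV[R]_n | forall i, A i (x ord0 i)].
Proof.
move=> mA; rewrite (_ : mkset _ = \bigcap_(i in [set: 'I_n])
    (rv_coord i @^-1` A i)); last first.
  by apply/seteqP; split => [x Ax i _|x Ax i]; [exact: Ax|exact: (Ax i)].
apply: fin_bigcap_measurable; first exact: finite_finset.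
by move=> i _; rewrite -[X in measurable X]setTI; exact: measurable_rv_coord.
Qed.

(** The box has measure 1, whence the absence of a constant in front of [c]. *)
Lemma cLnorm_ge_box f c : 0 <= c -> cmeasurable f ->
  (forall x, unit_box x -> c <= normc (f x)) -> (c%:E <= cLnorm p f)%E.
Proof.
move=> c0 /measurable_normc mf fc.
rewrite /cLnorm (LnormE (F := fun x => normc (f x))); last by move=> x; exact: normc_ge0.
rewrite (_ : c%:E = (c `^ p)%:E `^ p^-1)%E; last first.
  by rewrite poweR_EFin -powRrM mulfV ?gt_eqF// powRr1.
apply: le_poweR_pV; first by rewrite lee_fin powR_ge0.
have mB : measurable unit_box.
  by apply: (measurable_box (A := fun=> [set` `[- 2^-1, 2^-1]])) => _; exact: measurable_itv.
apply: (@le_trans _ _ (\int[mu]_(x in unit_box) (normc (f x) `^ p)%:E)%E); last first.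
  apply: ge0_subset_integral => //; first exact: measurable_powRp.
  by move=> x _; rewrite lee_fin powR_ge0.
rewrite -[X in (X <= _)%E]mule1 -unit_box_measure -integral_cst//.
apply: ge0_le_integral => //.
- by move=> x _; rewrite lee_fin powR_ge0.
- by apply: measurable_funTS; exact: measurable_powRp.
- move=> x Bx; rewrite lee_fin ge0_ler_powR ?(ltW p0)// ?nnegrE ?normc_ge0//.
  exact: fc.
Qed.

End Lp.
End norms.

(** * Bessel potentials at high frequency *)
Section semiclassical.
Variables (R : realType) (n : nat).
Local Notation mu := (lebesgue_rv R n).
Local Notation normc := ComplexField.Normc.normc.
Implicit Types (f : 'rV[R]_n -> R[i]) (x e : 'rV[R]_n).

Definition freq (N : nat) : R := N.+1%:R.

Lemma freq_ge1 N : 1 <= freq N. Proof. by rewrite /freq ler1n. Qed.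

Lemma freq_gt0 N : 0 < freq N. Proof. by rewrite /freq ltr0n. Qed.

Lemma freqV_cvg0 : (freq N)^-1 @[N --> \oo] --> (0 : R).
Proof. exact: cvg_harmonic. Qed.

Variables (s : R) (e : 'rV[R]_n).
Hypothesis e1 : dotp e e = 1.

(** The normalisation for which the symbol recentred at a point of norm [t]
tends to 1 as [t] grows. *)
Definition scale (t : R) : R := (t ^+ 2)^-1.

Lemma scale_gt0 t : t != 0 -> 0 < scale t.
Proof. by move=> t0; rewrite invr_gt0 lt_neqAle eq_sym sqrf_eq0 t0 sqr_ge0. Qed.

Lemma scale_bounds (t : R) : 1 <= t ^+ 2 ->
  [/\ 0 < scale t, scale t * (1 + dotp (t *: e) (t *: e)) <= 2 &
    1 <= 2 * (scale t * (1 + dotp (t *: e) (t *: e)))].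
Proof.
move=> t1; have t0 : 0 < t ^+ 2 by apply: lt_le_trans t1.
rewrite dotpZl dotpZr e1 mulr1 -expr2 /scale.
have h : (t ^+ 2)^-1 <= 1 by rewrite invf_le1.
have h0 : 0 < (t ^+ 2)^-1 by rewrite invr_gt0.
by rewrite mulrDr mulr1 mulVf ?gt_eqF//; split => //; lra.
Qed.

Lemma freq_sqr_ge1 N : 1 <= (freq N) ^+ 2.
Proof. by rewrite expr_ge1 ?freq_ge1// ltW// freq_gt0. Qed.

Lemma symbol_cvg x : symbol s (scale (freq N)) (freq N *: e) x @[N --> \oo] --> (1 : R).
Proof.
pose b N := scale (freq N) * (1 + dotp (x + freq N *: e) (x + freq N *: e)).
have bE : b = fun N => (freq N)^-1 * (freq N)^-1 * (1 + dotp x x) +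
    (freq N)^-1 * (2 * dotp x e) + 1.
  apply/funext => N; rewrite /b /scale !(dotpDl, dotpDr, dotpZl, dotpZr) e1 (dotpC e x).
  by have := freq_gt0 N; move: (freq N) => t t0; field; rewrite gt_eqF.
have b1 : b N @[N --> \oo] --> (1 : R).
  rewrite bE -[X in _ --> X]add0r; apply: cvgD; last exact: cvg_cst.
  rewrite -[X in _ --> X]add0r; apply: cvgD.
    rewrite -(mul0r (1 + dotp x x)) -{1}(mul0r 0).
    by apply: cvgM; [apply: cvgM; exact: freqV_cvg0|exact: cvg_cst].
  rewrite -(mul0r (2 * dotp x e)).
  by apply: cvgM; [exact: freqV_cvg0|exact: cvg_cst].
rewrite (_ : 1 = 1 `^ (s / 2)); last by rewrite powR1.
have c1 : {for (1 : R), continuous (fun t => t `^ (s / 2))}.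
  apply/differentiable_continuous/derivable1_diffP.
  exact: (@ex_derive _ _ _ _ _ _ _ (is_derive1_powR (s / 2) (@ltr01 R))).
exact: (cvg_comp _ _ b1 c1).
Qed.

(** By inversion the difference is the inverse transform of (symbol - 1) times
the transform of f. It is bounded uniformly in x by the L^1 norm of that
product, which tends to 0 by dominated convergence: the symbols converge
pointwise to 1 and form one slow family. *)
Lemma modulated_bessel_cvg f : wave f -> forall eps, 0 < eps ->
  \forall N \near \oo, forall x,
    normc (modulated_bessel s (scale (freq N)) (freq N *: e) f x - f x) <= eps.
Proof.
move=> wf eps eps0; have nf := wave_nice_fourier wf.
pose A N xi := (symbol s (scale (freq N)) (freq N *: e) xi - 1)%:C * ft (-1) f xi.
have nA : cnice A.
  apply: cniceM; last exact: nice_cst.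
  apply: cslow_real; apply: slowD; last exact: slow_const.
  apply: (@slow_weight _ _ _ _ 2) => N.
  - by have [] := scale_bounds (freq_sqr_ge1 N).
  - by have [] := scale_bounds (freq_sqr_ge1 N).
  - by have [] := scale_bounds (freq_sqr_ge1 N).
have [C [C0 AC]] := cnice_decay nA.
have mA N : measurable_fun setT (fun xi => normc (A N xi)).
  by apply: measurable_normc; exact/nice_cmeasurable/(cnice_nice N nA).
have iC : mu.-integrable setT (EFin \o (fun xi : 'rV[R]_n => C * decay xi)).
  exact: (@integrableZl _ _ _ _ _ _ _ _ (integrable_decay R n)).
have iA N : mu.-integrable setT (EFin \o (fun xi => normc (A N xi))).
  apply: (integrable_le_decay (C := C) (mA N)) => xi.
  by rewrite ger0_norm ?normc_ge0 ?AC.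
have A_cvg xi : (normc (A N xi))%:E @[N --> \oo] --> (0%:E : \bar R).
  apply/cvg_EFin; first exact: nearW.
  rewrite (_ : _ \o _ = fun N => `|symbol s (scale (freq N)) (freq N *: e) xi - 1| *
      normc (ft (-1) f xi)); last first.
    apply/funext => N; rewrite -[LHS]/(normc (A N xi)).
    by rewrite ComplexField.Normc.normcM normcR.
  rewrite -(mul0r (normc (ft (-1) f xi))); apply: cvgM; last exact: cvg_cst.
  rewrite -(@normr0 _ R); apply: cvg_norm.
  rewrite -(subrr 1); apply: cvgB; last exact: cvg_cst.
  exact: symbol_cvg.
have A_dom xi N : (`|(normc (A N xi))%:E| <= (EFin \o (fun xi => (C * decay xi)%R)) xi)%E.
  by rewrite abse_EFin ger0_norm ?normc_ge0//= lee_fin AC.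
have A0 : \int[mu]_xi normc (A N xi) @[N --> \oo] --> (0 : R).
  have [_ _] := @dominated_convergence _ _ _ mu setT measurableT
    (fun N xi => (normc (A N xi))%:E) (fun=> 0%E) (EFin \o (fun xi : 'rV[R]_n => C * decay xi))
    (fun N => (measurable_EFinP _ _).2 (mA N)) (measurable_cst _)
    (aeW _ (fun xi _ => A_cvg xi)) iC
    (aeW _ (fun xi N _ => A_dom xi N)).
  by rewrite integral0 => h; apply: fine_cvg.
have K0 : 0 <= normc (fourier_cst R n) by exact: normc_ge0.
set K := normc _ in K0.
have e0 : 0 < eps / (2 * K + 1) by rewrite divr_gt0//; lra.
near=> N => x.
have h : \int[mu]_xi normc (A N xi) < eps / (2 * K + 1).
  by near: N; exact: (cvgr_lt _ A0).
have -> : modulated_bessel s (scale (freq N)) (freq N *: e) f x - f x =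
    fourier_cst R n * ft 1 (A N) x.
  have e2 : ft 1 (A N) x = ft 1 (fun xi => (symbol s (scale (freq N)) (freq N *: e) xi)%:C *
      ft (-1) f xi) x - ft 1 (ft (-1) f) x.
    apply/eqP; rewrite eq_sym subr_eq -ftD//; last exact: (cnice_nice N nA).
    apply/eqP; apply: eq_ft => xi.
    by rewrite /A real_complexD mulrDl real_complexN mulN1r subrK.
  by rewrite e2 mulrBr wave_inversion// fourier_cstK.
rewrite ComplexField.Normc.normcM -/K.
apply: (@le_trans _ _ (K * (2 * (eps / (2 * K + 1))))).
  rewrite ler_wpM2l//; apply: le_trans (normc_cintegral_le _ (iA N) _) _.
  - exact: (ft_cintegrable 1 x (cnice_nice N nA)).
  - by move=> xi; rewrite ComplexField.Normc.normcM normc_cis mul1r.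
  - by rewrite ler_pM2l// ltW.
rewrite (_ : K * _ = (2 * K * eps) / (2 * K + 1)); last by ring.
by rewrite ler_pdivrMr; [nra|lra].
Unshelve. all: by end_near. Qed.

End semiclassical.

(** * Mean oscillation *)
Section oscillation.
Variables (R : realType) (n : nat).
Local Notation mu := (lebesgue_rv R n).
Implicit Types (v w : 'rV[R]_n -> R) (x y a : 'rV[R]_n).

Definition bounded_mfun v := measurable_fun setT v /\ exists B, forall x, `|v x| <= B.

(** A bound for the mean oscillation in which the average over the cube is
replaced by an arbitrary constant. Sums and multiples of [v] are then immediate
to treat, at the price of a factor 2 in [le_bmo_norm]. *)
Definition osc v (D : R) := bounded_mfun v /\ forall a (l : R), 0 < l ->
  exists c, \int[mu]_(x in cube a l) `|v x - c| <= D * l ^+ n.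

Lemma cubeE a (l : R) :
  cube a l = [set x | forall i, [set` `[a ord0 i, a ord0 i + l]] (x ord0 i)].
Proof. by apply/seteqP; split => x /= h i; have := h i; rewrite in_itv. Qed.

Lemma cube_measure a (l : R) : 0 < l -> mu (cube a l) = (l ^+ n)%:E.
Proof.
move=> l0; rewrite cubeE.
rewrite (lebesgue_rv_box (A := fun i => [set` `[a ord0 i, a ord0 i + l]])); last first.
  by move=> i; exact: measurable_itv.
under eq_bigr => i _ do rewrite lebesgue_measure_itv/= lte_fin ltrDl l0 -EFinD addrAC subrr add0r.
by rewrite prodEFin prodr_const card_ord.
Qed.

Lemma measurable_cube a (l : R) : measurable (cube a l : set 'rV[R]_n).
Proof.
rewrite cubeE; apply: (measurable_box (A := fun i => [set` `[a ord0 i, a ord0 i + l]])).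
by move=> i; exact: measurable_itv.
Qed.

Lemma Rintegral_cube_cst a (l t : R) : 0 < l ->
  \int[mu]_(x in cube a l) t = t * l ^+ n.
Proof.
move=> l0; rewrite Rintegral_cst; last exact: measurable_cube.
exact: (congr1 (fun z => t * fine z) (cube_measure a l0)).
Qed.

Lemma bounded_eq v w : bounded_mfun v -> v =1 w -> bounded_mfun w.
Proof. by move=> bv /funext <-. Qed.

Lemma boundedD v w : bounded_mfun v -> bounded_mfun w -> bounded_mfun (fun x => v x + w x).
Proof.
move=> [mv [B vB]] [mw [C wC]]; split; first exact: measurable_funD.
by exists (B + C) => x; rewrite (le_trans (ler_normD _ _))// lerD.
Qed.

Lemma boundedZ (t : R) v : bounded_mfun v -> bounded_mfun (fun x => t * v x).
Proof.
move=> [mv [B vB]]; split; first exact: measurable_funM.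
by exists (`|t| * B) => x; rewrite normrM ler_wpM2l.
Qed.

Lemma bounded_cst (c : R) : bounded_mfun (fun=> c).
Proof. by split; [exact: measurable_cst|exists `|c|]. Qed.

Lemma bounded_normB v (c : R) : bounded_mfun v -> bounded_mfun (fun x => `|v x - c|).
Proof.
move=> bv; have [m [B vB]] := boundedD bv (bounded_cst (- c)).
split; first exact: (measurableT_comp (@normr_measurable _ _) m).
by exists B => x; rewrite normr_id.
Qed.

Lemma bounded_integrable v a (l : R) : 0 < l -> bounded_mfun v ->
  mu.-integrable (cube a l) (EFin \o v).
Proof.
move=> l0 [mv [B vB]]; apply: measurable_bounded_integrable.
- exact: measurable_cube.
- by rewrite [X in (X < _)%E](cube_measure a l0) ltry.
- exact: measurable_funTS.
- by exists B; split; rewrite ?num_real// => M BM x _; exact: (le_trans (vB x) (ltW BM)).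
Qed.

(** The average of [v] over a cube differs from [c] by at most the mean
oscillation about [c]. *)
Lemma le_bmo_norm v D : osc v D -> (bmo_norm v <= (2 * D)%:E)%E.
Proof.
move=> [bv oD]; apply: ge_ereal_sup => _ [_ [a [l [l0 ->]]] <-].
have [c hc] := oD a l l0.
rewrite cube_measure//=; set Q := cube a l.
have ln0 : 0 < l ^+ n by exact: exprn_gt0.
have mQ : measurable Q by exact: measurable_cube.
have iv u : bounded_mfun u -> mu.-integrable Q (EFin \o u) by exact: bounded_integrable.
have cQ (t : R) : \int[mu]_(x in Q) t = t * l ^+ n.
  exact: Rintegral_cube_cst.
set A := average Q v.
have bA := bounded_normB A bv; have bc := bounded_normB c bv.
rewrite (_ : (\int[mu]_(y in Q) (`|v y - A|)%:E)%E = (\int[mu]_(y in Q) `|v y - A|)%:E); last first.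
  by rewrite /Rintegral fineK//; apply: integrable_fin_num => //; exact: iv.
rewrite -EFinM lee_fin mulrC ler_pdivrMr//.
have h1 : `|c - A| * l ^+ n <= D * l ^+ n.
  rewrite -{1}(gtr0_norm ln0) -normrM mulrBl.
  have -> : A * l ^+ n = \int[mu]_(y in Q) v y.
    by rewrite /A /average cube_measure//= mulrC mulVKf// gt_eqF.
  rewrite -[c * _](cQ c) -RintegralB//; [|exact/iv/bounded_cst|exact: iv].
  apply: le_trans hc; apply: le_trans (le_normr_Rintegral _ _) _ => //.
    apply: (iv (fun x => c - v x)).
    by apply: (bounded_eq (boundedD (bounded_cst c) (boundedZ (-1) bv))) => x; rewrite mulN1r.
  apply: le_Rintegral => //.
  - by apply: (iv (fun x => `|c - v x|)); apply: (bounded_eq bc) => x; rewrite distrC.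
  - exact: (iv (fun x => `|v x - c|)).
  - by move=> x _; rewrite distrC.
apply: (@le_trans _ _ (\int[mu]_(y in Q) (`|v y - c| + `|c - A|))).
  apply: le_Rintegral => //.
  - exact: (iv (fun x => `|v x - A|)).
  - by apply: (iv (fun x => `|v x - c| + `|c - A|)); apply: boundedD => //; exact: bounded_cst.
  - by move=> x _; rewrite (le_trans _ (ler_normD _ _))// addrA subrK.
rewrite RintegralD//; last 2 first.
- exact: (iv (fun x => `|v x - c|)).
- by apply: (iv (fun=> `|c - A|)); exact: bounded_cst.
rewrite cQ; lra.
Qed.

Lemma oscD v w C D : osc v C -> osc w D -> osc (fun x => v x + w x) (C + D).
Proof.
move=> [bv vC] [bw wD]; split=> [|a l l0]; first exact: boundedD.
have [c hc] := vC a l l0; have [d hd] := wD a l l0; exists (c + d).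
have mQ := measurable_cube a l.
have bc := bounded_normB c bv; have bd := bounded_normB d bw.
have bcd := bounded_normB (c + d) (boundedD bv bw).
have iv u : bounded_mfun u -> mu.-integrable (cube a l) (EFin \o u) by exact: bounded_integrable.
apply: (@le_trans _ _ (\int[mu]_(x in cube a l) (`|v x - c| + `|w x - d|))).
  apply: le_Rintegral => //.
  - exact: (iv (fun x => `|v x + w x - (c + d)|)).
  - by apply: (iv (fun x => `|v x - c| + `|w x - d|)); exact: boundedD.
  - by move=> x _; rewrite opprD addrACA ler_normD.
rewrite RintegralD// ?mulrDl ?lerD//.
- exact: (iv (fun x => `|v x - c|)).
- exact: (iv (fun x => `|w x - d|)).
Qed.

Lemma oscZ (t : R) v D : osc v D -> osc (fun x => t * v x) (`|t| * D).
Proof.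
move=> [bv vD]; split=> [|a l l0]; first exact: boundedZ.
have [c hc] := vD a l l0; exists (t * c).
under eq_Rintegral do rewrite -mulrBr normrM.
rewrite RintegralZl//.
- by rewrite -mulrA ler_wpM2l.
- exact: measurable_cube.
- exact: (bounded_integrable a l0 (bounded_normB c bv)).
Qed.

Lemma osc_le v C D : C <= D -> osc v C -> osc v D.
Proof.
move=> CD [bv vC]; split=> // a l l0; have [c hc] := vC a l l0; exists c.
by rewrite (le_trans hc)// ler_wpM2r// exprn_ge0// ltW.
Qed.

Lemma osc_bounded v B : measurable_fun setT v -> (forall x, `|v x| <= B) -> osc v B.
Proof.
move=> mv vB; have bv : bounded_mfun v by split => //; exists B.
split => // a l l0; exists 0.
have mQ := measurable_cube a l.
apply: (@le_trans _ _ (\int[mu]_(x in cube a l) B)).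
  apply: le_Rintegral => //.
  - exact: (bounded_integrable a l0 (bounded_normB 0 bv)).
  - exact: (bounded_integrable a l0 (bounded_cst B)).
  - by move=> x _; rewrite subr0.
by rewrite Rintegral_cube_cst.
Qed.

(** * Lacunary superpositions of dilates *)
(** On a cube of side l, the dilate at scale 4^m oscillates by at most a constant
times [hat (q / 2 ^ m)], where q is the square root of l. *)
Definition hat (r : R) := Num.min r r^-1.

(** Removing the term m = 0 replaces q by q/2. The bound 4 - 2/q is chosen so
that this step closes: hat q + (4 - 4/q) <= 4 - 2/q once q >= 2. *)
Lemma hat_sum (K : nat) (q : R) : 0 < q ->
  (q <= 1 -> \sum_(m < K) hat (q / 2 ^+ m) <= 2 * q) /\
  (1 <= q -> \sum_(m < K) hat (q / 2 ^+ m) <= 4 - 2 / q).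
Proof.
elim: K q => [|K IH] q q0.
  rewrite !big_ord0; split => q1; first by lra.
  have : q^-1 <= 1 by rewrite invf_le1.
  by lra.
have q20 : 0 < q / 2 by rewrite divr_gt0.
have [IH1 IH2] := IH (q / 2) q20.
rewrite big_ord_recl expr0 divr1.
under eq_bigr => m _.
  rewrite lift0 exprS invfM mulrA.
  over.
split => q1.
  have h1 : hat q <= q by rewrite /hat ge_min lexx.
  have h2 := IH1 ltac:(lra).
  apply: le_trans (lerD h1 h2) _; lra.
have h1 : hat q <= q^-1 by rewrite /hat ge_min lexx orbT.
have qq : q * q^-1 = 1 by rewrite mulfV// gt_eqF.
have qi : 0 < q^-1 by rewrite invr_gt0.
have [q2|q2] := leP (q / 2) 1.
  have h2 := IH1 q2; apply: le_trans (lerD h1 h2) _.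
  nra.
have h2 := IH2 (ltW q2); apply: le_trans (lerD h1 h2) _.
rewrite invf_div; lra.
Qed.

Lemma hat_sum_le4 (K : nat) (q : R) : 0 < q -> \sum_(m < K) hat (q / 2 ^+ m) <= 4.
Proof.
move=> q0; have [h1 h2] := hat_sum K q0.
have [q1|/ltW q1] := leP q 1; first by apply: le_trans (h1 q1) _; lra.
apply: le_trans (h2 q1) _; have : 0 < q^-1 by rewrite invr_gt0.
by lra.
Qed.

Section lacunary.
Variables (g : 'rV[R]_n -> R) (L : R) (k : 'I_n).
Hypothesis mg : measurable_fun setT g.
Hypothesis L0 : 0 <= L.
Hypothesis gL : forall x, `|g x| <= L.
Hypothesis gkL : forall x, `|x ord0 k| * `|g x| <= L.
Hypothesis glip : forall x y (t : R), (forall i, `|x ord0 i - y ord0 i| <= t) ->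
  `|g x - g y| <= L * t.

Lemma measurable_rv_scale (t : R) : measurable_fun setT (fun x : 'rV[R]_n => t *: x).
Proof.
apply: measurable_fun_rvP => i.
rewrite [X in measurable_fun _ X](_ : _ = fun x : 'rV[R]_n => t * x ord0 i); last first.
  by apply/funext => x; rewrite /rv_coord /= mxE.
by apply: measurable_funM => //; exact: measurable_rv_coord.
Qed.

Lemma bounded_scale (t : R) : bounded_mfun (fun x => g (t *: x)).
Proof.
split; first exact: (measurableT_comp mg (measurable_rv_scale t)).
by exists L => x.
Qed.

(** For a cube small compared with the scale [r], the Lipschitz bound shows that
the dilate is nearly constant. *)
Lemma osc_scale_fine (r l : R) a : 0 < r -> 0 < l ->
  \int[mu]_(x in cube a l) `|g (r^-1 *: x) - g (r^-1 *: a)| <= L * (l / r) * l ^+ n.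
Proof.
move=> r0 l0; have mQ := measurable_cube a l.
have -> : L * (l / r) * l ^+ n = \int[mu]_(x in cube a l) (L * (l / r)).
  by rewrite Rintegral_cube_cst.
apply: le_Rintegral => //.
- exact: (bounded_integrable a l0 (bounded_normB _ (bounded_scale _))).
- exact: (bounded_integrable a l0 (bounded_cst _)).
- move=> x /= Qx; apply: glip => i; rewrite !mxE -mulrBr normrM.
  rewrite gtr0_norm ?invr_gt0// mulrC ler_wpM2r ?invr_ge0 ?(ltW r0)//.
  by have /andP[h1 h2] := Qx i; rewrite ger0_norm ?subr_ge0// lerBlDl.
Qed.

(** For a cube large compared with the scale r^2 the dilate is compared with 0.
The slab |x_k| <= r q occupies a proportion at most 2 r / q of the cube, and
there |g| <= L is enough; outside it the decay in x_k gives L r / q. The width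
of the slab is chosen to make the two contributions comparable. *)
Lemma osc_scale_coarse (r q : R) a : 0 < r -> 0 < q ->
  \int[mu]_(x in cube a (q ^+ 2)) `|g ((r ^+ 2)^-1 *: x)| <= 3 * L * (r / q) * (q ^+ 2) ^+ n.
Proof.
move=> r0 q0; set l := q ^+ 2; have l0 : 0 < l by exact: exprn_gt0.
have mQ := measurable_cube a l; set Q := cube a l in mQ *.
pose T : set 'rV[R]_n := [set x | `|x ord0 k| <= r * q].
have mT : measurable T.
  rewrite (_ : T = (fun x => `|x ord0 k|) @^-1` [set` `]-oo, r * q]]); last first.
    by apply/seteqP; split => x /=; rewrite in_itv.
  rewrite -[X in measurable X]setTI.
  have m1 : measurable_fun setT (fun x : 'rV[R]_n => `|x ord0 k|).
    exact: measurable_rv_coord_comp (@normr_measurable _ _).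
  exact: m1.
have mQT : measurable (Q `&` T) by exact: measurableI.
have muQT : (mu (Q `&` T) <= (2 * (r / q) * l ^+ n)%:E)%E.
  pose A i := if i == k then [set` `[- (r * q), r * q]] else [set` `[a ord0 i, a ord0 i + l]].
  have mA i : measurable (A i : set (measurableTypeR R)).
    by rewrite /A; case: ifP => _; exact: measurable_itv.
  apply: (@le_trans _ _ (mu [set x | forall i, A i (x ord0 i)])).
    apply: le_measure; rewrite ?inE//; first exact: (measurable_box mA).
    move=> x [/= Qx Tx] i; rewrite /A; case: ifPn => [/eqP ->|_] /=.
      by rewrite in_itv/= -ler_norml.
    by rewrite in_itv/=; exact: Qx.
  rewrite lebesgue_rv_box// (bigD1 k)//= {1}/A eqxx lebesgue_measure_itv/=.
  have rq : 0 < r * q by exact: mulr_gt0.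
  rewrite lte_fin ifT; last by lra.
  rewrite (eq_bigr (fun=> l%:E)); last first.
    move=> i ik; rewrite /A (negbTE ik) lebesgue_measure_itv/= lte_fin ltrDl l0.
    by rewrite -EFinD addrAC subrr add0r.
  rewrite -EFinD prodEFin -EFinM lee_fin prodr_const.
  have -> : #|(fun i => i != k)| = n.-1.
    by have := cardC1 k; rewrite card_ord.
  have n0 : (0 < n)%N by case: (k) => m; case: (n).
  rewrite -[in leRHS](prednK n0) exprS.
  rewrite (_ : 2 * (r / q) * (l * l ^+ n.-1) = (r * q - - (r * q)) * l ^+ n.-1)//.
  by rewrite /l; field; rewrite gt_eqF.
have hr : 0 <= r / q by rewrite divr_ge0 ?ltW.
have bi : bounded_mfun (fun x => L * \1_T x + L * (r / q)).
  apply: boundedD; last exact: bounded_cst.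
  apply: boundedZ; split; first exact: measurable_indic.
  by exists 1 => x; rewrite indicE; case: (_ \in _); rewrite ?normr1 ?normr0.
have iv u : bounded_mfun u -> mu.-integrable Q (EFin \o u) by exact: bounded_integrable.
apply: (@le_trans _ _ (\int[mu]_(x in Q) (L * \1_T x + L * (r / q)))).
  apply: le_Rintegral => //.
  - apply: (iv (fun x => `|g ((r ^+ 2)^-1 *: x)|)).
    by apply: (bounded_eq (bounded_normB 0 (bounded_scale ((r ^+ 2)^-1)))) => x; rewrite subr0.
  - exact: (iv _ bi).
  - move=> x _; rewrite indicE; have [Tx|Tx] := boolP (x \in T).
      by rewrite mulr1 (le_trans (gL _))// lerDl mulr_ge0.
    rewrite mulr0 add0r.
    have xr : r * q < `|x ord0 k|.
      by rewrite ltNge; apply/negP => h; move: Tx; rewrite notin_setE; apply.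
    have := gkL ((r ^+ 2)^-1 *: x); rewrite mxE normrM.
    rewrite gtr0_norm ?invr_gt0 ?exprn_gt0//; set G := `|g _| => h.
    have G0 : 0 <= G by exact: normr_ge0.
    have h2 : (r ^+ 2)^-1 * (r * q) * G <= L.
      apply: le_trans h; rewrite ler_wpM2r// ler_wpM2l ?invr_ge0 ?exprn_ge0 ?(ltW r0)//.
      exact: ltW.
    have e : (r ^+ 2)^-1 * (r * q) * G = G / (r / q).
      by field; rewrite ?gt_eqF//.
    by move: h2; rewrite e ler_pdivrMr// divr_gt0.
have b1 : bounded_mfun (\1_T : 'rV[R]_n -> R).
  split; first exact: measurable_indic.
  by exists 1 => x; rewrite indicE; case: (_ \in _); rewrite ?normr1 ?normr0.
rewrite RintegralD//; last 2 first.
- exact: (iv (fun x => L * \1_T x) (boundedZ _ b1)).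
- exact: (iv (fun=> L * (r / q)) (bounded_cst _)).
rewrite RintegralZl//; last exact: (iv _ b1).
rewrite Rintegral_cube_cst//=.
have -> : \int[mu]_(x in Q) \1_T x = fine (mu (Q `&` T)).
  by rewrite /Rintegral integral_indic// setIC.
have h3 : fine (mu (Q `&` T)) <= 2 * (r / q) * l ^+ n.
  rewrite -lee_fin fineK//; rewrite ge0_fin_numE//; apply: le_lt_trans muQT _.
  by rewrite ltry.
have := ler_wpM2l L0 h3; lra.
Qed.

(** The oscillation of each summand decays geometrically as its scale moves away
from the side of the cube, so the sum over all scales is bounded independently
of [K], although the function itself is only bounded by [K * L]. *)
Lemma osc_lacunary (K : nat) :
  osc (fun x => \sum_(m < K) g ((4 ^+ m)^-1 *: x)) (12 * L).
Proof.
have bK J : bounded_mfun (fun x => \sum_(m < J) g ((4 ^+ m)^-1 *: x)).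
  elim: J => [|J IH].
    by apply: (bounded_eq (bounded_cst 0)) => x; rewrite big_ord0.
  by apply: (bounded_eq (boundedD IH (bounded_scale (4 ^+ J)^-1))) => x; rewrite big_ord_recr.
split=> [|a l l0]; first exact: bK.
pose q := Num.sqrt l; have q0 : 0 < q by rewrite sqrtr_gt0.
have q2 : q ^+ 2 = l by rewrite sqr_sqrtr// ltW.
suff [c hc] : exists c, \int[mu]_(x in cube a l)
    `|\sum_(m < K) g ((4 ^+ m)^-1 *: x) - c| <=
    3 * L * (\sum_(m < K) hat (q / 2 ^+ m)) * l ^+ n.
  exists c; apply: le_trans hc _; rewrite ler_wpM2r ?exprn_ge0 ?(ltW l0)//.
  by have := ler_wpM2l L0 (hat_sum_le4 K q0); lra.
have step J : exists c, \int[mu]_(x in cube a l) `|g ((4 ^+ J)^-1 *: x) - c| <=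
    3 * L * hat (q / 2 ^+ J) * l ^+ n.
  have p2 : 0 < (2 : R) ^+ J by exact: exprn_gt0.
  have e4 : (4 : R) ^+ J = (2 ^+ J) ^+ 2 by rewrite exprAC; congr (_ ^+ _); ring.
  have [h|h] := leP (q / 2 ^+ J) 1.
    exists (g ((4 ^+ J)^-1 *: a)); apply: le_trans (osc_scale_fine _ _ _) _ => //.
    rewrite ler_wpM2r ?exprn_ge0 ?(ltW l0)// e4 -q2 -expr_div_n.
    have r0 : 0 < q / 2 ^+ J by rewrite divr_gt0.
    have -> : hat (q / 2 ^+ J) = q / 2 ^+ J.
      by apply/min_idPl; rewrite (le_trans h)// invf_ge1.
    move: (q / _) r0 h => r r0 h.
    have h2 : r ^+ 2 <= r by rewrite expr2 ler_piMl// ltW.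
    have := ler_wpM2l L0 h2; have := mulr_ge0 L0 (ltW r0); lra.
  exists 0; under eq_Rintegral do rewrite subr0.
  rewrite e4 -q2; apply: le_trans (osc_scale_coarse _ _ _) _ => //.
  apply: ler_wpM2r; first by rewrite exprn_ge0// sqr_ge0.
  have -> : hat (q / 2 ^+ J) = (q / 2 ^+ J)^-1.
    have r0 : 0 < q / 2 ^+ J by rewrite divr_gt0.
    by apply/min_idPr; apply: le_trans (ltW h); rewrite invf_le1// ltW.
  by rewrite invf_div.
elim: K => [|K [c hc]].
  exists 0; rewrite !big_ord0 mulr0 mul0r.
  under eq_Rintegral do rewrite big_ord0 subr0 normr0.
  by rewrite Rintegral_cst ?mul0r//; exact: measurable_cube.
have [d hd] := step K; exists (c + d).
have mQ := measurable_cube a l.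
have iv u : bounded_mfun u -> mu.-integrable (cube a l) (EFin \o u) by exact: bounded_integrable.
have b1 := bounded_normB c (bK K).
have b2 := bounded_normB d (bounded_scale (4 ^+ K)^-1).
have b3 := bounded_normB (c + d) (bK K.+1).
rewrite big_ord_recr mulrDr mulrDl.
apply: (@le_trans _ _ (\int[mu]_(x in cube a l)
   (`|\sum_(m < K) g ((4 ^+ m)^-1 *: x) - c| + `|g ((4 ^+ K)^-1 *: x) - d|))).
  apply: le_Rintegral => //.
  - exact: (iv _ b3).
  - exact: (iv _ (boundedD b1 b2)).
  - by move=> x _; rewrite big_ord_recr opprD addrACA ler_normD.
rewrite RintegralD//; [exact: lerD|exact: (iv _ b1)|exact: (iv _ b2)].
Qed.

End lacunary.

Lemma derive_sum_partial (f : 'rV[R]_n -> R) x (v : 'rV[R]_n) : differentiable f x ->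
  'D_v f x = \sum_k v ord0 k * partial k f x.
Proof.
move=> df; rewrite deriveE// {1}(row_sum_delta v) linear_sum.
by apply: eq_bigr => k _; rewrite linearZ/= /partial deriveE.
Qed.

Lemma lipschitz_partial (f : 'rV[R]_n -> R) (L : R) :
  (forall x, differentiable f x) -> (forall k x, `|partial k f x| <= L) ->
  forall x y (t : R), (forall i, `|x ord0 i - y ord0 i| <= t) ->
  `|f x - f y| <= n%:R * L * t.
Proof.
move=> df fL x y t xy; pose v := x - y; pose F u := f (y + u *: v).
have dF u : is_derive u (1 : R) F ('D_v f (y + u *: v)).
  by apply: is_derive_line; exact: diff_derivable.
have [u _ ] : exists2 u, u \in `[0, 1] & F 1 - F 0 = 'D_v f (y + u *: v) * (1 - 0).
  apply: (@MVT_segment _ F (fun u => 'D_v f (y + u *: v))) => //.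
  by apply: continuous_subspaceT => u; exact/differentiable_continuous/derivable1_diffP.
rewrite /F scale1r scale0r addr0 (addrC y) /v subrK => ->.
rewrite subr0 mulr1 derive_sum_partial// (le_trans (ler_norm_sum _ _ _))//.
rewrite -mulrA -[n in n%:R]card_ord mulr_natl -sumr_const.
apply: ler_sum => k _; rewrite normrM mulrC ler_pM//.
by have := xy k; rewrite !mxE.
Qed.

Lemma osc_lacunary_snice (F : unit -> 'rV[R]_n -> R) : (0 < n)%N -> snice F ->
  exists L : R, 0 <= L /\ forall K,
    osc (fun x => \sum_(m < K) F tt ((4 ^+ m)^-1 *: x)) L.
Proof.
move=> n0 nF; pose k := Ordinal n0.
have [C [C0 FC]] := snice_decay nF.
have [D [D0 FD]] := snice_decay (sniceM (@slow_coord R n unit k) nF).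
have h (j : 'I_n) : exists B, 0 <= B /\ forall x, `|partial j (F tt) x| <= B.
  have [B [B0 FB]] := snice_decay (snice_partial j nF); exists B; split => // x.
  by rewrite (le_trans (FB tt x))// ler_piMr// decay_le1.
have [B hB] := choice h.
pose E := \sum_j B j.
have E0 : 0 <= E by apply: sumr_ge0 => j _; have [] := hB j.
pose L := C + D + n%:R * E.
have nE : 0 <= n%:R * E by rewrite mulr_ge0.
have L0 : 0 <= L by rewrite !addr_ge0.
exists (12 * L); split; first by rewrite mulr_ge0.
move=> K; apply: (@osc_lacunary _ L k) => //.
- exact: snice_measurable.
- move=> x; rewrite (le_trans (FC tt x))// (@le_trans _ _ C)//.
    by rewrite ler_piMr// decay_le1.
  by rewrite /L; lra.
- move=> x; have := FD tt x; rewrite normrM => hx; rewrite (le_trans hx)//.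
  rewrite (@le_trans _ _ D)//; first by rewrite ler_piMr// decay_le1.
  by rewrite /L; lra.
- move=> x y t xy.
  have t0 : 0 <= t by apply: le_trans (xy k).
  rewrite (@le_trans _ _ (n%:R * E * t))//.
    apply: lipschitz_partial => // [z|j z]; first exact: snice_differentiable.
    have [_ hj] := hB j; rewrite (le_trans (hj z))// /E (bigD1 j)//= lerDl.
    by apply: sumr_ge0 => i _; have [] := hB i.
  by rewrite ler_wpM2r// /L; lra.
Qed.

End oscillation.

(** * The commutator as a bilinear form *)

Section bilinear_commutator.
Variables (R : realType) (n : nat) (s : R).
Implicit Types (f g : 'rV[R]_n -> R[i]) (U V : 'I_n -> 'rV[R]_n -> R[i]).

Definition waves U := forall l, wave (U l).

Definition transport U f x := \sum_l U l x * cpartial l f x.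

(** U . grad (J^s f) with the derivative moved inside J^s, where it acts on a
wave. *)
Definition smooth_transport U f x := \sum_l U l x * bessel s (cpartial l f) x.

Definition comm U f x := bessel s (transport U f) x - smooth_transport U f x.

Lemma wave_transport U f : waves U -> wave f -> wave (transport U f).
Proof. by move=> wU wf; apply: wave_sum => l; apply: waveM => //; exact: wave_cpartial. Qed.

Lemma bessel_eq f g x : f =1 g -> bessel s f x = bessel s g x.
Proof. by move=> /funext ->. Qed.

Lemma transport_linl (a : R[i]) U V f x :
  transport (fun l y => a * U l y + V l y) f x = a * transport U f x + transport V f x.
Proof.
by rewrite /transport mulr_sumr -big_split; apply: eq_bigr => l _; rewrite /= mulrDl mulrA.
Qed.

Lemma cpartial_lin l (a : R[i]) f g x : wave f -> wave g ->
  cpartial l (fun y => a * f y + g y) x = a * cpartial l f x + cpartial l g x.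
Proof.
move=> wf wg; rewrite cpartialD; last exact: wave_cdiff.
  by rewrite cpartialZ//; exact: wave_cdiff.
by apply: cdiffM; [exact: cdiff_cst|exact: wave_cdiff].
Qed.

Lemma transport_linr (a : R[i]) U f g x : wave f -> wave g ->
  transport U (fun y => a * f y + g y) x = a * transport U f x + transport U g x.
Proof.
move=> wf wg; rewrite /transport mulr_sumr -big_split; apply: eq_bigr => l _.
by rewrite /= cpartial_lin// mulrDr mulrCA.
Qed.

Lemma smooth_transport_linl (a : R[i]) U V f x :
  smooth_transport (fun l y => a * U l y + V l y) f x =
  a * smooth_transport U f x + smooth_transport V f x.
Proof.
rewrite /smooth_transport mulr_sumr -big_split; apply: eq_bigr => l _ /=.
by rewrite mulrDl mulrA.
Qed.

Lemma smooth_transport_linr (a : R[i]) U f g x : wave f -> wave g ->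
  smooth_transport U (fun y => a * f y + g y) x =
  a * smooth_transport U f x + smooth_transport U g x.
Proof.
move=> wf wg; rewrite /smooth_transport mulr_sumr -big_split; apply: eq_bigr => l _ /=.
rewrite (bessel_eq _ (fun y => cpartial_lin l a y wf wg)).
by rewrite bessel_lin; [rewrite mulrDr mulrCA|exact: wave_cpartial..].
Qed.

Lemma comm_linl (a : R[i]) U V f x : waves U -> waves V -> wave f ->
  comm (fun l y => a * U l y + V l y) f x = a * comm U f x + comm V f x.
Proof.
move=> wU wV wf.
rewrite /comm (bessel_eq _ (transport_linl a U V f)) smooth_transport_linl.
by rewrite bessel_lin; [rewrite mulrBr opprD addrACA|exact: wave_transport..].
Qed.

Lemma comm_linr (a : R[i]) U f g x : waves U -> wave f -> wave g ->
  comm U (fun y => a * f y + g y) x = a * comm U f x + comm U g x.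
Proof.
move=> wU wf wg.
rewrite /comm (bessel_eq _ (fun y => transport_linr a U y wf wg)).
rewrite smooth_transport_linr//.
by rewrite bessel_lin; [rewrite mulrBr opprD addrACA|exact: wave_transport..].
Qed.

Lemma comm_cmeasurable U f : waves U -> wave f -> cmeasurable (comm U f).
Proof.
move=> wU wf; apply: cmeasurableD; first exact/bessel_cmeasurable/wave_transport.
have ms : cmeasurable (smooth_transport U f).
  apply: cmeasurable_sum => l; apply: cmeasurableM; first exact: wave_cmeasurable.
  exact/bessel_cmeasurable/wave_cpartial.
have := cmeasurableM (cmeasurable_cst n (-1)) ms.
by congr cmeasurable; apply/funext => x; rewrite mulN1r.
Qed.

Lemma commutatorE (u : 'rV[R]_n -> 'rV[R]_n) j : waves (ccomponent u) ->
  commutator s u j =1 comm (ccomponent u) (ccomponent u j).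
Proof.
move=> wu x; rewrite /commutator /comm /advection; congr (_ - _).
by apply: eq_bigr => l _; rewrite cpartial_bessel.
Qed.

(** The symmetric bilinear form attached to the quadratic map
[U |-> comm U (U j)]. *)
Definition polar U V j x := comm U (V j) x + comm V (U j) x.

Lemma polar_cmeasurable U V j : waves U -> waves V -> cmeasurable (polar U V j).
Proof. by move=> wU wV; apply: cmeasurableD; exact: comm_cmeasurable. Qed.

Lemma comm_square (a : R[i]) U V j x : waves U -> waves V ->
  comm (fun l y => a * V l y + U l y) (fun y => a * V j y + U j y) x =
  a ^+ 2 * comm V (V j) x + a * polar U V j x + comm U (U j) x.
Proof.
move=> wU wV.
have wj : wave (fun y => a * V j y + U j y) by exact: wave_lin.
rewrite (comm_linl a x wV wU wj) (comm_linr a x wV (wV j) (wU j)).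
rewrite (comm_linr a x wU (wV j) (wU j)) /polar.
by move: (comm V _ x) (comm V _ x) (comm U _ x) (comm U _ x) => A B C D; ring.
Qed.

Lemma comm_polarization (a : R[i]) U V j x : waves U -> waves V ->
  comm (fun l y => a * V l y + U l y) (fun y => a * V j y + U j y) x -
  comm (fun l y => - a * V l y + U l y) (fun y => - a * V j y + U j y) x =
  2 * a * polar U V j x.
Proof.
move=> wU wV; rewrite (comm_square a j x wU wV) (comm_square (- a) j x wU wV).
by move: (comm V _ x) (comm U _ x) (polar U V j x) => A B C; ring.
Qed.

Lemma polar_lin (a : R[i]) U V W j x : waves U -> waves V -> waves W ->
  polar U (fun l y => a * V l y + W l y) j x = a * polar U V j x + polar U W j x.
Proof.
move=> wU wV wW; rewrite /polar (comm_linr a x wU (wV j) (wW j)).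
rewrite (comm_linl a x wV wW (wU j)).
by move: (comm U _ x) (comm U _ x) (comm V _ x) (comm W _ x) => A B C D; ring.
Qed.

End bilinear_commutator.

Lemma normc_leD (R : realType) (a b : R[i]) :
  ComplexField.Normc.normc (a + b) <=
  ComplexField.Normc.normc a + ComplexField.Normc.normc b.
Proof. exact: le_normcD. Qed.

Lemma normc_opp (R : realType) (a : R[i]) :
  ComplexField.Normc.normc (- a) = ComplexField.Normc.normc a.
Proof. exact: normcN. Qed.

(** * Uniform limits *)
Section uniform_limits.
Variables (R : realType) (n : nat).
Local Notation normc := ComplexField.Normc.normc.
Implicit Types (F G : nat -> 'rV[R]_n -> R[i]).

Definition unif0 F := forall eta : R, 0 < eta ->
  \forall N \near \oo, forall x, normc (F N x) <= eta.

Definition ubd F := exists C : R, 0 <= C /\ forall N x, normc (F N x) <= C.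

Lemma unif0_eq F G : unif0 F -> (forall N x, F N x = G N x) -> unif0 G.
Proof.
move=> uF FG eta eta0; have := uF _ eta0; apply: filterS => N h x.
by rewrite -FG.
Qed.

Lemma unif0D F G : unif0 F -> unif0 G -> unif0 (fun N x => F N x + G N x).
Proof.
move=> uF uG eta eta0; have e2 : 0 < eta / 2 by rewrite divr_gt0.
have := uF _ e2; have := uG _ e2; apply: filterS2 => N hG hF x.
rewrite (le_trans (normc_leD _ _))//.
by have := hF x; have := hG x; lra.
Qed.

Lemma unif0_mul F G : ubd F -> unif0 G -> unif0 (fun N x => F N x * G N x).
Proof.
move=> [C [C0 FC]] uG eta eta0.
have e2 : 0 < eta / (C + 1) by rewrite divr_gt0// ltr_wpDl.
have := uG _ e2; apply: filterS => N hG x.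
rewrite ComplexField.Normc.normcM (@le_trans _ _ (C * (eta / (C + 1))))//.
  by rewrite ler_pM// ?normc_ge0.
by rewrite mulrA ler_pdivrMr; nra.
Qed.

Lemma unif0N F : unif0 F -> unif0 (fun N x => - F N x).
Proof.
move=> uF eta eta0; have := uF _ eta0; apply: filterS => N h x.
by rewrite normc_opp.
Qed.

Lemma unif0_sum (I : Type) (r : seq I) (F : I -> nat -> 'rV[R]_n -> R[i]) :
  (forall l, unif0 (F l)) -> unif0 (fun N x => \sum_(l <- r) F l N x).
Proof.
move=> uF; elim: r => [|l r IH].
  move=> eta eta0; apply: nearW => N x.
  by rewrite big_nil ComplexField.Normc.normc0 ltW.
by apply: (unif0_eq (unif0D (uF l) IH)) => N x; rewrite big_cons.
Qed.

Lemma unif0_scalar (c : nat -> R) : c N @[N --> \oo] --> (0 : R) ->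
  unif0 (fun N _ => (c N)%:C).
Proof.
move=> c0 eta eta0; move/cvgr0_norm_le : c0 => /(_ _ eta0); apply: filterS => N h x.
by rewrite normcR.
Qed.

Lemma unif0_scale (c : nat -> R) F : c N @[N --> \oo] --> (0 : R) -> ubd F ->
  unif0 (fun N x => (c N)%:C * F N x).
Proof.
move=> /unif0_scalar c0 bF.
by apply: (unif0_eq (unif0_mul bF c0)) => N x; rewrite mulrC.
Qed.

Lemma ubd_wave f : wave f -> ubd (fun _ => f).
Proof.
move=> /wave_nice/cnice_decay[C [C0 fC]]; exists C; split => // _ x.
by rewrite (le_trans (fC tt x))// ler_piMr// decay_le1.
Qed.

Lemma ubdD F G : ubd F -> ubd G -> ubd (fun N x => F N x + G N x).
Proof.
move=> [C [C0 FC]] [D [D0 GD]]; exists (C + D); split => [|N x]; first exact: addr_ge0.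
by rewrite (le_trans (normc_leD _ _))// lerD.
Qed.

Lemma ubdM F G : ubd F -> ubd G -> ubd (fun N x => F N x * G N x).
Proof.
move=> [C [C0 FC]] [D [D0 GD]]; exists (C * D); split => [|N x]; first exact: mulr_ge0.
by rewrite ComplexField.Normc.normcM ler_pM// normc_ge0.
Qed.

Lemma ubd_sum (I : Type) (r : seq I) (F : I -> nat -> 'rV[R]_n -> R[i]) :
  (forall l, ubd (F l)) -> ubd (fun N x => \sum_(l <- r) F l N x).
Proof.
move=> uF; elim: r => [|l r [C [C0 IH]]].
  by exists 0; split => // N x; rewrite big_nil ComplexField.Normc.normc0.
have [D [D0 FD]] := uF l; exists (D + C); split=> [|N x]; first exact: addr_ge0.
rewrite big_cons (le_trans (normc_leD _ _))// lerD//.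
Qed.

Lemma freqV_le1 N : 0 <= (freq R N)^-1 <= 1.
Proof. by rewrite invr_ge0 ltW ?freq_gt0//= invf_le1 ?freq_gt0 ?freq_ge1. Qed.

Lemma ubd_freqV : ubd (fun N _ => ((freq R N)^-1)%:C).
Proof.
exists 1; split => // N x; have /andP[h0 h1] := freqV_le1 N.
by rewrite normcR ger0_norm.
Qed.

Lemma freq_powR_cvg0 (t : R) : 0 < t -> (freq R N) `^ (- t) @[N --> \oo] --> (0 : R).
Proof.
move=> t0; apply/cvgrPdist_le => eta eta0.
have e0 : 0 < eta `^ t^-1 by rewrite powR_gt0.
have /cvgr0_norm_le /(_ _ e0) := @freqV_cvg0 R; apply: filterS => N.
have /andP[h0 _] := freqV_le1 N.
rewrite ger0_norm// => h; rewrite sub0r normrN ger0_norm ?powR_ge0//.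
rewrite -mulN1r powRrM powR_inv1 ?(ltW (freq_gt0 _ _))//.
apply: le_trans (_ : (eta `^ t^-1) `^ t <= _).
  by apply: ge0_ler_powR => //; rewrite ?nnegrE ?(ltW t0)// ltW.
by rewrite -powRrM mulVf ?gt_eqF// powRr1// ltW.
Qed.

End uniform_limits.

(** * The commutator at high frequency *)
Section high_frequency.
Variables (R : realType) (n : nat) (s : R) (k0 : 'I_n).
Hypothesis s0 : 0 < s.
Implicit Types (f g : 'rV[R]_n -> R[i]).

Let e : 'rV[R]_n := delta_mx ord0 k0.

Lemma dotp_e : dotp e e = 1.
Proof. by rewrite dotp_deltar /e mxE !eqxx. Qed.

Definition carrier (nu : R) (x : 'rV[R]_n) : R[i] := cis (dotp (nu *: e) x).

(** The amplitude [g] of relative order 1/nu leaves room to make a packet exactly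
divergence free; see [divergence_packet]. *)
Definition packet (nu : R) f g x : R[i] := carrier nu x * (f x + (nu^-1)%:C * g x).

Lemma wave_packet nu f g : wave f -> wave g -> wave (packet nu f g).
Proof.
move=> wf wg; apply: wave_cis; apply: waveD => //; exact: waveZ.
Qed.

Lemma cpartial_packet nu l f g x : nu != 0 -> wave f -> wave g ->
  cpartial l (packet nu f g) x = carrier nu x *
    ((nu%:C * ('i * ((l == k0)%:R)%:C * f x) + ('i * ((l == k0)%:R)%:C * g x + cpartial l f x)) +
     (nu^-1)%:C * cpartial l g x).
Proof.
move=> nu0 wf wg; rewrite /packet cpartialM; last 2 first.
- exact: cdiff_cis.
- by apply: cdiffD; [|apply: cdiffM; first exact: cdiff_cst]; exact: wave_cdiff.
rewrite cpartial_cis cpartialD; last 2 first.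
- exact: wave_cdiff.
- by apply: cdiffM; [exact: cdiff_cst|exact: wave_cdiff].
rewrite cpartialZ; last exact: wave_cdiff.
rewrite -/(carrier nu x) !mxE eqxx /= real_complexM.
have nuK : nu%:C * (nu^-1)%:C = 1 :> R[i] by rewrite -real_complexM mulfV.
set D := ((l == k0)%:R)%:C.
have -> : 'i * D * g x = nu%:C * (nu^-1)%:C * ('i * D * g x) by rewrite nuK mul1r.
move: (carrier nu x) (cpartial l f x) (cpartial l g x) => E F G; ring.
Qed.

Definition modulated N f x := modulated_bessel s (scale (freq R N)) (freq R N *: e) f x.

Lemma modulated_cvg f : wave f -> unif0 (fun N x => modulated N f x - f x).
Proof. by move=> wf eta; exact: modulated_bessel_cvg dotp_e f wf eta. Qed.

Lemma ubd_modulated f : wave f -> ubd (fun N => modulated N f).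
Proof.
move=> wf; have [K [K0 fK]] := @modulated_bessel_decay R n s nat
  (fun N => scale (freq R N)) (fun N => freq R N *: e) 2 f
  (fun N => let: And3 h _ _ := scale_bounds dotp_e (freq_sqr_ge1 R N) in h)
  (fun N => let: And3 _ h _ := scale_bounds dotp_e (freq_sqr_ge1 R N) in h)
  (fun N => let: And3 _ _ h := scale_bounds dotp_e (freq_sqr_ge1 R N) in h) wf.
by exists K; split => // N x; rewrite (le_trans (fK N x))// ler_piMr// decay_le1.
Qed.

Lemma scale_powR (nu : R) : nu != 0 -> scale nu `^ (- (s / 2)) = `|nu| `^ s.
Proof.
move=> nu0; have n0 : 0 < `|nu| by rewrite normr_gt0.
rewrite /scale -(real_normK (num_real nu)) -powR_inv1 ?sqr_ge0// -powRrM.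
by rewrite -powR_mulrn ?ltW// -powRrM; congr (_ `^ _); field.
Qed.

Lemma bessel_packet nu f g x : nu != 0 -> wave f -> wave g ->
  bessel s (packet nu f g) x = (`|nu| `^ s)%:C * (carrier nu x *
    (modulated_bessel s (scale nu) (nu *: e) f x +
     (nu^-1)%:C * modulated_bessel s (scale nu) (nu *: e) g x)).
Proof.
move=> nu0 wf wg.
have sc := scale_gt0 nu0.
rewrite (bessel_cis _ _ _ sc); last by apply: waveD => //; exact: waveZ.
rewrite scale_powR//.
have e1 : (fun y => f y + (nu^-1)%:C * g y) = (fun y => (nu^-1)%:C * g y + f y).
  by apply/funext => y; rewrite addrC.
by rewrite e1 (modulated_bessel_lin s (nu *: e) (nu^-1)%:C x sc wg wf) [X in _ * (_ * X) = _]addrC.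
Qed.

Variables (b h0 h1 : 'I_n -> 'rV[R]_n -> R[i]).
Hypotheses (wb : waves b) (wh0 : waves h0) (wh1 : waves h1).
Hypothesis h00 : forall x, h0 k0 x = 0.

Definition packets N l := packet (freq R N) (h0 l) (h1 l).

(** Component [k0] of the packet has amplitude of order 1/nu because h0 vanishes
there, so its gradient is again a packet, of order 1. As J^s acts on packets as
nu^s up to o(nu^s), the two terms that transport the packet by [b] cancel to
leading order. Of the two terms that transport [b] by the packet, the one where
J^s acts on [b] alone is killed by nu^-s, and the other one gives the limit. *)
Lemma polar_packets_cvg :
  unif0 (fun N x => ((freq R N) `^ (- s))%:C * carrier (- freq R N) x *
      polar s b (packets N) k0 x - \sum_l h0 l x * cpartial l (b k0) x).
Proof.
(* g0 and g1 are the amplitudes of the gradient of component k0. *)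
pose g0 l x := 'i * ((l == k0)%:R)%:C * h1 k0 x : R[i].
pose g1 l := cpartial l (h1 k0).
have wg0 l : wave (g0 l) by exact: waveZ.
have wg1 l : wave (g1 l) by exact: wave_cpartial.
have wdb l : wave (cpartial l (b k0)) by exact: wave_cpartial.
pose S x := \sum_l h0 l x * cpartial l (b k0) x.
pose G0 x := \sum_l b l x * g0 l x + S x.
pose G1 x := \sum_l b l x * g1 l x + \sum_l h1 l x * cpartial l (b k0) x.
have wS : wave S by apply: wave_sum => l; exact: waveM.
have wG0 : wave G0 by apply: waveD => //; apply: wave_sum => l; exact: waveM.
have wG1 : wave G1 by apply: waveD; apply: wave_sum => l; exact: waveM.
have dp N l : cpartial l (packets N k0) = packet (freq R N) (g0 l) (g1 l).
  apply/funext => x; rewrite cpartial_packet//; last by rewrite gt_eqF ?freq_gt0.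
  rewrite h00 (_ : cpartial l (h0 k0) x = 0); last first.
    by rewrite (_ : h0 k0 = fun=> 0) ?cpartial_cst//; apply/funext.
  by rewrite /packet /g0 /g1 !mulr0 add0r addr0.
have fn0 N : freq R N != 0 by rewrite gt_eqF ?freq_gt0.
have wp N : waves (packets N) by move=> l; exact: wave_packet.
(* The difference written exactly, in summands that each tend to 0 uniformly. *)
pose err (N : nat) (x : 'rV[R]_n) := (modulated N G0 x - G0 x) + ((freq R N)^-1)%:C * modulated N G1 x
  - \sum_l b l x * ((modulated N (g0 l) x - g0 l x) + ((freq R N)^-1)%:C * modulated N (g1 l) x)
  - ((freq R N) `^ (- s))%:C *
     \sum_l (h0 l x + ((freq R N)^-1)%:C * h1 l x) * bessel s (cpartial l (b k0)) x.
have ub_bessel f : wave f -> ubd (fun _ : nat => bessel s f).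
  move=> wf; have [K [K0 fK]] := @modulated_bessel_decay R n s unit
    (fun=> 1) (fun=> 0) 1 f (fun=> ltr01)
    (fun=> ltac:(by rewrite dotp0l addr0 mulr1)) (fun=> ltac:(by rewrite dotp0l addr0 !mulr1)) wf.
  by exists K; split => // _ x; rewrite besselE (le_trans (fK tt x))// ler_piMr// decay_le1.
have e1 N x : bessel s (transport b (packets N k0)) x +
    bessel s (transport (packets N) (b k0)) x =
    (freq R N `^ s)%:C * (carrier (freq R N) x *
      (modulated N G0 x + ((freq R N)^-1)%:C * modulated N G1 x)).
  have w1 : wave (transport b (packets N k0)) by exact: (wave_transport wb (wp N k0)).
  have w2 : wave (transport (packets N) (b k0)) by exact: (wave_transport (wp N) (wb k0)).
  have := bessel_packet x (fn0 N) wG0 wG1.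
  rewrite (gtr0_norm (freq_gt0 R N)) => <-.
  have := bessel_lin s 1 x w1 w2; rewrite mul1r => <-.
  apply: bessel_eq => y; rewrite mul1r /transport.
  under eq_bigr do rewrite dp.
  rewrite /packet /packets /packet /G0 /G1 /S.
  move: (carrier (freq R N) y) ((freq R N)^-1)%:C => E c.
  have split2 (u v w : 'I_n -> R[i]) :
      \sum_l u l * (E * (v l + c * w l)) =
      E * \sum_l u l * v l + E * (c * \sum_l u l * w l).
    rewrite !mulr_sumr -big_split; apply: eq_bigr => l _ /=; ring.
  have split3 (u v w : 'I_n -> R[i]) :
      \sum_l E * (v l + c * w l) * u l =
      E * \sum_l v l * u l + E * (c * \sum_l w l * u l).
    rewrite !mulr_sumr -big_split; apply: eq_bigr => l _ /=; ring.
  rewrite (split2 (fun l => b l y) (fun l => g0 l y) (fun l => g1 l y)).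
  rewrite (split3 (fun l => cpartial l (b k0) y) (fun l => h0 l y) (fun l => h1 l y)).
  move: (\sum_l _) (\sum_l _) (\sum_l _) (\sum_l _) => X1 X2 X3 X4; ring.
have e2 N x : smooth_transport s b (packets N k0) x =
    (freq R N `^ s)%:C * (carrier (freq R N) x *
     \sum_l b l x * (modulated N (g0 l) x + ((freq R N)^-1)%:C * modulated N (g1 l) x)).
  rewrite /smooth_transport !mulr_sumr; apply: eq_bigr => l _.
  rewrite dp (bessel_packet x (fn0 N) (wg0 l) (wg1 l)) (gtr0_norm (freq_gt0 R N)).
  by rewrite mulrCA; congr (_ * _); rewrite mulrCA.
have e3 N x : smooth_transport s (packets N) (b k0) x = carrier (freq R N) x *
     \sum_l (h0 l x + ((freq R N)^-1)%:C * h1 l x) * bessel s (cpartial l (b k0)) x.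
  rewrite /smooth_transport mulr_sumr; apply: eq_bigr => l _.
  by rewrite mulrA.
have e5 N x : \sum_l b l x * ((modulated N (g0 l) x - g0 l x) +
      ((freq R N)^-1)%:C * modulated N (g1 l) x) =
    \sum_l b l x * (modulated N (g0 l) x + ((freq R N)^-1)%:C * modulated N (g1 l) x)
    - \sum_l b l x * g0 l x.
  by rewrite -sumrB; apply: eq_bigr => l _; rewrite -mulrBr addrAC.
(* P and Q stand for nu^-s and nu^s, E' and E for the conjugate carriers. *)
have algebra (P Q E E' X Y Z A B C D : R[i]) : P * Q = 1 -> E' * E = 1 ->
    A + C = Q * (E * X) -> B = Q * (E * Y) -> D = E * Z ->
    P * E' * ((A - B) + (C - D)) = X - Y - P * Z.
  move=> PQ EE AC -> ->.
  transitivity (P * E' * ((A + C) - Q * (E * Y) - E * Z)); first by ring.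
  rewrite AC; transitivity (P * Q * (E' * E) * (X - Y) - P * (E' * E) * Z); first by ring.
  by rewrite PQ EE !mul1r mulr1.
apply: (@unif0_eq _ _ err) => [|N x]; last first.
  have PQ : (freq R N `^ (- s))%:C * (freq R N `^ s)%:C = 1 :> R[i].
    by rewrite -real_complexM powRN mulVf// gt_eqF// powR_gt0// freq_gt0.
  have EE : carrier (- freq R N) x * carrier (freq R N) x = 1.
    by rewrite /carrier scaleNr dotpNl cisNK.
  rewrite /err /polar /comm (algebra _ _ _ _ _ _ _ _ _ _ _ PQ EE (e1 N x) (e2 N x) (e3 N x)).
  rewrite e5 /G0 -/(S x).
  move: (S x) (\sum_l b l x * g0 l x) (\sum_l b l x * (_ + _)) (\sum_l _ * _) => Z Y X1 X2.
  move: (modulated N _ x) (modulated N _ x) => X W; ring.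
rewrite /err; apply: unif0D; last first.
  apply: unif0N; apply: unif0_scale; first exact: freq_powR_cvg0.
  apply: ubd_sum => l; apply: ubdM; last exact: ub_bessel.
  apply: ubdD; first exact: ubd_wave.
  by apply: ubdM; [exact: ubd_freqV|exact: ubd_wave].
apply: unif0D; last first.
  apply: unif0N; apply: unif0_sum => l; apply: unif0_mul; first exact: ubd_wave.
  apply: unif0D; first exact: modulated_cvg.
  by apply: unif0_scale; [exact: freqV_cvg0|exact: ubd_modulated].
apply: unif0D; first exact: modulated_cvg.
by apply: unif0_scale; [exact: freqV_cvg0|exact: ubd_modulated].
Qed.

End high_frequency.

(** * Packet bounds uniform in the frequency *)
Section packet_bounds.
Variables (R : realType) (n : nat) (s : R) (k0 : 'I_n).
Local Notation normc := ComplexField.Normc.normc.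
Implicit Types (f g : 'rV[R]_n -> R[i]).

Lemma sqr_ge1_neq0 (nu : R) : 1 <= nu ^+ 2 -> nu != 0.
Proof. by move=> h; apply/eqP => nu0; move: h; rewrite nu0 expr0n /= ler10. Qed.

Lemma sqr_ge1_normV (nu : R) : 1 <= nu ^+ 2 -> `|nu^-1| <= 1.
Proof.
move=> h; have nu0 := sqr_ge1_neq0 h.
rewrite normfV invf_le1 ?normr_gt0//.
by rewrite -(@ler_pXn2r _ 2) ?nnegrE// expr1n real_normK ?num_real.
Qed.

(** Frequencies of both signs belong to one family: the negative ones occur when
a packet is conjugated. *)
Lemma bessel_packet_decay f g : wave f -> wave g -> exists K : R, 0 <= K /\
  forall nu : R, 1 <= nu ^+ 2 -> forall x,
    normc (bessel s (packet k0 nu f g) x) <= `|nu| `^ s * K * decay x.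
Proof.
move=> wf wg; pose I := {nu : R | 1 <= nu ^+ 2}.
have sb (i : I) := scale_bounds (dotp_e R k0) (svalP i).
have bound (h : 'rV[R]_n -> R[i]) : wave h -> exists K, 0 <= K /\ forall (i : I) x,
    normc (modulated_bessel s (scale (sval i)) (sval i *: delta_mx ord0 k0) h x) <= K * decay x.
  by apply: (@modulated_bessel_decay R n s I _ _ 2) => i; have [] := sb i.
have [C [C0 fC]] := bound f wf; have [D [D0 gD]] := bound g wg.
exists (C + D); split => [|nu nu1 x]; first exact: addr_ge0.
have nu0 := sqr_ge1_neq0 nu1.
rewrite bessel_packet// !ComplexField.Normc.normcM normc_cis mul1r normcR.
rewrite ger0_norm ?powR_ge0// -mulrA ler_wpM2l ?powR_ge0//.
rewrite (le_trans (normc_leD _ _))// mulrDl lerD//.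
  exact: (fC (exist _ nu nu1)).
rewrite ComplexField.Normc.normcM normcR.
apply: le_trans (gD (exist _ nu nu1) x).
by rewrite ler_piMl ?normc_ge0// sqr_ge1_normV.
Qed.

Lemma cpartial_packet_le f g : wave f -> wave g -> exists K : R, 0 <= K /\
  forall (nu : R), 1 <= nu ^+ 2 -> forall l x,
    normc (cpartial l (packet k0 nu f g) x) <= `|nu| * K.
Proof.
move=> wf wg.
have bound (h : 'rV[R]_n -> R[i]) : wave h -> exists C : R, 0 <= C /\ forall x, normc (h x) <= C.
  by move=> /ubd_wave[C [C0 hC]]; exists C; split => // x; exact: (hC 0).
have [A [A0 fA]] := bound f wf; have [B [B0 gB]] := bound g wg.
have boundl (h : 'rV[R]_n -> R[i]) : wave h -> exists C : R, 0 <= C /\ forall l x, normc (cpartial l h x) <= C.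
  move=> wh; have [C hC] := choice (fun l => bound _ (wave_cpartial l wh)).
  exists (\sum_l C l); split; first by apply: sumr_ge0 => l _; have [] := hC l.
  move=> l x; have [_ h1] := hC l; apply: le_trans (h1 x) _.
  by rewrite (bigD1 l)//= lerDl sumr_ge0// => j _; have [] := hC j.
have [C [C0 fC]] := boundl f wf; have [D [D0 gD]] := boundl g wg.
exists (A + B + C + D); split => [|nu nu1 l x]; first by rewrite !addr_ge0.
have nu0 := sqr_ge1_neq0 nu1.
have n1 : 1 <= `|nu|.
  by have := sqr_ge1_normV nu1; rewrite normfV invf_le1 ?normr_gt0.
rewrite cpartial_packet// ComplexField.Normc.normcM normc_cis mul1r.
have h01 : normc ('i * ((l == k0)%:R)%:C : R[i]) <= 1.
  rewrite ComplexField.Normc.normcM normc_i mul1r normcR.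
  by case: (l == k0); rewrite ?normr1 ?normr0.
have hz (h : 'rV[R]_n -> R[i]) y E : normc (h y) <= E ->
  normc ('i * ((l == k0)%:R)%:C * h y) <= E.
  move=> hE; apply: le_trans hE; rewrite ComplexField.Normc.normcM.
  by rewrite ler_piMl ?normc_ge0.
have t1 := hz f x A (fA x); have t2 := hz g x B (gB x).
have t3 : normc (nu%:C * ('i * ((l == k0)%:R)%:C * f x)) <= `|nu| * A.
  by rewrite ComplexField.Normc.normcM normcR ler_wpM2l.
have t4 : normc ((nu^-1)%:C * cpartial l g x) <= D.
  rewrite ComplexField.Normc.normcM normcR; apply: le_trans (gD l x).
  by rewrite ler_piMl ?normc_ge0// sqr_ge1_normV.
have nB := ler_peMl B0 n1; have nC := ler_peMl C0 n1; have nD := ler_peMl D0 n1.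
apply: le_trans (normc_leD _ _) _; rewrite -addrA.
apply: (@le_trans _ _ (`|nu| * A + (B + C) + D)).
  apply: lerD => //; apply: le_trans (normc_leD _ _) _; apply: lerD => //.
  by apply: le_trans (normc_leD _ _) _; apply: lerD.
by rewrite !mulrDr; lra.
Qed.

Lemma conj_packet nu f g x : conjc (packet k0 nu f g x) =
  packet k0 (- nu) (fun y => conjc (f y)) (fun y => - conjc (g y)) x.
Proof.
rewrite /packet /carrier conjcM conjcD conjcM conjc_cis conjc_real.
by rewrite scaleNr dotpNl invrN real_complexN mulrN mulNr opprK.
Qed.

(** Real velocity fields are taken from a complex packet as its real and its
imaginary part, both selected by one boolean. *)
Definition part (re : bool) (f : 'rV[R]_n -> R[i]) x : R :=
  if re then complex.Re (f x) else complex.Im (f x).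

(** The constant for which [part re f] is [part_cst re * f] plus its conjugate. *)
Definition part_cst (re : bool) : R[i] := if re then (2^-1)%:C else - 'i * (2^-1)%:C.

Lemma partE re f x : (part re f x)%:C =
  part_cst re * f x + conjc (part_cst re) * conjc (f x).
Proof.
by apply: complex_ext; case: re; rewrite /part /part_cst !cE /=; field.
Qed.

Lemma normc_part_cst re : normc (part_cst re) <= 1 /\ normc (conjc (part_cst re)) <= 1.
Proof.
have h : `|2^-1 : R| <= 1 by rewrite ger0_norm//; lra.
case: re; rewrite /part_cst; first by rewrite conjc_real normcR.
have ci : conjc (- 'i) = 'i :> R[i] by apply: complex_ext; rewrite !cE /=; ring.
by rewrite conjcM ci conjc_real !ComplexField.Normc.normcM normcR normc_opp normc_i mul1r.
Qed.

Lemma wave_part re f : wave f -> wave (fun x => (part re f x)%:C).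
Proof.
move=> wf; apply: (wave_eq (waveD (waveZ (part_cst re) wf)
  (waveZ (conjc (part_cst re)) (wave_conj wf)))) => x.
by rewrite partE.
Qed.

Lemma partial_part re f k x : partial k (part re f) x = part re (cpartial k f) x.
Proof. by case: re. Qed.

Lemma normr_part re f x : `|part re f x| <= normc (f x).
Proof. by case: re; [exact: normr_Re_le|exact: normr_Im_le]. Qed.

Lemma besselZ (a : R[i]) g x : wave g ->
  bessel s (fun y => a * g y) x = a * bessel s g x.
Proof.
move=> wg; transitivity ((a - 1) * bessel s g x + bessel s g x).
  rewrite -(bessel_lin s (a - 1) x wg wg); apply: bessel_eq => y.
  by rewrite mulrBl mul1r subrK.
by move: (bessel s g x) => B; rewrite mulrBl mul1r subrK.
Qed.

Lemma bessel_part_packet_decay f g : wave f -> wave g -> exists K : R, 0 <= K /\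
  forall (nu : R), 1 <= nu ^+ 2 -> forall re x,
    normc (bessel s (fun y => (part re (packet k0 nu f g) y)%:C) x) <=
    `|nu| `^ s * K * decay x.
Proof.
move=> wf wg; have [C [C0 hC]] := bessel_packet_decay wf wg.
have wg' : wave (fun y => - conjc (g y)).
  by apply: (wave_eq (waveZ (-1) (wave_conj wg))) => y; rewrite mulN1r.
have [D [D0 hD]] := bessel_packet_decay (wave_conj wf) wg'.
exists (C + D); split => [|nu nu1 re x]; first exact: addr_ge0.
have wp := wave_packet k0 nu wf wg.
have wp' := wave_packet k0 (- nu) (wave_conj wf) wg'.
rewrite (@bessel_eq _ _ _ _ (fun y => part_cst re * packet k0 nu f g y +
   conjc (part_cst re) * packet k0 (- nu) (fun y => conjc (f y)) (fun y => - conjc (g y)) y)); last first.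
  by move=> y; rewrite partE conj_packet.
rewrite (bessel_lin s _ x wp (waveZ _ wp')) (besselZ _ x wp').
apply: le_trans (normc_leD _ _) _.
have -> : `|nu| `^ s * (C + D) * decay x =
  `|nu| `^ s * C * decay x + `|nu| `^ s * D * decay x by ring.
have [p1 p2] := normc_part_cst re.
apply: lerD; rewrite ComplexField.Normc.normcM.
  by apply: le_trans (hC nu nu1 x); rewrite ler_piMl ?normc_ge0.
have nu1' : 1 <= (- nu) ^+ 2 by rewrite sqrrN.
rewrite -(normrN nu); apply: le_trans (hD _ nu1' x).
by rewrite ler_piMl ?normc_ge0.
Qed.

End packet_bounds.

(** * Polarisation of the assumed estimate *)
Section admissible.
Variables (R : realType) (n : nat) (p s M : R).
Hypotheses (p1 : 1 < p) (n0 : (0 < n)%N) (M0 : 0 < M).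

Definition cx (b : 'I_n -> 'rV[R]_n -> R) j x : R[i] := (b j x)%:C.

Definition field (b : 'I_n -> 'rV[R]_n -> R) (x : 'rV[R]_n) : 'rV[R]_n := \row_j b j x.

Lemma component_field b j : component (field b) j = b j.
Proof. by apply/funext => x; rewrite /component mxE. Qed.

Lemma ccomponent_field b : ccomponent (field b) = cx b.
Proof. by apply/funext => j; apply/funext => x; rewrite /ccomponent component_field. Qed.

Definition admissible (u : 'rV[R]_n -> 'rV[R]_n) :=
  [/\ forall j : 'I_n, schwartz (component u j),
      forall x, divergence u x = 0 &
      (\sum_(k < n) \sum_(j < n) bmo_norm (partial k (component u j)) <= 1)%E].

(** The share of each of the n^2 partial derivatives in the BMO budget 1, halved
because [le_bmo_norm] doubles. *)
Definition quota : R := (2 * n%:R ^+ 2)^-1.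

Lemma wave_real_schwartz b j : waves (cx b) -> schwartz (b j).
Proof. by move=> wb; have [h _] := wave_nice (wb j); exact: (snice_schwartz tt h). Qed.

Lemma wave_real_differentiable b j x : waves (cx b) -> differentiable (b j) x.
Proof. by move=> wb; have [h _] := wave_cdiff x (wb j). Qed.

Lemma admissible_field b : waves (cx b) ->
  (forall x, \sum_l partial l (b l) x = 0) ->
  (forall k j, osc (partial k (b j)) quota) -> admissible (field b).
Proof.
move=> wb db ob; split.
- by move=> j; rewrite component_field; exact: wave_real_schwartz.
- move=> x; rewrite -(db x); apply: eq_bigr => l _.
  by rewrite component_field.
- apply: (@le_trans _ _ (\sum_(k < n) \sum_(j < n) (2 * quota)%:E)%E).
    apply: lee_sum => k _; apply: lee_sum => j _.
    by rewrite component_field; exact: le_bmo_norm.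
  have nn : (n%:R : R) != 0 by rewrite pnatr_eq0 -lt0n.
  under eq_bigr do rewrite sumEFin sumr_const card_ord.
  rewrite sumEFin sumr_const card_ord lee_fin.
  suff -> : 2 * quota *+ n *+ n = 1 by [].
  by rewrite -mulrnA -[LHS]mulr_natr natrM /quota; field.
Qed.

Hypothesis H : forall u, admissible u ->
  (\sum_(j < n) cLnorm p (commutator s u j) <=
   M%:E * \sum_(j < n) cLnorm p (bessel s (ccomponent u j)))%E.

Variables (b w : 'I_n -> 'rV[R]_n -> R) (Db Dw del Cb Cw : R) (k0 : 'I_n).
Hypotheses (wb : waves (cx b)) (ww : waves (cx w)).
Hypotheses (db : forall x, \sum_l partial l (b l) x = 0)
  (dw : forall x, \sum_l partial l (w l) x = 0).
Hypotheses (ob : forall k j, osc (partial k (b j)) Db)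
  (ow : forall k j, osc (partial k (w j)) Dw).
Hypotheses (del0 : 0 < del) (small : del * Dw + Db <= quota).
Hypotheses (hCb : forall j, (cLnorm p (bessel s (cx b j)) <= Cb%:E)%E)
  (hCw : forall j, (cLnorm p (bessel s (cx w j)) <= Cw%:E)%E).

Let v (a : R) j x := a * w j x + b j x.

Let cxv a : cx (v a) = fun l y => a%:C * cx w l y + cx b l y.
Proof.
by apply/funext => l; apply/funext => y; rewrite /cx /v real_complexD real_complexM.
Qed.

Let waves_v a : waves (cx (v a)).
Proof. by move=> l; rewrite cxv; exact: wave_lin. Qed.

Let admissible_v a : `|a| = del -> admissible (field (v a)).
Proof.
move=> adel.
have pv k j x : partial k (v a j) x = a * partial k (w j) x + partial k (b j) x.
  have dwj := wave_real_differentiable j x ww.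
  have dbj := wave_real_differentiable j x wb.
  have g := gradientD (gradientZ a (conj dwj (fun=> erefl))) (conj dbj (fun=> erefl)).
  by rewrite [LHS]g.2.
apply: admissible_field => // [x|k j].
  under eq_bigr do rewrite pv.
  by rewrite big_split /= -mulr_sumr dw db mulr0 addr0.
have := oscD (oscZ a (ow k j)) (ob k j); rewrite adel => /(osc_le small).
by congr osc; apply/funext => x; rewrite pv.
Qed.

Let bessel_v a j : `|a| = del -> (cLnorm p (bessel s (cx (v a) j)) <= (del * Cw + Cb)%:E)%E.
Proof.
move=> adel; have mw := bessel_cmeasurable s (ww j); have mb := bessel_cmeasurable s (wb j).
have maw := cmeasurableM (cmeasurable_cst n a%:C) mw.
have e x : bessel s (cx (v a) j) x = a%:C * bessel s (cx w j) x + bessel s (cx b j) x.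
  by rewrite cxv bessel_lin.
apply: (@le_trans _ _ (cLnorm p (fun x => (a%:C * bessel s (cx w j) x)%R) + cLnorm p (bessel s (cx b j)))%E).
  apply: (cLnorm_le_add p1 (bessel_cmeasurable s (waves_v a j)) maw mb) => x.
  by rewrite e; exact: normc_leD.
rewrite (cLnormZ p1 a%:C mw) normcR adel EFinD EFinM; apply: leeD; last exact: hCb.
by apply: lee_wpmul2l; [rewrite lee_fin ltW|exact: hCw].
Qed.

Let commutator_v a : `|a| = del ->
  (cLnorm p (comm s (cx (v a)) (cx (v a) k0)) <= (M * (n%:R * (del * Cw + Cb)))%:E)%E.
Proof.
move=> adel; have := H (admissible_v adel); rewrite ccomponent_field => h.
have e j : cLnorm p (commutator s (field (v a)) j) = cLnorm p (comm s (cx (v a)) (cx (v a) j)).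
  rewrite -ccomponent_field; congr (cLnorm p _); apply/funext.
  by apply: commutatorE; rewrite ccomponent_field.
apply: (@le_trans _ _ (\sum_(j < n) cLnorm p (commutator s (field (v a)) j))%E).
  have eqle (y z : \bar R) : y = z -> (z <= y)%E by move=> ->.
  apply: (le_trans (eqle _ _ (e k0))).
  rewrite (bigD1 k0 isT).
  apply: leeDl.
  apply: sume_ge0 => j _.
  exact: cLnorm_ge0.
apply: le_trans h _; rewrite EFinM; apply: lee_wpmul2l; first by rewrite lee_fin ltW.
apply: (@le_trans _ _ (\sum_(j < n) (del * Cw + Cb)%:E)%E).
  by apply: lee_sum => j _; exact: bessel_v.
by rewrite sumEFin sumr_const card_ord mulr_natl.
Qed.

(** The assumed estimate is applied to b + del w and b - del w; the difference of
the two commutators is 2 del times the polarisation. *)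
Lemma polar_bound :
  (cLnorm p (polar s (cx b) (cx w) k0) <= (M * (n%:R * (Cw + Cb / del)))%:E)%E.
Proof.
have m a : cmeasurable (comm s (cx (v a)) (cx (v a) k0)) by exact: (comm_cmeasurable s (waves_v a) (waves_v a k0)).
have mp : cmeasurable (polar s (cx b) (cx w) k0) by exact: (polar_cmeasurable s k0 wb ww).
have h : (cLnorm p (fun x => ((2 * del)%:C * polar s (cx b) (cx w) k0 x)%R) <=
    (M * (n%:R * (del * Cw + Cb)))%:E + (M * (n%:R * (del * Cw + Cb)))%:E)%E.
  apply: (@le_trans _ _ (cLnorm p (comm s (cx (v del)) (cx (v del) k0)) +
     cLnorm p (comm s (cx (v (- del))) (cx (v (- del)) k0)))%E); last first.
    by apply: leeD; apply: commutator_v; rewrite ?normrN gtr0_norm.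
  apply: (cLnorm_le_add p1 (cmeasurableM (cmeasurable_cst n _) mp) (m _) (m _)) => x.
  have := comm_polarization s del%:C k0 x wb ww.
  have e2 : (2 * del)%:C = 2 * del%:C :> R[i].
    by rewrite real_complexM; congr (_ * _); rewrite (rmorph_nat (real_complex R) 2).
  rewrite !cxv real_complexN e2 => <-.
  by apply: le_trans (normc_leD _ _) _; rewrite normc_opp.
move: h; rewrite (cLnormZ p1 _ mp) normcR gtr0_norm ?mulr_gt0//.
move=> h; rewrite -(@lee_pmul2l _ (2 * del)%:E) ?lte_fin ?mulr_gt0//.
apply: le_trans h _.
rewrite -EFinD -EFinM lee_fin le_eqVlt; apply/orP; left; apply/eqP; field.
by rewrite gt_eqF.
Qed.

End admissible.

(** * Dilations *)
Section scaling.
Variables (R : realType) (n : nat).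

Lemma gradient_scale (f : 'rV[R]_n -> R) (t : R) x L : gradient f (t *: x) L ->
  gradient (fun y => f (t *: y)) x (fun v => L (t *: v)).
Proof.
move=> [df ef]; split=> [|v].
  by apply: (@differentiable_comp _ _ _ _ (fun y : 'rV[R]_n => t *: y) f).
rewrite -ef /derive.
rewrite (_ : (fun h : R => _) = fun h : R => h^-1 *: ((f \o shift (t *: x)) (h *: (t *: v))
   - f (t *: x))) //.
apply/funext => h /=; congr (_ *: (f _ - _)).
by rewrite scalerDr !scalerA (mulrC t).
Qed.

Lemma wave_scale (f : 'rV[R]_n -> R[i]) (t : R) : t != 0 -> wave f ->
  wave (fun x => f (t *: x)).
Proof.
move=> t0; elim=> {f} [c v c0|k f wf IH|a f g wf IHf wg IHg].
- have c1 : 0 < c * t ^+ 2 by rewrite mulr_gt0// lt_neqAle eq_sym sqrf_eq0 t0 sqr_ge0.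
  apply: (wave_eq (wave_gauss (t *: v) c1)) => x.
  rewrite dotpZl dotpZr /gauss !subr0 dotpZl dotpZr.
  by congr (_ * (expR _)%:C); field.
- by apply: (wave_eq (waveZ t%:C (wave_coord k IH))) => x; rewrite mxE real_complexM mulrA.
- exact: wave_lin.
Qed.

End scaling.

(** * Vortices, packets and the lacunary swirl *)
Section vortex.
Variables (R : realType) (n : nat) (k0 k1 : 'I_n).
Hypothesis k10 : k1 != k0.
Implicit Types (x y v : 'rV[R]_n).

Let k01 : k0 != k1. Proof. by rewrite eq_sym. Qed.

Definition rot (j : 'I_n) v : R :=
  if j == k0 then - v ord0 k1 else if j == k1 then v ord0 k0 else 0.

Lemma rotZ j (t : R) v : rot j (t *: v) = t * rot j v.
Proof.
by rewrite /rot; case: ifP => _; [|case: ifP => _]; rewrite ?mxE ?mulrN ?mulr0.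
Qed.

Lemma rot_cases j : [\/ rot j = (fun v => -1 * v ord0 k1),
  rot j = (fun v => v ord0 k0) | rot j = fun=> 0].
Proof.
have [j0|j0] := boolP (j == k0).
  by apply: Or31; apply/funext => v; rewrite /rot j0 mulN1r.
have [j1|j1] := boolP (j == k1).
  by apply: Or32; apply/funext => v; rewrite /rot (negbTE j0) j1.
by apply: Or33; apply/funext => v; rewrite /rot (negbTE j0) (negbTE j1).
Qed.

Lemma gradient_rot j x : gradient (rot j) x (rot j).
Proof.
case: (rot_cases j) => ->.
- exact: gradientZ (gradient_coord x k1).
- exact: gradient_coord.
- exact: gradient_cst.
Qed.

(** The field (d_k1 phi, - d_k0 phi) in the plane of the coordinates k0 and k1,
with phi the Gaussian as stream function; hence it is divergence free. *)
Definition vortex j y : R := rot j y * gauss 1 0 y.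

Lemma gradient_vortex j x : gradient (vortex j) x
  (fun v => gauss 1 0 x * (rot j v - dotp x v * rot j x)).
Proof.
have [d e] := gradientM (gradient_rot j x) (gradient_gauss 1 0 x).
by split => // v; rewrite e subr0; ring.
Qed.

Lemma partial_vortex l j x : partial l (vortex j) x =
  gauss 1 0 x * (rot j (delta_mx ord0 l) - x ord0 l * rot j x).
Proof. by rewrite /partial (gradient_vortex j x).2 dotp_deltar. Qed.

Lemma sum_two (V : nmodType) (F : 'I_n -> V) :
  (forall l, l != k0 -> l != k1 -> F l = 0) -> \sum_l F l = F k0 + F k1.
Proof.
move=> F0; rewrite (bigD1 k0)//= (bigD1 k1)//= big1 ?addr0// => l /andP[h1 h2].
exact: F0.
Qed.

Lemma divergence_vortex x : \sum_l partial l (vortex l) x = 0.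
Proof.
rewrite sum_two => [|l l0 l1]; rewrite !partial_vortex /rot.
  by rewrite !eqxx (negbTE k10) !mxE !eqxx (negbTE k10) (negbTE k01) /=; ring.
by rewrite (negbTE l0) (negbTE l1); ring.
Qed.

Lemma wave_gauss1 : wave (fun y => (gauss 1 0 y)%:C : R[i]).
Proof.
by apply: (wave_eq (wave_gauss 0 (@ltr01 R))) => y; rewrite dotp0l cis0 mul1r.
Qed.

Lemma waves_vortex : waves (cx vortex).
Proof.
move=> j; rewrite /cx /vortex; case: (rot_cases j) => ->.
- apply: (wave_eq (waveZ (-1)%:C (wave_coord k1 wave_gauss1))) => y.
  by rewrite !real_complexM mulrA.
- by apply: (wave_eq (wave_coord k0 wave_gauss1)) => y; rewrite real_complexM.
- by apply: (wave_eq (wave0 R n)) => y; rewrite mul0r.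
Qed.

Lemma snice_vortex j : snice (fun _ : unit => vortex j).
Proof. by have [h _] := wave_nice (waves_vortex j). Qed.

(** The field (d_k1, - d_k0) derived from the oscillating stream function
exp(i nu x_k0) phi / nu is the packet with leading amplitude [tilt] and
correction [vortex]. Its leading part is orthogonal to the direction k0 of
propagation. *)
Definition tilt (j : 'I_n) y : R[i] := if j == k1 then - 'i * (gauss 1 0 y)%:C else 0.

Lemma waves_tilt : waves tilt.
Proof.
move=> j; have [j1|j1] := boolP (j == k1).
  by apply: (wave_eq (waveZ (- 'i) wave_gauss1)) => y; rewrite /tilt j1.
by apply: (wave_eq (wave0 R n)) => y; rewrite /tilt (negbTE j1).
Qed.

Lemma tilt0 x : tilt k0 x = 0.
Proof. by rewrite /tilt (negbTE k01). Qed.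

Lemma divergence_packet (nu : R) x : nu != 0 ->
  \sum_l cpartial l (packet k0 nu (tilt l) (cx vortex l)) x = 0.
Proof.
move=> nu0.
under eq_bigr => l _ do
  rewrite (cpartial_packet k0 l x nu0 (@waves_tilt l) (@waves_vortex l)).
rewrite -mulr_sumr big_split /= -mulr_sumr.
have -> : \sum_l cpartial l (cx vortex l) x = 0.
  under eq_bigr do rewrite cpartial_real.
  by rewrite -rmorph_sum divergence_vortex.
have tilt_eq l : l != k1 -> tilt l = fun=> 0.
  by move=> l1; apply/funext => y; rewrite /tilt (negbTE l1).
rewrite mulr0 addr0 sum_two => [|l l0 l1]; last first.
  by rewrite (negbTE l0) tilt_eq// cpartial_cst !(mulr0, mul0r, addr0).
rewrite tilt_eq// cpartial_cst eqxx (negbTE k10).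
have -> : tilt k1 = fun y => - 'i * (gauss 1 0 y)%:C.
  by apply/funext => y; rewrite /tilt eqxx.
rewrite cpartialZ; last by apply: wave_cdiff; exact: wave_gauss1.
rewrite cpartial_gauss mxE /cx /vortex /rot eqxx subr0.
move: (gauss 1 0 x) => G.
rewrite mulN1r [in LHS]real_complexM !real_complexN.
apply/eqP; rewrite mulf_eq0; apply/orP; right; apply/eqP.
by rewrite -[true%:R]/(1 : R) -[false%:R]/(0 : R); ring.
Qed.

Section swirl.
Variables (K : nat) (eb : R).

(** Each dilate is multiplied by its scale, so that the gradients of the summands
are plain dilates of one gradient and add up near the origin. *)
Definition swirl j x : R := eb * \sum_(m < K) 4 ^+ m * vortex j ((4 ^+ m)^-1 *: x).

Lemma waves_swirl : waves (cx swirl).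
Proof.
move=> j.
have w m : wave (fun x => (4 ^+ m)%:C * cx vortex j ((4 ^+ m)^-1 *: x)).
  by apply/waveZ/wave_scale; [rewrite invr_eq0 expf_neq0|exact: waves_vortex].
apply: (wave_eq (waveZ eb%:C (wave_sum (index_enum 'I_K) (fun m : 'I_K => w m)))) => x.
rewrite /cx /swirl real_complexM rmorph_sum; congr (_ * _).
by apply: eq_bigr => m _; rewrite -real_complexM.
Qed.

Lemma partial_swirl k j x : partial k (swirl j) x =
  eb * \sum_(m < K) partial k (vortex j) ((4 ^+ m)^-1 *: x).
Proof.
have g := gradientZ eb (gradient_sum (index_enum 'I_K) (fun m : 'I_K =>
  gradientZ (4 ^+ m) (gradient_scale (gradient_vortex j ((4 ^+ m)^-1 *: x))))).
rewrite [LHS]g.2; congr (_ * _); apply: eq_bigr => m _.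
rewrite [RHS](gradient_vortex j _).2 rotZ dotpZr.
have h : (4 : R) ^+ m != 0 by rewrite expf_neq0.
by field.
Qed.

Lemma divergence_swirl x : \sum_l partial l (swirl l) x = 0.
Proof.
under eq_bigr do rewrite partial_swirl.
rewrite -mulr_sumr exchange_big /= big1 ?mulr0// => m _.
exact: divergence_vortex.
Qed.

Definition gauss_floor : R := expR (- (n%:R / 8)).

Lemma gauss_floor_gt0 : 0 < gauss_floor. Proof. exact: expR_gt0. Qed.

Lemma gauss_floor_le (t : R) x : 0 <= t <= 1 -> @unit_box R n x ->
  gauss_floor <= gauss 1 0 (t *: x).
Proof.
move=> /andP[t0 t1] bx; rewrite ler_expR subr0 mulNr lerN2 mul1r.
have h : dotp (t *: x) (t *: x) <= n%:R / 4.
  rewrite dotpZl dotpZr mulrA -expr2.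
  have d0 := dotp_ge0 x.
  apply: (@le_trans _ _ (dotp x x)); first by rewrite ler_piMl// expr_le1.
  rewrite -[n in n%:R]card_ord -sumr_const mulr_suml /dotp; apply: ler_sum => i _.
  by have := bx i; rewrite /= in_itv/= => /andP[h1 h2]; nra.
lra.
Qed.

(** On the box all summands have the same sign: d_k1 of component k0 of the
vortex is - (1 - x_k1^2) phi, and x_k1^2 <= 1/4. *)
Lemma partial_swirl_box x : 0 <= eb -> @unit_box R n x ->
  eb * K%:R * (3 / 4 * gauss_floor) <= `|partial k1 (swirl k0) x|.
Proof.
move=> eb0 bx; rewrite partial_swirl normrM ger0_norm// -mulrA ler_wpM2l//.
rewrite -[leRHS]normrN -sumrN; apply: le_trans (ler_norm _).
rewrite -[K in K%:R]card_ord mulr_natl -sumr_const.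
apply: ler_sum => m _.
have t0 : 0 <= ((4 : R) ^+ m)^-1 by rewrite invr_ge0 exprn_ge0.
have t1 : ((4 : R) ^+ m)^-1 <= 1.
  by rewrite invf_le1 ?exprn_gt0// exprn_ege1//; lra.
set t := ((4 : R) ^+ m)^-1 in t0 t1 *.
have gf : gauss_floor <= gauss 1 0 (t *: x) by apply: gauss_floor_le => //; rewrite t0.
rewrite partial_vortex /rot eqxx !mxE !eqxx /=.
have := bx k1; rewrite /= in_itv/= => /andP[h1 h2].
have g0 := gauss_floor_gt0.
have hx : (t * x ord0 k1) ^+ 2 <= 1 / 4.
  rewrite exprMn; have : t ^+ 2 <= 1 by rewrite expr_le1.
  have : x ord0 k1 ^+ 2 <= 1 / 4 by nra.
  have := sqr_ge0 (x ord0 k1); have := sqr_ge0 t; nra.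
have hy : 3 / 4 <= 1 - (t * x ord0 k1) ^+ 2 by lra.
rewrite -[true%:R]/(1 : R); move: (gauss 1 0 _) gf => G gf.
rewrite (_ : - (_ * _) = G * (1 - (t * x ord0 k1) ^+ 2)); last by ring.
by rewrite mulrC ler_pM// ?(ltW g0)//; lra.
Qed.

End swirl.

Lemma osc_swirl : (0 < n)%N -> exists L : R, 0 <= L /\ forall K eb k j,
  0 <= eb -> osc (partial k (swirl K eb j)) (eb * L).
Proof.
move=> n0.
have h (kj : 'I_n * 'I_n) : exists L : R, 0 <= L /\ forall K,
    osc (fun x => \sum_(m < K) partial kj.1 (vortex kj.2) ((4 ^+ m)^-1 *: x)) L.
  exact: (osc_lacunary_snice n0 (snice_partial kj.1 (snice_vortex kj.2))).
have [L hL] := choice h; exists (\sum_kj L kj); split.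
  by apply: sumr_ge0 => kj _; have [] := hL kj.
move=> K eb k j eb0; have [_ /(_ K) o] := hL (k, j).
have Lk : L (k, j) <= \sum_kj L kj.
  by rewrite (bigD1 (k, j))//= lerDl sumr_ge0// => kj _; have [] := hL kj.
have := oscZ eb (osc_le Lk o); rewrite ger0_norm//.
by congr osc; apply/funext => x; rewrite partial_swirl.
Qed.

End vortex.

(** * The contradiction *)
Section blowup.
Variables (R : realType) (n : nat) (p s M : R).
Hypotheses (p1 : 1 < p) (s1 : 1 < s) (M0 : 0 < M) (n2 : (2 <= n)%N).
Local Notation normc := ComplexField.Normc.normc.

Hypothesis H : forall u, @admissible R n u ->
  (\sum_(j < n) cLnorm p (commutator s u j) <=
   M%:E * \sum_(j < n) cLnorm p (bessel s (ccomponent u j)))%E.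

Let n0 : (0 < n)%N. Proof. exact: ltn_trans n2. Qed.
Let s0 : 0 < s. Proof. exact: lt_trans s1. Qed.
Let k0 : 'I_n := Ordinal n0.
Let k1 : 'I_n := Ordinal n2.
Let k10 : k1 != k0. Proof. by []. Qed.

Let pk (N : nat) : 'I_n -> 'rV[R]_n -> R[i] := packets k0 (tilt k1) (cx (vortex k0 k1)) N.
Let w (re : bool) N j : 'rV[R]_n -> R := part re (pk N j).

Let wpk N : waves (pk N).
Proof. by move=> j; apply: wave_packet; [exact: waves_tilt|exact: waves_vortex]. Qed.

Let ww re N : waves (cx (w re N)).
Proof. by move=> j; have := @wave_part R n re _ (wpk N j). Qed.

Let fn0 N : freq R N != 0. Proof. by rewrite gt_eqF ?freq_gt0. Qed.

Let divergence_w re N x : \sum_l partial l (w re N l) x = 0.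
Proof.
have h := divergence_packet k10 x (fn0 N).
under eq_bigr do rewrite /w partial_part.
transitivity (part re (fun y => \sum_l cpartial l (pk N l) y) x); last first.
  by rewrite /part /pk /packets h; case: re.
rewrite /part; case: re; first by rewrite (raddf_sum (@complex.Re R : Rcomplex R -> R)).
by rewrite (raddf_sum (@complex.Im R : Rcomplex R -> R)).
Qed.

Let osc_w : exists D : R, 0 <= D /\ forall re N k j,
  osc (partial k (w re N j)) (freq R N * D).
Proof.
have h j := cpartial_packet_le k0 (waves_tilt R k1 j) (waves_vortex R k0 k1 j).
have [D hD] := choice h; exists (\sum_j D j); split.
  by apply: sumr_ge0 => j _; have [] := hD j.
move=> re N k j; have [Dj0 Dj] := hD j.
have wk : wave (cpartial k (pk N j)) by apply: wave_cpartial; exact: wpk.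
rewrite (_ : partial k (w re N j) = part re (cpartial k (pk N j))); last first.
  by apply/funext => x; exact: partial_part.
apply: osc_bounded.
  by have [mr mi] := wave_cmeasurable wk; case: (re).
move=> x; apply: le_trans (normr_part _ _ _) _.
apply: le_trans (Dj _ (freq_sqr_ge1 R N) k x) _.
rewrite (gtr0_norm (freq_gt0 R N)) ler_wpM2l ?(ltW (freq_gt0 _ _))//.
by rewrite (bigD1 j)//= lerDl sumr_ge0// => i _; have [] := hD i.
Qed.

Let bessel_w : exists C : R, 0 <= C /\ forall re N j,
  (cLnorm p (bessel s (cx (w re N) j)) <= ((freq R N) `^ s * C)%:E)%E.
Proof.
have h j := bessel_part_packet_decay s k0 (waves_tilt R k1 j) (waves_vortex R k0 k1 j).
have [C hC] := choice h; pose dn := fine (@decay_norm R n p).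
have dn0 : 0 <= dn by apply: fine_ge0; exact: poweR_ge0.
exists (\sum_j C j * dn); split.
  by apply: sumr_ge0 => j _; have [? _] := hC j; exact: mulr_ge0.
move=> re N j; have [Cj0 Cj] := hC j.
have F0 : 0 <= freq R N `^ s by exact: powR_ge0.
apply: (@le_trans _ _ (((freq R N) `^ s * C j) * dn)%:E).
  apply: (cLnorm_decay_le p1 (mulr_ge0 F0 Cj0) (bessel_cmeasurable s (ww re N j))) => x.
  by have := Cj _ (freq_sqr_ge1 R N) re x; rewrite (gtr0_norm (freq_gt0 R N)).
rewrite lee_fin -mulrA ler_wpM2l// (bigD1 j)//= lerDl sumr_ge0// => i _.
by have [? _] := hC i; exact: mulr_ge0.
Qed.

Let bessel_real (b : 'I_n -> 'rV[R]_n -> R) : waves (cx b) -> exists C : R, 0 <= C /\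
  forall j, (cLnorm p (bessel s (cx b j)) <= C%:E)%E.
Proof.
move=> wb.
have h j : exists C : R, 0 <= C /\ (cLnorm p (bessel s (cx b j)) <= C%:E)%E.
  have [K [K0 hK]] := @modulated_bessel_decay R n s unit (fun=> 1) (fun=> 0) 1 (cx b j)
    (fun=> ltr01) (fun=> ltac:(by rewrite dotp0l addr0 mulr1))
    (fun=> ltac:(by rewrite dotp0l addr0 !mulr1)) (wb j).
  exists (K * fine (@decay_norm R n p)); split.
    by rewrite mulr_ge0// fine_ge0//; exact: poweR_ge0.
  apply: (cLnorm_decay_le p1 K0 (bessel_cmeasurable s (wb j))) => x.
  by rewrite besselE; exact: (hK tt).
have [C hC] := choice h; exists (\sum_j C j); split.
  by apply: sumr_ge0 => j _; have [] := hC j.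
move=> j; have [_ Cj] := hC j; apply: le_trans Cj _.
by rewrite lee_fin (bigD1 j)//= lerDl sumr_ge0// => i _; have [] := hC i.
Qed.

(** The order of the choices matters. The Sobolev constant [Cw] of the packets
does not depend on the background, so [K] can be chosen after it; the frequency
is chosen last, to absorb the Sobolev norm [Cb] of the background. *)
Lemma blowup_contradiction : False.
Proof.
have [Lb [Lb0 osc_b]] := @osc_swirl R n k0 k1 n0.
have [Dw [Dw0 oscw]] := osc_w.
have [Cw [Cw0 hCw]] := bessel_w.
have q0 : 0 < quota R n by rewrite invr_gt0 mulr_gt0// exprn_gt0// ltr0n.
set q := quota R n in q0.
(* The background and del times the packet use half of the quota each; c is
   del times the frequency. *)
pose eb := q / (2 * (Lb + 1)).
have eb0 : 0 < eb by rewrite divr_gt0// mulr_gt0//; lra.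
pose c := q / (2 * (Dw + 1)).
have c0 : 0 < c by rewrite divr_gt0// mulr_gt0//; lra.
have half (L : R) : 0 <= L -> q / (2 * (L + 1)) * L <= q / 2.
  move=> L0; rewrite mulrAC ler_pdivrMr; last by lra.
  by rewrite mulrA divfK//; nra.
pose gf := gauss_floor R n; have gf0 : 0 < gf by exact: gauss_floor_gt0.
pose A := eb * (3 / 4 * gf) * gf.
have A0 : 0 < A.
  by apply: (mulr_gt0 _ gf0); apply: (mulr_gt0 eb0); apply: (mulr_gt0 _ gf0); lra.
(* Real and imaginary parts each contribute M n Cw in the limit; the constant 4
   leaves room for the error terms. *)
pose B := 2 * (M * (n%:R * Cw)) + 4.
pose K := Num.truncn (B / A).
have KA : B <= A * K.+1%:R.
  by rewrite mulrC -ler_pdivrMr//; apply: ltW; exact: truncnS_gt.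
pose b := @swirl R n k0 k1 K.+1 eb.
have wb : waves (cx b) by exact: waves_swirl.
have [Cb [Cb0 hCb]] := bessel_real wb.
have h0 := @tilt0 R n k0 k1 k10.
have near1 := polar_packets_cvg s0 wb (waves_tilt R k1) (waves_vortex R k0 k1) h0 ltr01.
have s10 : 0 < s - 1 by rewrite subr_gt0.
pose E := M * (n%:R * (Cb / c)).
have E0 : 0 <= E by rewrite !mulr_ge0// ?(ltW M0)// invr_ge0 ltW.
have e1 : 0 < (E + 1)^-1 by rewrite invr_gt0 ltr_wpDl.
have /cvgr0_norm_le /(_ _ e1) near2 := freq_powR_cvg0 (R := R) s10.
have [N [hN1 hN2]] : exists N, (forall x, normc ((freq R N `^ (- s))%:C * carrier k0 (- freq R N) x *
      polar s (cx b) (pk N) k0 x - \sum_l tilt k1 l x * cpartial l (cx b k0) x) <= 1) /\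
    `|freq R N `^ (- (s - 1))| <= (E + 1)^-1.
  by near \oo => N; exists N; split; near: N.
set nu := freq R N in hN1 hN2.
have nu0 : 0 < nu by exact: freq_gt0.
have Q0 : 0 < nu `^ s by exact: powR_gt0.
pose del := c / nu.
have del0 : 0 < del by exact: divr_gt0.
have ub re : (cLnorm p (polar s (cx b) (cx (w re N)) k0) <=
    (M * (n%:R * (nu `^ s * Cw + Cb / del)))%:E)%E.
  apply: (@polar_bound R n p s M p1 n0 M0 H b (w re N) (q / 2) (nu * Dw) del Cb
    (nu `^ s * Cw) k0 wb (ww re N) (@divergence_swirl R n k0 k1 k10 K.+1 eb)
    (divergence_w re N) _ (oscw re N) del0 _ hCb (hCw re N)).
    by move=> k j; apply: osc_le (osc_b K.+1 eb k j (ltW eb0)); exact: half.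
  rewrite /del mulrA divfK ?(gt_eqF nu0)//.
  by have := half Dw Dw0; rewrite -/c -/q; lra.
have mp re := polar_cmeasurable s k0 wb (ww re N).
have mpk := polar_cmeasurable s k0 wb (wpk N).
have ubc : (cLnorm p (polar s (cx b) (pk N) k0) <=
    (M * (n%:R * (nu `^ s * Cw + Cb / del)))%:E + (M * (n%:R * (nu `^ s * Cw + Cb / del)))%:E)%E.
  apply: le_trans (leeD (ub false) (ub true)).
  apply: (cLnorm_le_add p1 mpk (mp false) (mp true)) => x.
  have -> : pk N = (fun l y => 'i * cx (w false N) l y + cx (w true N) l y).
    apply/funext => l; apply/funext => y; rewrite /cx /w /part.
    by rewrite addrC -complexE.
  rewrite (polar_lin s 'i k0 x wb (ww false N) (ww true N)).
  by apply: le_trans (normc_leD _ _) _; rewrite ComplexField.Normc.normcM normc_i mul1r.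
have lb : ((nu `^ s * (B - 1))%:E <= cLnorm p (polar s (cx b) (pk N) k0))%E.
  apply: (cLnorm_ge_box p1) => //.
    rewrite mulr_ge0 ?(ltW Q0)// /B.
    have : 0 <= M * (n%:R * Cw) by rewrite !mulr_ge0// ltW.
    lra.
  move=> x bx; have := hN1 x.
  rewrite (sum_two k10); last by move=> l _ l1; rewrite /tilt (negbTE l1) mul0r.
  rewrite h0 mul0r add0r cpartial_real.
  set P := polar _ _ _ _ x; set T := tilt k1 k1 x * _ => h.
  have Tb : B <= normc T.
    apply: le_trans KA _.
    rewrite ComplexField.Normc.normcM normcR /tilt eqxx ComplexField.Normc.normcM.
    rewrite normc_opp normc_i mul1r normcR (gtr0_norm (gauss_gt0 _ _ _)).
    have g1 : gf <= gauss 1 0 x.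
      by rewrite -[x]scale1r; apply: gauss_floor_le => //; rewrite ler01 lexx.
    have := @partial_swirl_box R n k0 k1 K.+1 eb x (ltW eb0) bx; rewrite -/b -/gf => g2.
    rewrite (_ : A * _ = gf * (eb * K.+1%:R * (3 / 4 * gf))); last by rewrite /A; ring.
    apply: (ler_pM (ltW gf0) _ g1 g2); apply: mulr_ge0.
      by rewrite mulr_ge0 ?ler0n ?(ltW eb0).
    by apply: (mulr_ge0 _ (ltW gf0)); lra.
  have tri : normc T <= normc ((nu `^ (- s))%:C * carrier k0 (- nu) x * P) + 1.
    rewrite -lerBlDl; apply: le_trans _ h.
    set Z := _ * P; rewrite lerBlDl -[in leLHS](subrK Z T).
    by apply: le_trans (normc_leD _ _) _; rewrite addrC -opprB normc_opp lerD2l.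
  have nP : normc ((nu `^ (- s))%:C * carrier k0 (- nu) x * P) = (nu `^ s)^-1 * normc P.
    rewrite 2!ComplexField.Normc.normcM normc_cis mulr1 normcR powRN.
    by rewrite ger0_norm// invr_ge0 ltW.
  by rewrite mulrC -ler_pdivlMr// mulrC; move: tri; rewrite nP; lra.
have := le_trans lb ubc; rewrite -EFinD lee_fin => fin.
have nus : nu `^ (- (s - 1)) * nu `^ s = nu.
  rewrite -powRD; last by rewrite (gt_eqF nu0) implybT.
  by rewrite (_ : - (s - 1) + s = 1); [rewrite powRr1// ltW|ring].
have e2 : M * (n%:R * (Cb / del)) = E * nu.
  by rewrite /E /del; field; rewrite !gt_eqF.
have hE : E * nu <= nu `^ s.
  rewrite (_ : E * nu = E * nu `^ (- (s - 1)) * nu `^ s); last by rewrite -mulrA nus.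
  rewrite ler_piMl ?(ltW Q0)//; rewrite ger0_norm ?powR_ge0// in hN2.
  apply: (@le_trans _ _ (E * (E + 1)^-1)); first by rewrite ler_wpM2l.
  by rewrite ler_pdivrMr; lra.
have : nu `^ s * (B - 1) <= 2 * (M * (n%:R * (nu `^ s * Cw))) + 2 * (E * nu).
  by rewrite -e2; apply: le_trans fin _; lra.
rewrite (_ : M * (n%:R * (nu `^ s * Cw)) = nu `^ s * (M * (n%:R * Cw))); last by ring.
rewrite /B; move: (M * (n%:R * Cw)) (E * nu) hE Q0 => F G; move: (nu `^ s) => Q.
by nra.
Unshelve. all: by end_near. Qed.

End blowup.

Theorem proposition9p3 (R : realType) (d : nat) (hd : (2 <= d)%N)
    (p s : R) (hp : 1 < p) (hs : 1 + d%:R / p < s) (M : R) (hM : 0 < M) :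
  exists u : 'rV[R]_d -> 'rV[R]_d,
    [/\ forall j : 'I_d, schwartz (component u j),
        forall x : 'rV[R]_d, divergence u x = 0,
        (\sum_(k < d) \sum_(j < d) bmo_norm (partial k (component u j)) <= 1)%E &
        (M%:E * \sum_(j < d) cLnorm p (bessel s (ccomponent u j)) <
          \sum_(j < d) cLnorm p (commutator s u j))%E].
Proof.
apply: contrapT => nex.
have s1 : 1 < s.
  apply: le_lt_trans hs; rewrite lerDl divr_ge0// ltW//.
  exact: lt_trans hp.
apply: (@blowup_contradiction R d p s M hp s1 hM hd) => u [u1 u2 u3].
rewrite leNgt; apply/negP => lt; apply: nex; exists u; split => //.
Qed.
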